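(* Let $(\bar x,\bar u)$ be a weak local minimizer of problem (P) such that $\bar g(0)=0$ and $\bar g_u(0)=0$ (in the sense of essential limits). Assume there exist $\varepsilon>0$ and a non-decreasing function $\omega:(0,1]\to(0,\infty)$ with $\int_0^1\omega(t)^{-1}\,dt<\infty$ such that $|\bar g_u(t)|\ge\omega(t)$ for a.e. $t\in\{\bar g\ge-\varepsilon\}$. Suppose moreover that there exists $(y,v)\in W^{1,1}([0,1];\mathbb R^n)\times L^\infty([0,1];\mathbb R^m)$ solving the linear system $$\dot y(t)=\bar f_x(t)y(t)+\bar f_u(t)v(t)\ \text{ a.e.},\qquad y(0)=0,$$ and satisfying $$\bar g_x(t)y(t)+\bar g_u(t)v(t)<0\qquad\text{for a.e. }t\in\{\bar g=0\}.$$ Then there exists a multiplier tuple $(\lambda,\beta,\lambda_0,z,\zeta)$ for (P) at $(\bar x,\bar u)$ with $\zeta=0$, $\beta\equiv0$ and $\lambda_0>0$; in particular, after normalization one may take $\lambda_0=1$.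
   Context: Notation. $|\cdot|$ is the Euclidean norm; ''a.e.'' refers to Lebesgue measure $\mathrm{Leb}$; $\mathfrak L$ is the $\sigma$-algebra of Lebesgue measurable subsets of $[0,1]$. $BV([0,1];\mathbb R^n)$ denotes functions of bounded variation that are right-continuous on $(0,1)$. A measurable $k:[0,1]\to\mathbb R$ has essential limit $\alpha$ at $t$ if for every $\varepsilon>0$ there is a neighborhood $V$ of $t$ with $|k(s)-\alpha|<\varepsilon$ for a.e. $s\in V\cap[0,1]$; for $k$ in a Lebesgue space, ''$k(t)=\alpha$'' at a given instant $t$ means that the essential limit exists and equals $\alpha$ (componentwise for vector functions). Problem (P): minimize $J(x,u)=\int_0^1L(t,x(t),u(t))\,dt$ over $(x,u)\in W^{1,1}([0,1];\mathbb R^n)\times L^\infty([0,1];\mathbb R^m)$ subject to $\dot x(t)=f(t,x(t),u(t))$ a.e., $g(t,x(t),u(t))\le 0$ a.e., $x(0)=x_0$, where $x_0\in\mathbb R^n$ is fixed and $(L,f,g):[0,1]\times\mathbb R^n\times\mathbb R^m\to\mathbb R\times\mathbb R^n\times\mathbb R$ are continuous in $(t,x,u)$ and continuously differentiable in $(x,u)$ (derivatives jointly continuous in $(t,x,u)$). Pairs satisfying the constraints are admissible processes. A weak local minimizer is an admissible $(\bar x,\bar u)$ for which there is $\varepsilon>0$ with $J(\bar x,\bar u)\le J(x,u)$ for all admissible $(x,u)$ with $\|x-\bar x\|_C<\varepsilon$, $\|u-\bar u\|_{L^\infty}<\varepsilon$. A bar denotes evaluation along $(\bar x,\bar u)$: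 $\bar k(t)=k(t,\bar x(t),\bar u(t))$; $\bar L_x,\bar L_u,\bar g_x,\bar g_u$ are row vectors and $\bar f_x,\bar f_u$ Jacobian matrices. $\{\bar g\ge-\varepsilon\}=\{t\in[0,1]:\bar g(t)\ge-\varepsilon\}$ and $\{\bar g=0\}=\{t\in[0,1]:\bar g(t)=0\}$. Charges. A charge is a finitely additive set function on $\mathfrak L$ vanishing at $\emptyset$; $\operatorname{ba}$ denotes the bounded charges vanishing on Lebesgue null sets (isometric to $L^\infty([0,1];\mathbb R)^*$ with the total variation norm). A positive charge $\zeta$ is pure if the only countably additive measure $\mu$ with $0\le\mu\le\zeta$ is $\mu=0$. For $k\in L^\infty$, $\int_E k\,d\zeta$ is the limit of integrals of simple functions converging to $k\chi_E$ uniformly a.e. (componentwise for vectors). For $\zeta\ge0$, ''$k=0$ $\zeta$-a.e.'' means $\zeta(\{|k|>\varepsilon\})=0$ for all $\varepsilon>0$. Multiplier tuple for (P) at $(\bar x,\bar u)$: $(\lambda,\beta,\lambda_0,z,\zeta)$ with $\lambda_0\ge0$ a scalar, $z\in L^1([0,1];\mathbb R)$, $z\ge0$, $\zeta\in\operatorname{ba}$ a pure charge, $\zeta\ge0$, $\lambda,\beta\in BV([0,1];\mathbb R^n)$ such that: (a) $\lambda_0+\|z\|_{L^1}+\zeta([0,1])>0$; (b) $z(t)\bar g(t)=0$ a.e. and $\bar g=0$ $\zeta$-a.e.; (c) $\lambda(1)=\beta(1)=0$, $-d\lambda=[\bar f_x^T\lambda+\lambda_0\bar L_x^T+z\bar g_x^T]\,dt+d\beta$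 (as measures on $[0,1]$), where $\beta(0)=-\int_0^1\bar g_x^T\,d\zeta$ and $\beta(t)=-\lim_{k\to\infty}\int_{t+1/k}^1\bar g_x^T\,d\zeta$ for $t\in(0,1)$; (d) $0=\bar f_u^T\lambda+\lambda_0\bar L_u^T+\bar g_u^Tz$ a.e., and $\int_E\bar g_u^T\,d\zeta=0$ for every $E\in\mathfrak L$. *)

(* Defs.v *)
From HB Require Import structures.
From mathcomp Require Export all_boot all_order all_algebra.
From mathcomp Require Export all_classical all_reals all_analysis.

Set Implicit Arguments.
Unset Strict Implicit.
Unset Printing Implicit Defensive.

Import Order.TTheory GRing.Theory Num.Theory.
Import numFieldNormedType.Exports HBSimple.

Local Open Scope classical_set_scope.
Local Open Scope ring_scope.

(* The real line with the sigma-algebra of all Lebesgue (not only Borel)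
   measurable sets, and the Lebesgue measure on it. *)
Notation lebT R := (caratheodory_type (R := R) (wlength idfun)^*%mu).
Notation Leb := completed_lebesgue_measure.

(* Functions "on [0,1]" are total functions on R of which only the values on
   [0,1] matter. *)
Definition ae01 (R : realType) (Q : R -> Prop) : Prop :=
  \forall t \ae (@Leb R), 0 <= t <= 1 -> Q t.

(* Euclidean norm of a column or row vector (the library norm on matrices is
   the maximum norm) *)
Definition eucl (R : realType) p q (A : 'M[R]_(p, q)) : R :=
  Num.sqrt (\sum_i \sum_j A i j ^+ 2).

Section FunctionSpaces.
Variable R : realType.

Definition meas01 (k : R -> R) : Prop :=
  measurable_fun (`[0, 1] : set (lebT R)) (k : lebT R -> R).

Definition ess_norm (k : R -> R) : \bar R :=
  ('N[@Leb R]_+oo[((EFin \o k) \_ `[0%R, 1%R])])%E.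

Definition inL1 (k : R -> R) : Prop :=
  (@Leb R).-integrable `[0, 1] (EFin \o k).

Definition Linf_norm p (u : R -> 'cV[R]_p) : \bar R :=
  ess_norm (fun t => eucl (u t)).

Definition inLinf p (u : R -> 'cV[R]_p) : Prop :=
  (forall i, meas01 (fun t => u t i 0)) /\ (Linf_norm u < +oo)%E.

Definition C_norm p (x : R -> 'cV[R]_p) : \bar R :=
  ereal_sup [set (eucl (x t))%:E | t in `[0%R, 1%R]].

(* x is the absolutely continuous representative of an element of
   W^{1,1}([0,1]; R^p) whose derivative is (the L^1-class of) w *)
Definition W11_deriv p (x w : R -> 'cV[R]_p) : Prop :=
  (forall i, inL1 (fun t => w t i 0)) /\
  (forall t, 0 <= t <= 1 -> forall i,
     x t i 0 = x 0 i 0 + \int[@Leb R]_(s in `[0, t]) w s i 0).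

Definition inBV p (phi : R -> 'cV[R]_p) : Prop :=
  forall i, bounded_variation 0 1 (fun t => phi t i 0) /\
    (forall t, 0 < t < 1 -> phi s i 0 @[s --> t^'+] --> phi t i 0).

Definition ess_lim (k : R -> R) (t a : R) : Prop :=
  forall e, 0 < e -> exists2 V : set R, nbhs t V &
    \forall s \ae (@Leb R), V s -> 0 <= s <= 1 -> `|k s - a| < e.

(* nu restricted to the Borel subsets of [0,1] is the signed measure d(phi) of
   a function phi of bounded variation that is right-continuous on ]0,1[; the
   jumps of phi at the end points are counted, so that
   d(phi)({0}) = phi(0+) - phi(0) and d(phi)({1}) = phi(1) - phi(1-). *)
Definition is_stieltjes (phi : R -> R)
    (nu : {charge set (measurableTypeR R) -> \bar R}) : Prop :=
  (forall t, 0 < t < 1 -> nu `[0, t]%classic = (phi t - phi 0)%:E) /\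
  nu `[0, 1]%classic = (phi 1 - phi 0)%:E.

End FunctionSpaces.

Section Charges.
Variable R : realType.
Implicit Type zeta : {additive_charge set (lebT R) -> \bar R}.

(* Charges on the Lebesgue subsets of [0,1] are represented by the charges on
   the Lebesgue subsets of R that do not see the complement of [0,1]; the first
   clause expresses this together with the vanishing on null sets. *)
Definition is_ba zeta : Prop :=
  (forall A : set (lebT R), measurable A -> @Leb R (A `&` `[0%R, 1%R]%classic) = 0%E -> zeta A = 0%E) /\
  (exists M : R, forall A : set (lebT R), measurable A -> (`|zeta A| <= M%:E)%E).

Definition charge_ge0 zeta : Prop := forall A : set (lebT R), measurable A -> (0 <= zeta A)%E.

Definition pure_charge zeta : Prop :=
  forall mu : {measure set (lebT R) -> \bar R},
    (forall A : set (lebT R), measurable A -> (mu A <= zeta A)%E) ->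
    forall A : set (lebT R), measurable A -> mu A = 0%E.

(* v is the integral of k over E with respect to zeta; library [sintegral] only
   needs a set function, hence also makes sense for a charge. *)
Definition is_charge_int zeta (E : set R) (k : R -> R) (v : R) : Prop :=
  exists s : nat -> {sfun (lebT R) >-> R},
    (ess_norm (fun t => (s j : lebT R -> R) t - k t * \1_E t)
       @[j --> \oo] --> 0%E) /\
    (sintegral zeta (s j) @[j --> \oo] --> v%:E).

Definition charge_ae0 zeta (k : R -> R) : Prop :=
  forall e, 0 < e -> zeta [set t : R | 0 <= t <= 1 /\ e < `|k t|] = 0%E.

End Charges.

Section Problem.
Variables (R : realType) (n m : nat).

Record problem := Problem {
  P_x0 : 'cV[R]_n;
  P_L : R -> 'cV[R]_n -> 'cV[R]_m -> R;
  P_f : R -> 'cV[R]_n -> 'cV[R]_m -> 'cV[R]_n;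
  P_g : R -> 'cV[R]_n -> 'cV[R]_m -> R
}.

Definition grad p (h : 'cV[R]_p -> R) (x : 'cV[R]_p) : 'rV[R]_p :=
  \row_j 'D_(delta_mx j 0) h x.

Definition grad_x (h : R -> 'cV[R]_n -> 'cV[R]_m -> R) t x u : 'rV[R]_n :=
  grad (fun y => h t y u) x.
Definition grad_u (h : R -> 'cV[R]_n -> 'cV[R]_m -> R) t x u : 'rV[R]_m :=
  grad (h t x) u.

Definition jac_x (h : R -> 'cV[R]_n -> 'cV[R]_m -> 'cV[R]_n) t x u : 'M[R]_n :=
  \matrix_i grad_x (fun s y v => h s y v i 0) t x u.
Definition jac_u (h : R -> 'cV[R]_n -> 'cV[R]_m -> 'cV[R]_n) t x u :
    'M[R]_(n, m) :=
  \matrix_i grad_u (fun s y v => h s y v i 0) t x u.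

Definition dom01 : set (R * ('cV[R]_n * 'cV[R]_m)) := [set p | 0 <= p.1 <= 1].

Definition C1_data (h : R -> 'cV[R]_n -> 'cV[R]_m -> R) : Prop :=
  [/\ {within dom01, continuous (fun p => h p.1 p.2.1 p.2.2)},
      forall t, 0 <= t <= 1 -> forall x u,
        differentiable (fun q : 'cV[R]_n * 'cV[R]_m => h t q.1 q.2) (x, u),
      {within dom01, continuous (fun p => grad_x h p.1 p.2.1 p.2.2)} &
      {within dom01, continuous (fun p => grad_u h p.1 p.2.1 p.2.2)}].

Definition regular (P : problem) : Prop :=
  [/\ C1_data (P_L P), forall i, C1_data (fun t x u => P_f P t x u i 0) &
      C1_data (P_g P)].

Definition admissible (P : problem) (x : R -> 'cV[R]_n) (u : R -> 'cV[R]_m) :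
    Prop :=
  [/\ exists2 dx, W11_deriv x dx & ae01 (fun t => dx t = P_f P t (x t) (u t)),
      inLinf u,
      ae01 (fun t => P_g P t (x t) (u t) <= 0) &
      x 0 = P_x0 P].

Definition cost (P : problem) (x : R -> 'cV[R]_n) (u : R -> 'cV[R]_m) : R :=
  \int[@Leb R]_(t in `[0, 1]) P_L P t (x t) (u t).

Definition weak_local_minimizer (P : problem) (xb : R -> 'cV[R]_n)
    (ub : R -> 'cV[R]_m) : Prop :=
  admissible P xb ub /\
  exists2 e : R, 0 < e & forall x u, admissible P x u ->
    (C_norm (fun t => x t - xb t)%R < e%:E)%E ->
    (Linf_norm (fun t => u t - ub t)%R < e%:E)%E ->
    cost P xb ub <= cost P x u.

Definition bar (T : Type) (h : R -> 'cV[R]_n -> 'cV[R]_m -> T)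
    (xb : R -> 'cV[R]_n) (ub : R -> 'cV[R]_m) (t : R) : T :=
  h t (xb t) (ub t).

Definition linear_system (P : problem) xb ub (y : R -> 'cV[R]_n)
    (v : R -> 'cV[R]_m) : Prop :=
  [/\ exists2 dy, W11_deriv y dy &
        ae01 (fun t => dy t = bar (jac_x (P_f P)) xb ub t *m y t
                              + bar (jac_u (P_f P)) xb ub t *m v t),
      inLinf v &
      y 0 = 0].

Record multiplier (P : problem) (xb : R -> 'cV[R]_n) (ub : R -> 'cV[R]_m)
    (lam bet : R -> 'cV[R]_n) (lam0 : R) (z : R -> R)
    (zeta : {additive_charge set (lebT R) -> \bar R}) : Prop := Multiplier {
  mult_lam0 : 0 <= lam0;
  mult_zL1 : inL1 z;
  mult_z_ge0 : ae01 (fun t => 0 <= z t);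
  mult_zeta_ba : is_ba zeta;
  mult_zeta_ge0 : charge_ge0 zeta;
  mult_zeta_pure : pure_charge zeta;
  mult_lam_BV : inBV lam;
  mult_bet_BV : inBV bet;
  mult_nontriv :
    0 < lam0 + \int[@Leb R]_(t in `[0, 1]) `|z t| + fine (zeta `[0%R, 1%R]%classic);
  mult_compl : ae01 (fun t => z t * bar (P_g P) xb ub t = 0);
  mult_compl_zeta : charge_ae0 zeta (bar (P_g P) xb ub);
  mult_end : lam 1 = 0 /\ bet 1 = 0;
  mult_adjoint : forall i,
    exists dlam dbet : {charge set (measurableTypeR R) -> \bar R},
    [/\ is_stieltjes (fun t => lam t i 0) dlam,
        is_stieltjes (fun t => bet t i 0) dbet &
        forall B : set (measurableTypeR R), measurable B -> B `<=` `[0, 1] ->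
          (- dlam B =
           \int[@Leb R]_(t in B)
             (((bar (jac_x (P_f P)) xb ub t)^T *m lam t
               + lam0 *: (bar (grad_x (P_L P)) xb ub t)^T
               + z t *: (bar (grad_x (P_g P)) xb ub t)^T)%R i 0)%:E
           + dbet B)%E];
  mult_bet0 : forall i,
    is_charge_int zeta `[0, 1] (fun t => bar (grad_x (P_g P)) xb ub t 0 i)
      (- bet 0 i 0);
  mult_bet : forall t, 0 < t < 1 -> forall i,
    exists2 v : nat -> R,
      (forall k, is_charge_int zeta `[t + k.+1%:R^-1, 1]
         (fun s => bar (grad_x (P_g P)) xb ub s 0 i) (v k)) &
      - v k @[k --> \oo] --> bet t i 0;
  mult_stationary : ae01 (fun t =>
    0 = (bar (jac_u (P_f P)) xb ub t)^T *m lam t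
        + lam0 *: (bar (grad_u (P_L P)) xb ub t)^T
        + z t *: (bar (grad_u (P_g P)) xb ub t)^T);
  mult_stationary_zeta : forall (E : set (lebT R)) j, measurable E ->
    is_charge_int zeta E (fun t => bar (grad_u (P_g P)) xb ub t 0 j) 0
}.

End Problem.

(* Main.v *)
(* Where the constraint is almost active, q = gu^T / |gu|^2 is a right inverse of
   the row vector gu, with |q| <= 1 / omega integrable. Eliminating z from the
   stationarity condition by z = - q . (fu^T lam + Lu^T) turns the adjoint
   equation into a linear equation with L^1 coefficients, solved backwards from
   lam 1 = 0. That this z works is seen from the perturbed controls
   u = ub + s v - (gx xi) q, supported in [dl, 1]: by the feedback term the
   constraint varies as s gu v only, so they are admissible as soon as
   gu v <= - kappa < 0 on the almost active set. Optimality then gives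
   int v . (fu^T lam + Lu^T) >= 0, and a suitable v (made strictly feasible by
   - kappa q) followed by kappa -> 0, eta -> 0, dl -> 0 yields z >= 0,
   complementarity and stationarity. *)

(* Near 0 the right inverse [q] may be unbounded, whereas a competing control must stay uniformly
   close to [ub]; this is why competitors differ from [ub] only on [dl, 1]. The adjoint equation
   tolerates the singularity, since it asks only for L^1 coefficients: [lam] and [z] are built once,
   from [q] on all of [0, 1], independently of [dl], [eta], [kappa] and [v], so that no limit of
   multipliers has to be taken. The term of the adjoint equation that carries [z] is exactly what
   the feedback - (gx xi) q costs, and the two cancel to first order. With h = fu^T lam + Lu^T, the
   direction v + kappa q is the projection of - h onto the half-space gu w <= 0 where g >= - eta,
   and - h itself elsewhere on [dl, 1]. Then v . h is minus the squared length of that projection,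
   up to a term of order kappa, so that int v . h >= 0 makes the projection vanish. Its vanishing
   for all small eta contains the sign of z, complementarity and stationarity together. *)
Require Import Defs.
From mathcomp Require Import ring lra measurable_realfun ess_sup_inf.

Set Implicit Arguments.
Unset Strict Implicit.
Unset Printing Implicit Defensive.

Import Order.TTheory GRing.Theory Num.Theory.
Import numFieldNormedType.Exports HBSimple.

Local Open Scope classical_set_scope.
Local Open Scope ring_scope.

(** * Integration on the unit interval *)

Section Lebesgue01.
Variable R : realType.
Implicit Types (h k : R -> R) (D : set (lebT R)).

Lemma lebT_measurable_borel (A : set R) :
  measurable (A : set (measurableTypeR R)) -> measurable (A : set (lebT R)).
Proof. exact: sub_caratheodory. Qed.

Lemma lebT_itv (i : interval R) : measurable ([set` i] : set (lebT R)).
Proof. by apply: lebT_measurable_borel; exact: measurable_itv. Qed.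

Lemma lebT_measurable_fun_borel (A : set R) (h : R -> R) :
  measurable_fun (A : set (measurableTypeR R)) h ->
  measurable (A : set (measurableTypeR R)) ->
  measurable_fun (A : set (lebT R)) (h : lebT R -> R).
Proof.
by move=> mh mA _ Y mY; apply: lebT_measurable_borel; exact: mh.
Qed.

Lemma Leb_itvcc (a b : R) : a <= b ->
  @Leb R (`[a, b]%classic : set (lebT R)) = (b - a)%:E.
Proof.
move=> ab; transitivity (@lebesgue_measure R `[a, b]%classic) => //.
rewrite lebesgue_measure_itv/= lte_fin.
by move: ab; case: ltgtP => // -> _; rewrite subrr.
Qed.

Lemma Leb_itvoc (a b : R) : a <= b ->
  @Leb R (`]a, b]%classic : set (lebT R)) = (b - a)%:E.
Proof.
move=> ab; transitivity (@lebesgue_measure R `]a, b]%classic) => //.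
rewrite lebesgue_measure_itv/= lte_fin.
by move: ab; case: ltgtP => // -> _; rewrite subrr.
Qed.

Lemma Leb_set1 (a : R) : @Leb R ([set a] : set (lebT R)) = 0%E.
Proof. exact: (@lebesgue_measure_set1 R a). Qed.

Lemma Leb_Rintegral_set1 (a : R) h : \int[@Leb R]_(t in [set a]) h t = 0.
Proof.
apply: (congr1 fine (y := 0%E)); apply: (@null_set_integral _ (lebT R)).
- rewrite -set_itv1; exact: lebT_itv.
- move=> _ Y mY; have [ha|ha] := pselect (Y (h a)%:E).
    rewrite [X in measurable X](_ : _ = [set a]).
      rewrite -set_itv1; exact: lebT_itv.
    by apply/seteqP; split => [t []//|t ->].
  rewrite [X in measurable X](_ : _ = set0) ?measurable0//.
  by apply/seteqP; split => [t [->]//|t].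
- exact: Leb_set1.
Qed.

Lemma subI0t (t : R) : t <= 1 -> `[0, t]%classic `<=` `[0, 1]%classic.
Proof. by move=> t1; apply: subset_itvl; rewrite bnd_simp. Qed.

Lemma subIt1 (t : R) : 0 <= t -> `[t, 1]%classic `<=` `[0, 1]%classic.
Proof. by move=> t0; apply: subset_itvr; rewrite bnd_simp. Qed.

Lemma inL1S h D : inL1 h -> measurable D -> D `<=` `[0, 1]%classic ->
  (@Leb R).-integrable D (EFin \o h).
Proof. by move=> hL mD DI; apply: integrableS hL => //; exact: lebT_itv. Qed.

Lemma inL1_meas h : inL1 h -> meas01 h.
Proof. by move=> /measurable_int/measurable_EFinP. Qed.

Lemma inL1_le h k : meas01 k -> inL1 h ->
  (forall t, 0 <= t <= 1 -> `|k t| <= h t) -> inL1 k.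
Proof.
move=> mk hL kh; apply: (@le_integrable _ (lebT R) R (@Leb R) _ (lebT_itv _) _ (EFin \o h)) => //.
  exact/measurable_EFinP.
move=> t /= tI; rewrite lee_fin (le_trans (kh t _))//; exact: ler_norm.
Qed.

Lemma inL1_bounded k (M : R) : meas01 k ->
  (forall t, 0 <= t <= 1 -> `|k t| <= M) -> inL1 k.
Proof.
move=> mk kM; apply: (inL1_le (h := cst M)) => //.
apply: (@measurable_bounded_integrable _ (lebT R)) => //.
- exact: lebT_itv.
- by rewrite -[X in (X < _)%E]/(Leb _) Leb_itvcc// ltry.
- by exists `|M|; split; rewrite ?num_real//= => x Mx t _ /=; rewrite ltW.
Qed.

Lemma inL1_cst (c : R) : inL1 (fun=> c).
Proof.
by apply: (@inL1_bounded _ `|c|) => //; exact: measurable_cst.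
Qed.

Lemma inL1D h k : inL1 h -> inL1 k -> inL1 (fun t => h t + k t).
Proof. by move=> hL kL; exact: (integrableD (lebT_itv `[0, 1]) hL kL). Qed.

Lemma inL1N h : inL1 h -> inL1 (fun t => - h t).
Proof. by move=> hL; exact: (integrableN hL). Qed.

Lemma inL1B h k : inL1 h -> inL1 k -> inL1 (fun t => h t - k t).
Proof. by move=> hL kL; apply: inL1D => //; exact: inL1N. Qed.

Lemma inL1Z (c : R) h : inL1 h -> inL1 (fun t => c * h t).
Proof. by move=> hL; exact: (integrableZl (lebT_itv `[0, 1]) c hL). Qed.

Lemma inL1_norm h : inL1 h -> inL1 (fun t => `|h t|).
Proof. by move=> hL; apply: integrable_norm. Qed.

Lemma inL1M h k (M : R) : inL1 h -> meas01 k ->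
  (forall t, 0 <= t <= 1 -> `|k t| <= M) -> inL1 (fun t => h t * k t).
Proof.
move=> hL mk kM; apply: (inL1_le (h := fun t => M * `|h t|)).
- by apply: measurable_funM => //; exact: inL1_meas.
- by apply: inL1Z; exact: inL1_norm.
- by move=> t tI; rewrite normrM mulrC ler_wpM2r// kM.
Qed.

Lemma inL1_sum n (h : 'I_n -> R -> R) : (forall i, inL1 (h i)) ->
  inL1 (fun t => \sum_i h i t).
Proof.
move=> hL; rewrite /inL1.
have -> : EFin \o (fun t => \sum_i h i t) =
   (fun t => (\sum_i (h i t)%:E)%E) by apply/funext => t /=; rewrite sumEFin.
by apply: integrable_sum => [|i _]; [exact: lebT_itv|exact: hL].
Qed.

Lemma inL1_eq h k : (forall t, 0 <= t <= 1 -> h t = k t) -> inL1 h -> inL1 k.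
Proof.
move=> hk hL; apply: eq_integrable hL; first exact: lebT_itv.
by move=> t; rewrite inE/= in_itv/= => /hk ->.
Qed.

(** Absolute continuity of the integral, applied to the extension [hI] of [h] by 0 to the line. *)
Lemma cumul_small h (e : R) : inL1 h -> 0 < e ->
  exists2 d : R, 0 < d & forall a b, 0 <= a -> a <= b -> b <= 1 -> b - a < d ->
    \int[@Leb R]_(t in `]a, b]) `|h t| < e.
Proof.
move=> hL e0.
have mI := @lebT_itv `[0, 1].
pose hI := h \_ `[0, 1]%classic.
have hIL : (@Leb R).-integrable setT (EFin \o hI).
  by rewrite -restrict_EFin; exact: (proj1 (integrable_mkcond _ mI) hL).
have [d [d0 hd]] := integral_normr_continuous hIL e0.
exists d => // a b a0 ab b1 bad.
have := hd `]a, b]%classic (lebT_itv _).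
rewrite -[X in (X < _)%E]/(Leb _) Leb_itvoc// lte_fin => /(_ bad).
congr (_ < _); apply: eq_Rintegral => t; rewrite inE/= in_itv/= => /andP[at_ tb].
by rewrite /hI patchE mem_set//= in_itv/= (le_trans a0 (ltW at_)) (le_trans tb).
Qed.

Lemma cumul0B h (a b : R) : inL1 h -> 0 <= a -> a <= b -> b <= 1 ->
  \int[@Leb R]_(t in `[0, b]) h t - \int[@Leb R]_(t in `[0, a]) h t =
  \int[@Leb R]_(t in `]a, b]) h t.
Proof.
move=> hL a0 ab b1.
have -> : `[0, b]%classic = `[0, a]%classic `|` `]a, b]%classic :> set R.
  by rewrite -itv_bndbnd_setU// bnd_simp.
rewrite Rintegral_setU; first by rewrite addrC addKr.
- exact: lebT_itv.
- exact: lebT_itv.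
- apply: inL1S hL _ _ => //; first by apply: measurableU; exact: lebT_itv.
  by rewrite -itv_bndbnd_setU ?bnd_simp//; exact: subI0t.
- rewrite disj_set2E; apply/eqP/seteqP; split => // t /= [].
  by rewrite !in_itv/= => /andP[_ ta] /andP[]; rewrite ltNge ta.
Qed.

Lemma cumul1B h (a b : R) : inL1 h -> 0 <= a -> a <= b -> b <= 1 ->
  \int[@Leb R]_(t in `[a, 1]) h t - \int[@Leb R]_(t in `[b, 1]) h t =
  \int[@Leb R]_(t in `]a, b]) h t.
Proof.
move=> hL a0 ab b1; have b0 := le_trans a0 ab; have a1 := le_trans ab b1.
have step c : 0 <= c -> c <= 1 -> \int[@Leb R]_(t in `[c, 1]) h t =
  \int[@Leb R]_(t in `[0, 1]) h t - \int[@Leb R]_(t in `[0, c]) h t.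
  move=> c0 c1; rewrite cumul0B//.
  have -> : `[c, 1]%classic = [set c] `|` `]c, 1]%classic :> set R.
    by rewrite setU1itv// bnd_simp.
  rewrite Rintegral_setU; first by rewrite Leb_Rintegral_set1 add0r.
  - have := @lebT_itv `[c, c]; by rewrite set_itv1.
  - exact: lebT_itv.
  - apply: inL1S hL _ _ => //.
    + rewrite setU1itv ?bnd_simp//; exact: lebT_itv.
    + by rewrite setU1itv ?bnd_simp//; exact: subIt1.
  - rewrite disj_set2E; apply/eqP/seteqP; split => // t /= [->].
    by rewrite in_itv/= ltxx.
rewrite (step a)// (step b)// -cumul0B//; ring.
Qed.

(** A modulus of continuity gives continuity on the subspace [0, 1], hence Borel and then Lebesgue
    measurability. It is asked for ordered pairs because increments of primitives are integrals over
    ]a, b]. *)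
Lemma meas01_modulus (F : R -> R) :
  (forall e : R, 0 < e -> exists2 d : R, 0 < d & forall a b : R, 0 <= a -> a <= b ->
     b <= 1 -> b - a < d -> `|F b - F a| < e) -> meas01 F.
Proof.
move=> Fmod; apply: lebT_measurable_fun_borel; last exact: measurable_itv.
apply: subspace_continuous_measurable_fun; first exact: measurable_itv.
apply/subspace_continuousP => x /=; rewrite in_itv/= => /andP[x0 x1].
apply/cvgrPdist_lt => e /Fmod[d d0 Fd].
near=> y.
have : 0 <= y <= 1.
  have : `[0, 1]%classic y by near: y; apply: withinT.
  by rewrite /= in_itv.
move=> /andP[y0 y1].
have xyd : `|x - y| < d.
  by near: y; apply: cvg_within; exact: nbhsx_ballx.
move: xyd; rewrite ltr_norml => /andP[xyd1 xyd2].
have [xy|yx] := leP x y.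
  rewrite distrC; apply: Fd => //; lra.
by apply: Fd => //; rewrite ?(ltW yx)//; lra.
Unshelve. all: by end_near. Qed.

Lemma cumul0_dist h (e : R) : inL1 h -> 0 < e ->
  exists2 d : R, 0 < d & forall a b, 0 <= a -> a <= b -> b <= 1 -> b - a < d ->
    `|\int[@Leb R]_(t in `[0, b]) h t - \int[@Leb R]_(t in `[0, a]) h t| < e.
Proof.
move=> hL e0; have [d d0 hd] := cumul_small hL e0.
exists d => // a b a0 ab b1 bad; rewrite cumul0B//.
apply: le_lt_trans (hd _ _ a0 ab b1 bad).
apply: (@le_normr_Rintegral _ (lebT R)); first exact: lebT_itv.
apply: inL1S => //; first exact: lebT_itv.
apply: subset_itv; rewrite bnd_simp//.
Qed.

Lemma cumul1_dist h (e : R) : inL1 h -> 0 < e ->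
  exists2 d : R, 0 < d & forall a b, 0 <= a -> a <= b -> b <= 1 -> b - a < d ->
    `|\int[@Leb R]_(t in `[b, 1]) h t - \int[@Leb R]_(t in `[a, 1]) h t| < e.
Proof.
move=> hL e0; have [d d0 hd] := cumul_small hL e0.
exists d => // a b a0 ab b1 bad; rewrite distrC cumul1B//.
apply: le_lt_trans (hd _ _ a0 ab b1 bad).
apply: (@le_normr_Rintegral _ (lebT R)); first exact: lebT_itv.
apply: inL1S => //; first exact: lebT_itv.
apply: subset_itv; rewrite bnd_simp//.
Qed.

Lemma meas01_cumul0 h : inL1 h ->
  meas01 (fun t => \int[@Leb R]_(s in `[0, t]) h s).
Proof. by move=> hL; apply: meas01_modulus => e; exact: cumul0_dist. Qed.

Lemma meas01_cumul1 h : inL1 h ->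
  meas01 (fun t => \int[@Leb R]_(s in `[t, 1]) h s).
Proof. by move=> hL; apply: meas01_modulus => e; exact: cumul1_dist. Qed.

(** The identity from the Lebesgue to the Borel sigma-algebra is measurable and pushes [Leb] forward
    to [lebesgue_measure], for which the fundamental theorem of calculus is stated. *)
Lemma Leb_Rintegral_borel (a b : R) (f : R -> R) :
  measurable_fun [set: measurableTypeR R] f -> (forall x, 0 <= f x) ->
  \int[@Leb R]_(t in `[a, b]) f t = \int[@lebesgue_measure R]_(t in `[a, b]) f t.
Proof.
move=> mf f0; rewrite /Rintegral; congr fine.
have mid : measurable_fun [set: lebT R] (fun x : lebT R => x : measurableTypeR R).
  by move=> _ Y mY; rewrite setTI; exact: lebT_measurable_borel.
rewrite -(@ge0_integral_pushforward _ _ (lebT R) (measurableTypeR R) R _ mid (@Leb R)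
  `[a, b]%classic (EFin \o f))//.
- apply/measurable_EFinP; exact: measurable_funTS.
- by move=> x _; rewrite lee_fin.
Qed.

Lemma Leb_Rintegral_expR (k c a b : R) : k != 0 -> a <= b ->
  \int[@Leb R]_(t in `[a, b]) expR (k * t + c) =
  (expR (k * b + c) - expR (k * a + c)) / k.
Proof.
move=> k0; rewrite le_eqVlt => /predU1P[->|ab].
  by rewrite set_itv1 Leb_Rintegral_set1 subrr mul0r.
have dF (x : R) : is_derive x 1 (fun t : R => expR (k * t + c) / k) (expR (k * x + c)).
  apply: is_derive_eq; rewrite ?scaler0 ?add0r ?addr0 /GRing.scale/=.
  by field.
have cF (x : R) : {for x, continuous (fun t : R => expR (k * t + c) / k)}.
  by apply: differentiable_continuous; apply/derivable1_diffP; apply: ex_derive; exact: dF.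
have mE : measurable_fun [set: measurableTypeR R] (fun t => expR (k * t + c)).
  apply: continuous_measurable_fun => x; apply: differentiable_continuous.
  by apply/derivable1_diffP.
rewrite Leb_Rintegral_borel// /Rintegral (continuous_FTC2 (F := fun t => expR (k * t + c) / k) ab).
- by rewrite -EFinB/= mulrBl.
- apply: continuous_subspaceT => x; apply: differentiable_continuous.
  by apply/derivable1_diffP.
- split.
  + by move=> x _; apply: ex_derive; exact: dF.
  + by apply: cvg_at_right_filter; exact: cF.
  + by apply: cvg_at_left_filter; exact: cF.
- by move=> x _; rewrite derive1E; apply: derive_val; exact: dF.
Qed.

(** The integrand q(x) p(y) \1_S(x, y) is dominated by |q(x)| |p(y)|, whose iterated integral is a
    product of two finite integrals. *)
Lemma Rintegral_Fubini_section d (T : measurableType d)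
    (mu : {sigma_finite_measure set T -> \bar R}) (S : set (T * T)) (p q : T -> R) :
  measurable S -> mu.-integrable setT (EFin \o p) -> mu.-integrable setT (EFin \o q) ->
  \int[mu]_x (q x * \int[mu]_y (p y * \1_S (x, y))) =
  \int[mu]_y (p y * \int[mu]_x (q x * \1_S (x, y))).
Proof.
move=> mS pL qL.
have mp : measurable_fun setT p by apply/measurable_EFinP; exact: measurable_int pL.
have mq : measurable_fun setT q by apply/measurable_EFinP; exact: measurable_int qL.
have mS1 x : measurable_fun setT (fun y => \1_S (x, y) : R).
  exact: (measurableT_comp (measurable_indic mS) (pair1_measurable x)).
have mS2 y : measurable_fun setT (fun x => \1_S (x, y) : R).
  exact: (measurableT_comp (measurable_indic mS) (pair2_measurable y)).
have le1 (g : T -> R) x z : `|g x * \1_S z| <= `|g x|.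
  by rewrite normrM ler_piMr// indicE; case: (_ \in _); rewrite ?normr1 ?normr0.
have pSL x : mu.-integrable setT (EFin \o (fun y => p y * \1_S (x, y))).
  apply: le_integrable pL => //; first by apply/measurable_EFinP; exact: measurable_funM.
  by move=> y _; rewrite /= lee_fin le1.
have qSL y : mu.-integrable setT (EFin \o (fun x => q x * \1_S (x, y))).
  apply: le_integrable qL => //; first by apply/measurable_EFinP; exact: measurable_funM.
  by move=> x _; rewrite /= lee_fin le1.
pose f (z : T * T) : \bar R := (q z.1 * (p z.2 * \1_S z))%:E.
have mf : measurable_fun setT f.
  apply/measurable_EFinP; apply: measurable_funM; last apply: measurable_funM.
  - by apply: (measurableT_comp mq); exact: measurable_fst.
  - by apply: (measurableT_comp mp); exact: measurable_snd.
  - exact: measurable_indic.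
have mnp : measurable_fun setT (fun y => `|p y|%:E).
  by apply/measurable_EFinP; exact: measurableT_comp.
have mnq : measurable_fun setT (fun y => `|q y|%:E).
  by apply/measurable_EFinP; exact: measurableT_comp.
have fL : (mu \x mu)%E.-integrable setT f.
  apply/integrable12ltyP => //.
  apply: (@le_lt_trans _ _ (\int[mu]_x (`|q x|%:E * \int[mu]_y `|p y|%:E))%E).
    apply: ge0_le_integral => //.
    - by move=> x _; exact: integral_ge0.
    - by apply: (@measurable_fun_fubini_tonelli_F _ _ _ _ _ mu (abse \o f));
        [exact: measurableT_comp|move=> z; exact: abse_ge0].
    - by apply: emeasurable_funM.
    - move=> x _; rewrite -ge0_integralZl//.
      apply: ge0_le_integral => //.
      + apply: measurableT_comp => //; apply/measurable_EFinP.
        by apply: measurable_funM => //=; exact: measurable_funM.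
      + exact: emeasurable_funM.
      + by move=> y _; rewrite /f/= lee_fin normrM ler_wpM2l.
  rewrite ge0_integralZr//; last exact: integral_ge0.
  apply: lte_mul_pinfty => //.
  - exact: integral_ge0.
  - by have /integrable_abse := qL; move/integrable_fin_num; apply.
  - by have /integrable_abse := pL; move/integrable_lty; apply.
have := Fubini fL => E.
have E1 x : (\int[mu]_y f (x, y))%E = (q x * \int[mu]_y (p y * \1_S (x, y)))%:E.
  rewrite /f/=; under eq_integral do rewrite EFinM.
  rewrite (integralZl measurableT (pSL x)) EFinM; congr (_ * _)%E.
  by apply/esym/fineK; exact: (integrable_fin_num measurableT (pSL x)).
have E2 y : (\int[mu]_x f (x, y))%E = (p y * \int[mu]_x (q x * \1_S (x, y)))%:E.
  rewrite /f/=; under eq_integral do rewrite mulrCA EFinM.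
  rewrite (integralZl measurableT (qSL y)) EFinM; congr (_ * _)%E.
  by apply/esym/fineK; exact: (integrable_fin_num measurableT (qSL y)).
transitivity (fine (\int[mu]_x \int[mu]_y f (x, y))%E).
  by apply: (congr1 fine); apply: eq_integral => x _; rewrite E1.
by rewrite E; apply: (congr1 fine); apply: eq_integral => y _; rewrite E2.
Qed.

Lemma measurable_triangle :
  measurable ([set z | (z.1 : R) <= z.2] : set (lebT R * lebT R)).
Proof.
have mid : measurable_fun [set: lebT R] (fun x : lebT R => x : R).
  by move=> _ Y mY; rewrite setTI; exact: lebT_measurable_borel.
rewrite -[X in measurable X]setTI.
apply: (@measurable_fun_ler _ (lebT R * lebT R)%type _ setT (fun z => z.1 : R) (fun z => z.2 : R)).
- by apply: (measurableT_comp mid); exact: measurable_fst.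
- by apply: (measurableT_comp mid); exact: measurable_snd.
- exact: measurableT.
- by [].
Qed.

(** Integration by parts in disguise: with lam t = int_t^1 p and xi t = int_0^t q it reads int xi'
    lam = - int xi lam', without boundary terms since xi 0 = 0 and lam 1 = 0. *)
Lemma Leb_Fubini_triangle p q : inL1 p -> inL1 q ->
  \int[@Leb R]_(t in `[0, 1]) (q t * \int[@Leb R]_(r in `[t, 1]) p r) =
  \int[@Leb R]_(r in `[0, 1]) (p r * \int[@Leb R]_(t in `[0, r]) q t).
Proof.
move=> pL qL.
pose I : set (lebT R) := `[0, 1]%classic.
have mI : measurable I := lebT_itv _.
have pIL : (@Leb R).-integrable setT (EFin \o (p \_ I)).
  by rewrite -restrict_EFin; exact: (proj1 (integrable_mkcond _ mI) pL).
have qIL : (@Leb R).-integrable setT (EFin \o (q \_ I)).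
  by rewrite -restrict_EFin; exact: (proj1 (integrable_mkcond _ mI) qL).
rewrite [LHS]Rintegral_mkcond [RHS]Rintegral_mkcond.
have tri x y : ((x, y) \in ([set z | (z.1 : R) <= z.2] : set (lebT R * lebT R))) = (x <= y :> R).
  by apply/idP/idP; rewrite inE.
etransitivity; last (etransitivity;
  first exact: (Rintegral_Fubini_section measurable_triangle pIL qIL)).
  apply: eq_Rintegral => x _; rewrite !patchE; case: ifPn => [|_]; last by rewrite mul0r.
  rewrite inE/= in_itv/= => /andP[x0 x1]; congr (_ * _).
  rewrite Rintegral_mkcond; apply: eq_Rintegral => y _.
  rewrite !patchE indicE tri !mem_setE/= !in_itv/= .
  by case: (leP x y) => xy; rewrite ?andbF ?mulr0//= mulr1 (le_trans x0 xy).
apply: eq_Rintegral => y _; rewrite !patchE; case: ifPn => [|_]; last by rewrite mul0r.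
rewrite /I mem_setE/= in_itv/= => /andP[y0 y1]; congr (_ * _).
rewrite [RHS]Rintegral_mkcond; apply: eq_Rintegral => x _.
rewrite !patchE indicE tri !mem_setE/= !in_itv/= .
by case: (leP x y) => xy; rewrite ?andbF ?mulr0//= mulr1 (le_trans xy y1).
Qed.

(** [F] depends continuously on finitely many measurable functions. The set F > a is a countable
    union of preimages of boxes with rational centres and radius 1 / (k + 1): those contained in it
    are kept, and continuity puts each of its points into one of them. *)
Lemma meas01_continuous_in (I : finType) (q : I -> R -> R) (F : R -> R) :
  (forall i, meas01 (q i)) ->
  (forall t e : R, 0 <= t <= 1 -> 0 < e -> exists2 d : R, 0 < d & forall s : R,
     0 <= s <= 1 -> (forall i, `|q i s - q i t| < d) -> `|F s - F t| < e) ->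
  meas01 F.
Proof.
move=> mq qF.
have mI : measurable (`[0, 1]%classic : set (lebT R)) := lebT_itv _.
apply: (measurability _ (RGenOInfty.measurableE R)) => // /= _ [_ [a ->]] <-.
pose Box (c : {ffun I -> rat} * nat) : set (lebT R) := `[0, 1]%classic `&`
  [set t : lebT R | forall i, `|q i t - ratr (c.1 i)| < c.2.+1%:R^-1].
pose U : set (lebT R) := `[0, 1]%classic `&` F @^-1` `]a, +oo[%classic.
pose B c := if `[< Box c `<=` U >] then Box c else set0.
suff -> : `[0, 1]%classic `&` F @^-1` `]a, +oo[%classic = \bigcup_c B c.
  apply: countable_bigcupT_measurable => [|c]; first exact: countableP.
  rewrite /B; case: asboolP => // _.
  rewrite /Box (_ : _ `&` _ = `[0, 1]%classic `&` \bigcap_(i in [set: I])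
      (`[0, 1]%classic `&` (q i @^-1` ball (ratr (c.1 i) : R) c.2.+1%:R^-1))).
    apply: measurableI => //; apply: fin_bigcap_measurable => [|i _].
      exact: finite_finset.
    apply: mq => //; exact: measurable_ball.
  apply/seteqP; split=> t /=.
    by move=> [tI Ht]; split => // i _; split => //; rewrite /ball/= distrC; exact: Ht.
  move=> [tI Ht]; split => // i; have [_] := Ht i Logic.I.
  by rewrite /ball/= distrC.
apply/seteqP; split => [t [tI]|t [c _]]; last first.
  by rewrite /B; case: asboolP => // + Bt; move/(_ _ Bt).
rewrite /= in_itv/= andbT => aFt.
have t01 : 0 <= t <= 1 by move: tI; rewrite /= in_itv.
have /(qF _ _ t01)[d d0 Hd] : 0 < F t - a by rewrite subr_gt0.
have [k kd] : exists k : nat, k.+1%:R^-1 < d / 2.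
  have /ltr_add_invr[k] : 0 < d / 2 by rewrite divr_gt0.
  by rewrite add0r; exists k.
have /choice[c ct] : forall i, exists c : rat, `|q i t - ratr c| < k.+1%:R^-1.
  move=> i; have /rat_in_itvoo[c] : q i t - k.+1%:R^-1 < q i t + k.+1%:R^-1.
    by rewrite ltrD2l gt0_cp// invr_gt0.
  by rewrite in_itv/= => /andP[c1 c2]; exists c; rewrite distrC ltr_distl c1 c2.
exists ([ffun i => c i], k) => //.
have BU : Box ([ffun i => c i], k) `<=` U.
  move=> s [sI Hs]; split => //; rewrite /= in_itv/= andbT.
  have s01 : 0 <= s <= 1 by move: sI; rewrite /= in_itv.
  have : `|F s - F t| < F t - a.
    apply: Hd => // i.
    rewrite (le_lt_trans (ler_distD (ratr (c i)) _ _))//.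
    have := Hs i; rewrite /= ffunE => Hsi.
    rewrite [ltRHS]splitr ltrD//; first exact: lt_trans Hsi kd.
    by rewrite distrC; exact: lt_trans (ct i) kd.
  rewrite ltr_norml => /andP[+ _]; lra.
rewrite /B; case: asboolP => // _; split => // i.
by rewrite /= ffunE.
Qed.

End Lebesgue01.

(** * The maximum norm of matrices *)

Section MatrixNorm.
Variable R : realType.

Lemma mx_coord_le_norm p q (A : 'M[R]_(p, q)) i j : `|A i j| <= `|A|.
Proof.
rewrite [leRHS]/Num.Def.normr/= mx_normrE.
by apply/bigmax_geP; right => /=; exists (i, j).
Qed.

Lemma mx_norm_le p q (A : 'M[R]_(p, q)) (c : R) : 0 <= c ->
  (forall i j, `|A i j| <= c) -> `|A| <= c.
Proof.
move=> c0 Ac; rewrite [leLHS]/Num.Def.normr/= mx_normrE.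
by apply/bigmax_leP; split => // -[i j] _; exact: Ac.
Qed.

Lemma cV_norm_le p (A : 'cV[R]_p) (c : R) : 0 <= c ->
  (forall i, `|A i 0| <= c) -> `|A| <= c.
Proof. by move=> c0 Ac; apply: mx_norm_le => // i j; rewrite ord1. Qed.

(** The maximum norm is not submultiplicative; the inner dimension enters as a factor and recurs in
    the later constants. *)
Lemma mulmx_norm_le p q r (A : 'M[R]_(p, q)) (B : 'M[R]_(q, r)) :
  `|A *m B| <= q%:R * `|A| * `|B|.
Proof.
apply: mx_norm_le => [|i j]; first by rewrite !mulr_ge0.
rewrite mxE (le_trans (ler_norm_sum _ _ _))//.
rewrite (le_trans (ler_sum _ (_ : forall k, true -> _ <= `|A| * `|B|)))//.
  by move=> k _; rewrite normrM ler_pM// mx_coord_le_norm.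
by rewrite sumr_const card_ord -mulrA mulr_natl.
Qed.

Lemma trmx_norm p q (A : 'M[R]_(p, q)) : `|A^T| = `|A|.
Proof.
apply/eqP; rewrite eq_le; apply/andP; split; apply: mx_norm_le => // i j.
  by rewrite mxE mx_coord_le_norm.
by have -> : A i j = A^T j i; [rewrite mxE|exact: mx_coord_le_norm].
Qed.

End MatrixNorm.

Section MeasurableVectors.
Variable R : realType.

Definition measV p (x : R -> 'cV[R]_p) := forall i, meas01 (fun t => x t i 0).

Lemma meas01_eq (h k : R -> R) : (forall t, 0 <= t <= 1 -> h t = k t) ->
  meas01 h -> meas01 k.
Proof.
move=> hk; apply: eq_measurable_fun => t; rewrite inE/= in_itv/=; exact: hk.
Qed.

Lemma measV_col p (f : 'I_p -> R -> R) : (forall i, meas01 (f i)) ->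
  measV (fun t => \col_i f i t).
Proof. by move=> mf i; apply: meas01_eq (mf i) => t _; rewrite mxE. Qed.

Lemma measV_cst p (A : 'cV[R]_p) : measV (fun=> A).
Proof. by move=> i; exact: measurable_cst. Qed.

End MeasurableVectors.

(** * Volterra equations *)

Section Picard.
Variable R : realType.

(** The tails of the increments sum to at most 2 C 2^-k, so u_k - 2 C 2^-k and u_k + 2 C 2^-k are
    monotone and squeeze the limit. The explicit rate is what the Picard limit needs. *)
Lemma geometric_cauchy_limit (u : nat -> R) (C : R) :
  (forall k, `|u k.+1 - u k| <= C * 2^-1 ^+ k) ->
  exists2 l, u k @[k --> \oo] --> l & forall k, `|l - u k| <= 2 * C * 2^-1 ^+ k.
Proof.
move=> uC.
have C0 : 0 <= C by have := uC 0%N; rewrite expr0 mulr1; apply: le_trans.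
have g0 k : 0 <= (2^-1 : R) ^+ k by rewrite exprn_ge0// invr_ge0.
have gS k : (2^-1 : R) ^+ k.+1 = 2^-1 ^+ k / 2 by rewrite exprSr.
pose w k := u k - 2 * C * 2^-1 ^+ k.
pose v k := u k + 2 * C * 2^-1 ^+ k.
have uC' k : u k.+1 - u k <= C * 2^-1 ^+ k /\ u k - u k.+1 <= C * 2^-1 ^+ k.
  have := uC k; rewrite ler_norml => /andP[h1 h2]; split => //; lra.
have w_nd : nondecreasing_seq w.
  apply/nondecreasing_seqP => k; rewrite /w gS; have [] := uC' k; lra.
have v_ni : nonincreasing_seq v.
  apply/nonincreasing_seqP => k; rewrite /v gS; have [] := uC' k; lra.
have wv k : w k <= v k.
  by rewrite /w /v; have := mulr_ge0 C0 (g0 k); lra.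
have wcvg : cvgn w.
  apply: nondecreasing_is_cvgn => //; exists (v 0%N) => _ [k _ <-].
  exact: le_trans (wv k) (v_ni _ _ (leq0n k)).
have gcvg : 2 * C * 2^-1 ^+ k @[k --> \oo] --> (0 : R).
  apply: (@cvg_geometric _ (2 * C)); rewrite ger0_norm ?invr_ge0//; lra.
have ul : u k @[k --> \oo] --> limn w.
  rewrite -[limn w]addr0; under eq_fun => k do rewrite -[u k](subrK (2 * C * 2^-1 ^+ k)).
  exact: cvgD.
have vl : v k @[k --> \oo] --> limn w by rewrite -[limn w]addr0; exact: cvgD.
exists (limn w) => // k; rewrite ler_distl; apply/andP; split.
  exact: nondecreasing_cvgn_le.
have <- : limn v = limn w by apply: cvg_lim.
by rewrite -/(v k); apply: nonincreasing_cvgn_ge => //; apply/cvg_ex; exists (limn w).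
Qed.

Lemma le0_geometric (x C : R) : (forall k : nat, x <= C * 2^-1 ^+ k) -> x <= 0.
Proof.
move=> xC; have gcvg : C * 2^-1 ^+ k @[k --> \oo] --> (0 : R).
  apply: (@cvg_geometric _ C); rewrite ger0_norm ?invr_ge0//; lra.
rewrite -(cvg_lim _ gcvg)//; apply: limr_ge; first by apply/cvg_ex; exists 0.
exact: nearW.
Qed.

Lemma Rintegral_le_on (D : set (lebT R)) (h k : R -> R) : measurable D ->
  D `<=` `[0, 1]%classic -> inL1 h -> inL1 k ->
  (forall t, 0 <= t <= 1 -> h t <= k t) ->
  \int[@Leb R]_(t in D) h t <= \int[@Leb R]_(t in D) k t.
Proof.
move=> mD DI hL kL hk; apply: (@le_Rintegral _ (lebT R)) => //; try exact: inL1S.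
by move=> t /DI/=; rewrite in_itv; exact: hk.
Qed.

Lemma normr_Rintegral_le (D : set (lebT R)) (h k : R -> R) : measurable D ->
  D `<=` `[0, 1]%classic -> inL1 h -> inL1 k ->
  (forall t, 0 <= t <= 1 -> `|h t| <= k t) ->
  `|\int[@Leb R]_(t in D) h t| <= \int[@Leb R]_(t in D) k t.
Proof.
move=> mD DI hL kL hk.
apply: le_trans (Rintegral_le_on mD DI (inL1_norm hL) kL hk).
by apply: (@le_normr_Rintegral _ (lebT R)) => //; exact: inL1S.
Qed.

Lemma Rintegral_on_B (D : set (lebT R)) (h k : R -> R) : measurable D ->
  D `<=` `[0, 1]%classic -> inL1 h -> inL1 k ->
  \int[@Leb R]_(t in D) (h t - k t) =
  \int[@Leb R]_(t in D) h t - \int[@Leb R]_(t in D) k t.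
Proof. by move=> mD DI hL kL; apply: (@RintegralB _ (lebT R)) => //; exact: inL1S. Qed.

Lemma Rintegral_on_D (D : set (lebT R)) (h k : R -> R) : measurable D ->
  D `<=` `[0, 1]%classic -> inL1 h -> inL1 k ->
  \int[@Leb R]_(t in D) (h t + k t) =
  \int[@Leb R]_(t in D) h t + \int[@Leb R]_(t in D) k t.
Proof. by move=> mD DI hL kL; apply: (@RintegralD _ (lebT R)) => //; exact: inL1S. Qed.

Lemma Rintegral_on_Z (D : set (lebT R)) (c : R) (h : R -> R) : measurable D ->
  D `<=` `[0, 1]%classic -> inL1 h ->
  \int[@Leb R]_(t in D) (c * h t) = c * \int[@Leb R]_(t in D) h t.
Proof. by move=> mD DI hL; apply: (@RintegralZl _ (lebT R)) => //; exact: inL1S. Qed.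

(* Picard iteration for [xi t = \int_(D t) G r (xi r) dr], a contraction in the
   sup norm with weight [1 / W]. *)
Lemma volterra_picard n (D : R -> set (lebT R)) (G : R -> 'cV[R]_n -> 'cV[R]_n)
    (a b W : R -> R) (B Wm : R) :
  (forall t, 0 <= t <= 1 -> measurable (D t) /\ D t `<=` `[0, 1]%classic) ->
  (forall h, inL1 h -> meas01 (fun t => \int[@Leb R]_(r in D t) h r)) ->
  (forall xi, measV xi -> measV (fun t => G t (xi t))) ->
  inL1 a -> inL1 b -> meas01 W -> 0 <= B ->
  (forall t, 0 <= t <= 1 -> 0 <= W t <= Wm) ->
  (forall t, 0 <= t <= 1 -> forall xi xi',
     `|G t xi - G t xi'| <= a t * `|xi - xi'|) ->
  (forall t, 0 <= t <= 1 -> `|G t 0| <= b t) ->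
  (forall t, 0 <= t <= 1 -> \int[@Leb R]_(r in D t) b r <= B * W t) ->
  (forall t, 0 <= t <= 1 -> \int[@Leb R]_(r in D t) (a r * W r) <= W t / 2) ->
  (forall t, 0 <= t <= 1 -> 0 <= a t) ->
  exists xi : R -> 'cV[R]_n,
    [/\ measV xi,
        forall t, 0 <= t <= 1 -> `|xi t| <= 2 * B * W t,
        forall i, inL1 (fun r => G r (xi r) i 0) &
        forall t, 0 <= t <= 1 -> forall i,
          xi t i 0 = \int[@Leb R]_(r in D t) G r (xi r) i 0].
Proof.
move=> HD Hcum HGm aL bL mW B0 W0 HGl HG0 Hb HW a0.
pose X := fix X (k : nat) : R -> 'cV[R]_n := if k is k'.+1 then
  fun t => \col_i \int[@Leb R]_(r in D t) G r (X k' r) i 0 else fun=> 0.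
have aWL : inL1 (fun r => a r * W r).
  by apply: (inL1M (M := Wm)) => // t /W0 /andP[w0 wm]; rewrite ger0_norm.
have GL xi : measV xi -> (forall t, 0 <= t <= 1 -> `|xi t| <= 2 * B * W t) ->
    forall i, inL1 (fun r => G r (xi r) i 0).
  move=> mxi xiW i.
  apply: (inL1_le (h := fun r => b r + 2 * B * (a r * W r))).
  - exact: HGm.
  - by apply: inL1D => //; exact: inL1Z.
  - move=> t tI; rewrite (le_trans (mx_coord_le_norm _ _ _))//.
    rewrite -[G t _](subrK (G t 0)) (le_trans (ler_normD _ _))// addrC lerD ?HG0//.
    rewrite (le_trans (HGl _ tI _ _))// subr0 mulrCA ler_wpM2l ?a0//.
    exact: xiW.
have GBW t i xi xi' (C : R) : 0 <= t <= 1 -> 0 <= C ->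
    measV xi -> (forall t, 0 <= t <= 1 -> `|xi t| <= 2 * B * W t) ->
    measV xi' -> (forall t, 0 <= t <= 1 -> `|xi' t| <= 2 * B * W t) ->
    (forall t, 0 <= t <= 1 -> `|xi t - xi' t| <= C * W t) ->
    `|\int[@Leb R]_(r in D t) G r (xi r) i 0 -
      \int[@Leb R]_(r in D t) G r (xi' r) i 0| <= C * (W t / 2).
  move=> tI C0 m1 b1 m2 b2 b12; have [mD DI] := HD _ tI.
  rewrite -Rintegral_on_B//; try exact: GL.
  apply: (@le_trans _ _ (\int[@Leb R]_(r in D t) (C * (a r * W r)))).
    apply: normr_Rintegral_le => //.
    - by apply: inL1B; exact: GL.
    - exact: inL1Z.
    - move=> r rI; have -> : G r (xi r) i 0 - G r (xi' r) i 0 =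
        (G r (xi r) - G r (xi' r)) i 0 by rewrite !mxE.
      rewrite (le_trans (mx_coord_le_norm _ _ _))// (le_trans (HGl _ rI _ _))//.
      by rewrite mulrCA ler_wpM2l ?a0// b12.
  by rewrite Rintegral_on_Z// ler_wpM2l// HW.
(* The bound 2 B W reproduces itself: the integral of [b] gives B W, and the Lipschitz part gives 2
   B times at most W / 2. *)
have Xprop k : measV (X k) /\ (forall t, 0 <= t <= 1 -> `|X k t| <= 2 * B * W t).
  elim: k => [|k [mX bX]].
    split=> [|t tI]; first exact: measV_cst.
    by rewrite normr0 !mulr_ge0//; have /andP[] := W0 _ tI.
  have GLk := GL _ mX bX.
  split=> [|t tI]; first by apply: measV_col => i; exact: Hcum.
  have [mD DI] := HD _ tI; have /andP[Wt0 _] := W0 _ tI.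
  apply: cV_norm_le => [|i]; first by rewrite !mulr_ge0.
  rewrite /= mxE.
  apply: (@le_trans _ _ (\int[@Leb R]_(r in D t) (b r + 2 * B * (a r * W r)))).
    apply: normr_Rintegral_le => //.
      by apply: inL1D => //; exact: inL1Z.
    move=> r rI; rewrite (le_trans (mx_coord_le_norm _ _ _))//.
    rewrite -[G r _](subrK (G r 0)) (le_trans (ler_normD _ _))// addrC lerD ?HG0//.
    rewrite (le_trans (HGl _ rI _ _))// subr0 mulrCA ler_wpM2l ?a0//.
    exact: bX.
  rewrite Rintegral_on_D//; last exact: inL1Z.
  rewrite Rintegral_on_Z//.
  have := Hb _ tI; have /(ler_wpM2l (mulr_ge0 (ler0n _ 2) B0)) := HW _ tI.
  lra.
have g0 k : 0 <= (2^-1 : R) ^+ k by rewrite exprn_ge0// invr_ge0.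
have Xstep k t : 0 <= t <= 1 -> `|X k.+1 t - X k t| <= 2 * B * 2^-1 ^+ k * W t.
  elim: k t => [|k IH] t tI; have /andP[Wt0 _] := W0 _ tI.
    rewrite expr0 mulr1 subr0; exact: (Xprop 1%N).2.
  apply: cV_norm_le => [|i]; first by rewrite !mulr_ge0.
  rewrite !mxE (le_trans (GBW _ _ _ _ (2 * B * 2^-1 ^+ k) tI _ _ _ _ _ _))//;
    try (by case: (Xprop k)); try (by case: (Xprop k.+1)).
  - by rewrite !mulr_ge0.
  - by rewrite exprSr; lra.
(* The limit is taken at each point and coordinate, which preserves measurability; outside [0, 1] it
   gets the default value 0. *)
have /choice[l lP] : forall t : R, exists l : 'I_n -> R, forall i, 0 <= t <= 1 ->
    X k t i 0 @[k --> \oo] --> l i /\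
    (forall k, `|l i - X k t i 0| <= 2 * (2 * B * W t) * 2^-1 ^+ k).
  move=> t.
  suff /choice[l lP] : forall i, exists y : R, 0 <= t <= 1 ->
      X k t i 0 @[k --> \oo] --> y /\
      (forall k, `|y - X k t i 0| <= 2 * (2 * B * W t) * 2^-1 ^+ k).
    by exists l.
  move=> i.
  have [tI|tI] := pselect (0 <= t <= 1); last by exists 0.
  have [k|l l1 l2] := @geometric_cauchy_limit (fun k => X k t i 0) (2 * B * W t).
    rewrite (le_trans _ (_ : `|X k.+1 t - X k t| <= _))//.
      by have := mx_coord_le_norm (X k.+1 t - X k t) i 0; rewrite !mxE.
    by rewrite (le_trans (Xstep k _ tI))//; lra.
  by exists l => _; split.
pose xi t := \col_i l t i : 'cV[R]_n.
have mxi : measV xi.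
  apply: measV_col => i; apply: (@measurable_fun_cvg _ (lebT R) R _ (fun k t => X k t i 0)).
    by move=> k; exact: (Xprop k).1.
  by move=> t; rewrite /= in_itv/= => tI; exact: (lP t i tI).1.
have dxi k t : 0 <= t <= 1 -> `|xi t - X k t| <= 2 * (2 * B) * 2^-1 ^+ k * W t.
  move=> tI; have /andP[Wt0 _] := W0 _ tI.
  apply: cV_norm_le => [|i]; first by rewrite !mulr_ge0.
  by rewrite !mxE (le_trans ((lP t i tI).2 k))//; lra.
have bxi t : 0 <= t <= 1 -> `|xi t| <= 2 * B * W t.
  move=> tI; rewrite -subr_le0; apply: (@le0_geometric _ (2 * (2 * B) * W t)) => k.
  have := (Xprop k).2 t tI; have := dxi k _ tI.
  have : `|xi t| <= `|xi t - X k t| + `|X k t| by rewrite -{1}[xi t](subrK (X k t)) ler_normD.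
  lra.
exists xi; split => //; first exact: GL.
move=> t tI i; have /andP[Wt0 _] := W0 _ tI.
(* Both sides are within a multiple of 2^-k of the iterate [X k.+1 t]. *)
apply/eqP; rewrite -subr_eq0 -normr_le0.
apply: (@le0_geometric _ (2 * (2 * (2 * B)) * W t)) => k.
have h1 : `|\int[@Leb R]_(r in D t) G r (X k r) i 0 - \int[@Leb R]_(r in D t) G r (xi r) i 0|
    <= 2 * (2 * B) * 2^-1 ^+ k * (W t / 2).
  apply: GBW => //; try (by case: (Xprop k)).
  - by rewrite !mulr_ge0.
  - by move=> r rI; rewrite distrC; exact: dxi.
have h2 : `|xi t i 0 - X k.+1 t i 0| <= 2 * (2 * B) * 2^-1 ^+ k.+1 * W t.
  have := dxi k.+1 _ tI; apply: le_trans.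
  by have := mx_coord_le_norm (xi t - X k.+1 t) i 0; rewrite !mxE.
rewrite /= mxE in h2.
rewrite (le_trans (ler_distD (\int[@Leb R]_(r in D t) G r (X k r) i 0) _ _))//.
rewrite exprSr in h2.
have := mulr_ge0 (mulr_ge0 B0 (g0 k)) Wt0; lra.
Qed.

End Picard.

Section WeightedVolterra.
Variable R : realType.
Implicit Types (r s t d : R).

Lemma Rintegral_itv01_subset (t : R) (h : R -> R) : 0 <= t <= 1 -> inL1 h ->
  (forall r, 0 <= r <= 1 -> 0 <= h r) ->
  \int[@Leb R]_(r in `[t, 1]) h r <= \int[@Leb R]_(r in `[0, 1]) h r.
Proof.
move=> /andP[t0 t1] hL h0; rewrite -subr_ge0 cumul1B//.
apply: Rintegral_ge0 => r /=; rewrite in_itv/= => /andP[tr r1].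
by apply: h0; rewrite (ltW tr) (le_trans r1 t1).
Qed.

(** The weight W t = exp (2 l t) satisfies int_0^t l W = (W t - 1) / 2. The bound on the solution is
    linear in [c], so that data of size s give a solution of size s. *)
Lemma forward_volterra n (G : R -> 'cV[R]_n -> 'cV[R]_n) (l c : R) :
  0 < l -> 0 <= c ->
  (forall xi, measV xi -> measV (fun t => G t (xi t))) ->
  (forall t, 0 <= t <= 1 -> forall xi xi', `|G t xi - G t xi'| <= l * `|xi - xi'|) ->
  (forall t, 0 <= t <= 1 -> `|G t 0| <= c) ->
  exists xi : R -> 'cV[R]_n,
    [/\ measV xi,
        forall t, 0 <= t <= 1 -> `|xi t| <= 2 * expR (2 * l) * c,
        forall i, inL1 (fun r => G r (xi r) i 0) &
        forall t, 0 <= t <= 1 -> forall i,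
          xi t i 0 = \int[@Leb R]_(r in `[0, t]) G r (xi r) i 0].
Proof.
move=> l0 c0 HGm HGl HG0.
(* The summand 0 gives the exponent the affine form of [Leb_Rintegral_expR]. *)
pose W (t : R) := expR (2 * l * t + 0).
have W1 t : 0 <= t <= 1 -> 1 <= W t.
  by move=> /andP[t0 _]; rewrite /W addr0 -[leLHS]expR0 ler_expR !mulr_ge0// ltW.
have Wm t : 0 <= t <= 1 -> W t <= expR (2 * l).
  by move=> /andP[_ t1]; rewrite /W addr0 ler_expR ler_piMr// mulr_ge0// ltW.
have mW : meas01 W.
  apply: lebT_measurable_fun_borel; last exact: measurable_itv.
  apply: measurable_funTS; apply: continuous_measurable_fun => x.
  apply: differentiable_continuous; exact/derivable1_diffP.
have [|||||||||||||xi [mxi bxi GL xiE]] := @volterra_picard R n (fun t => `[0, t]%classic) G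
  (fun=> l) (fun=> c) W c (expR (2 * l)).
- move=> t /andP[_ t1]; split; [exact: lebT_itv|exact: subI0t].
- exact: meas01_cumul0.
- exact: HGm.
- exact: inL1_cst.
- exact: inL1_cst.
- exact: mW.
- exact: c0.
- by move=> t tI; rewrite Wm// (le_trans ler01 (W1 _ tI)).
- exact: HGl.
- exact: HG0.
- move=> t tI; have /andP[t0 t1] := tI.
  rewrite (@Rintegral_cst _ (lebT R)); last exact: lebT_itv.
  rewrite -[X in fine X]/(Leb _) Leb_itvcc//= subr0 ler_wpM2l//.
  exact: le_trans (W1 _ tI).
- move=> t tI; have /andP[t0 t1] := tI.
  rewrite Rintegral_on_Z; [|exact: lebT_itv|exact: subI0t|].
    rewrite /W Leb_Rintegral_expR ?mulf_neq0 ?gt_eqF//.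
    rewrite mulr0 add0r expR0 mulrA.
    rewrite ler_pdivrMr ?mulr_gt0//.
    have -> : expR (2 * l * t + 0) / 2 * (2 * l) = l * expR (2 * l * t + 0) by field.
    by rewrite ler_pM2l// gerBl.
  apply: (@inL1_bounded _ _ (expR (2 * l))) => // r rI.
  by rewrite ger0_norm ?Wm// (le_trans ler01 (W1 _ rI)).
- by move=> t _; exact: ltW.
exists xi; split => // t tI; rewrite (le_trans (bxi _ tI))//.
by rewrite -mulrA mulrCA -mulrA mulrCA ler_wpM2l// mulrC ler_wpM2r// Wm.
Qed.

(** The Lipschitz bound [a] is integrable, and bounded only on each [d, 1] with d > 0. The weight
    exp (2 int_t^1 a) would serve too, at the price of a chain rule for absolutely continuous
    functions; splitting [0, 1] at a small [tau] lets an explicit exponential do. *)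
Lemma backward_volterra n (G : R -> 'cV[R]_n -> 'cV[R]_n) (a : R -> R) :
  inL1 a -> (forall t, 0 <= t <= 1 -> 0 <= a t) ->
  (forall d, 0 < d -> exists M, forall t, d <= t <= 1 -> a t <= M) ->
  (forall xi, measV xi -> measV (fun t => G t (xi t))) ->
  (forall t, 0 <= t <= 1 -> forall xi xi', `|G t xi - G t xi'| <= a t * `|xi - xi'|) ->
  (forall t, 0 <= t <= 1 -> `|G t 0| <= a t) ->
  exists (xi : R -> 'cV[R]_n) (C : R),
    [/\ measV xi,
        forall t, 0 <= t <= 1 -> `|xi t| <= C,
        forall i, inL1 (fun r => G r (xi r) i 0) &
        forall t, 0 <= t <= 1 -> forall i,
          xi t i 0 = \int[@Leb R]_(r in `[t, 1]) G r (xi r) i 0].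
Proof.
move=> aL a0 aM HGm HGl HG0.
have [d d0 ad] := cumul_small aL (divr_gt0 ltr01 (ltr0Sn R 3)).
(* The weight [W] handles [a] where it is bounded; near 0 the integral of [a] is
   small, which makes up for the singularity. *)
pose tau : R := Num.min (d / 2) 1.
have tau0 : 0 < tau by rewrite /tau lt_min ltr01 divr_gt0.
have tau1 : tau <= 1 by rewrite /tau ge_min lexx orbT.
have taud : tau < d.
  by rewrite /tau gt_min; apply/orP; left; rewrite ltr_pdivrMr// ltr_pMr// ltr1n.
have [M0 aM0] := aM _ tau0.
pose M : R := `|M0| + 1.
have M_gt0 : 0 < M by rewrite ltr_wpDl.
have aMle t : tau <= t <= 1 -> a t <= M.
  by move=> /aM0/le_trans; apply; rewrite /M (le_trans (ler_norm _))// lerDl.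
(* With this value M int_t^1 W is at most W t / 4. The part [a1] of [a] on [0, tau] has mass at most
   1 / 4 and W decreases, which adds another W t / 4; together they make the required W t / 2. *)
pose c : R := 4 * M; have c0 : 0 < c by rewrite mulr_gt0.
pose W (t : R) := expR (- c * t + c).
have WE t : W t = expR (c * (1 - t)) by rewrite /W; congr expR; ring.
have W1 t : 0 <= t <= 1 -> 1 <= W t.
  by move=> /andP[_ t1]; rewrite WE -[leLHS]expR0 ler_expR mulr_ge0 ?subr_ge0// ltW.
have Wm t : 0 <= t <= 1 -> W t <= expR c.
  by move=> /andP[t0 _]; rewrite WE ler_expR ler_piMr//; [exact: ltW|rewrite gerBl].
have Wni s t : s <= t -> W t <= W s by move=> st; rewrite !WE ler_expR ler_pM2l// lerD2l lerN2.
have mW : meas01 W.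
  apply: lebT_measurable_fun_borel; last exact: measurable_itv.
  apply: measurable_funTS; apply: continuous_measurable_fun => x.
  apply: differentiable_continuous; exact/derivable1_diffP.
have WL : inL1 W.
  apply: (@inL1_bounded _ _ (expR c)) => // r rI.
  by rewrite ger0_norm ?Wm// (le_trans ler01 (W1 _ rI)).
pose B := \int[@Leb R]_(r in `[0, 1]) a r.
have B0 : 0 <= B.
  by apply: Rintegral_ge0 => r /=; rewrite in_itv; exact: a0.
pose a1 := fun r => a r * \1_(`[0, tau]%classic : set (lebT R)) r.
have ind01 r : 0 <= (\1_(`[0, tau]%classic : set (lebT R)) r : R) <= 1.
  by rewrite indicE; case: (_ \in _); rewrite ?ler01 ?lexx.
have a1L : inL1 a1.
  apply: (inL1M (M := 1)) => //.
    by apply: measurable_funTS; apply: measurable_indic; exact: lebT_itv.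
  by move=> r _; have /andP[h0 h1] := ind01 r; rewrite ger0_norm.
have a10 r : 0 <= r <= 1 -> 0 <= a1 r.
  by move=> /a0 ar; rewrite /a1 mulr_ge0//; have /andP[] := ind01 r.
have a1int : \int[@Leb R]_(r in `[0, 1]) a1 r <= 1 / 4.
  have := ad 0 tau (lexx _) (ltW tau0) tau1; rewrite subr0 => /(_ taud) H.
  rewrite (le_trans _ (ltW H))//.
  have := cumul0B a1L (lexx 0) ler01 (lexx 1).
  rewrite set_itv1 Leb_Rintegral_set1 subr0 => ->.
  rewrite [leLHS](_ : _ = \int[@Leb R]_(r in `]0, 1]) (((fun r => `|a r|) \_ `]0, tau]%classic) r)).
    by rewrite -Rintegral_mkcondr setIidr//; apply: subset_itvl; rewrite bnd_simp.
  apply: eq_Rintegral => r; rewrite inE/= in_itv/= => /andP[r0 r1].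
  rewrite patchE /a1 indicE !mem_setE/= !in_itv/= r0 (ltW r0)/=.
  case: (r <= tau); rewrite ?mulr0// mulr1 ger0_norm// a0// (ltW r0)//.
have [|||||||||||||xi [mxi bxi GL xiE]] := @volterra_picard R n (fun t => `[t, 1]%classic) G
  a a W B (expR c).
- move=> t /andP[t0 t1]; split; [exact: lebT_itv|exact: subIt1].
- exact: meas01_cumul1.
- exact: HGm.
- exact: aL.
- exact: aL.
- exact: mW.
- exact: B0.
- by move=> t tI; rewrite Wm// (le_trans ler01 (W1 _ tI)).
- exact: HGl.
- exact: HG0.
- move=> t tI; rewrite (le_trans (Rintegral_itv01_subset tI aL a0))//.
  by rewrite -/B ler_peMr// W1.
- move=> t tI; have /andP[t0 t1] := tI.
  have mt : measurable (`[t, 1]%classic : set (lebT R)) := lebT_itv _.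
  have st := subIt1 t0.
  apply: (@le_trans _ _ (\int[@Leb R]_(r in `[t, 1]) (M * W r + W t * a1 r))).
    apply: (@le_Rintegral _ (lebT R)) => //.
    - apply: inL1S => //; apply: (inL1M (M := expR c)) => // r rI.
      by rewrite ger0_norm ?Wm// (le_trans ler01 (W1 _ rI)).
    - by apply: inL1S => //; apply: inL1D; exact: inL1Z.
    - move=> r /=; rewrite in_itv/= => /andP[tr r1].
      have rI : 0 <= r <= 1 by rewrite (le_trans t0 tr).
      have W0 := le_trans ler01 (W1 _ rI); have Wt0 := le_trans ler01 (W1 _ tI).
      have [rtau|rtau] := leP r tau.
        rewrite /a1 indicE mem_setE/= in_itv/= rtau (le_trans t0 tr)/= mulr1.
        rewrite ler_wpDl ?mulr_ge0// ?(ltW M_gt0)// mulrC ler_wpM2r ?a0//.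
        exact: Wni.
      apply: (@le_trans _ _ (M * W r)); last by rewrite lerDl mulr_ge0// a10.
      by rewrite ler_wpM2r// aMle// (ltW rtau).
  rewrite Rintegral_on_D//; try exact: inL1Z.
  rewrite !Rintegral_on_Z// /W Leb_Rintegral_expR ?oppr_eq0 ?gt_eqF// -/(W t) -/(W _).
  have h1 := le_trans (Rintegral_itv01_subset tI a1L a10) a1int.
  have Wt0 := le_trans ler01 (W1 _ tI).
  have /(ler_wpM2l Wt0) := h1.
  have -> : M * ((W 1 - W t) / - c) = (W t - W 1) / 4.
    by rewrite /c; field; rewrite gt_eqF.
  have := le_trans ler01 (W1 _ (_ : 0 <= 1 <= 1)); rewrite ler01 lexx => /(_ isT).
  lra.
- exact: a0.
exists xi, (2 * B * expR c); split => // t tI; rewrite (le_trans (bxi _ tI))//.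
by rewrite ler_wpM2l ?mulr_ge0// Wm.
Qed.

End WeightedVolterra.

(** * Uniform estimates for C^1 data *)

Section UniformC1.
Variables (R : realType) (n m : nat).
Implicit Types (t e d M : R) (x xi : 'cV[R]_n) (u w : 'cV[R]_m).
Implicit Types h : R -> 'cV[R]_n -> 'cV[R]_m -> R.

(** Transposition is an isometry for the maximum norm and carries over the compactness of boxes of
    row vectors. *)
Lemma compact_cV_box p (M : R) :
  compact [set x : 'cV[R]_p | forall i, -M <= x i 0 <= M].
Proof.
have cr : compact [set v : 'rV[R]_p | forall i, `[(- M), M]%classic (v ord0 i)].
  by apply: (@rV_compact _ _ (fun=> `[(- M), M]%classic)) => _; exact: segment_compact.
have ct : {within [set v : 'rV[R]_p | forall i, `[(- M), M]%classic (v ord0 i)],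
    continuous (fun v : 'rV[R]_p => v^T : 'cV[R]_p)}.
  apply: continuous_subspaceT => v.
  have FF : Filter (nbhs v) := nbhs_filter v.
  apply: (iffRL (cvgrPdist_lt _ _)) => e e0.
  near=> w; rewrite -linearB/= trmx_norm; near: w; exact: cvgr_dist_lt.
rewrite (_ : mkset _ = (fun v : 'rV[R]_p => v^T : 'cV[R]_p) @`
    [set v : 'rV[R]_p | forall i, `[(- M), M]%classic (v ord0 i)]).
  exact: continuous_compact.
apply/seteqP; split => [x xM|_ [v vM <-] i].
  exists x^T; last by rewrite trmxK.
  by move=> i /=; rewrite in_itv/= mxE.
by have := vM i; rewrite /= in_itv/= mxE.
Unshelve. all: by end_near. Qed.

Definition box M : set (R * ('cV[R]_n * 'cV[R]_m)) :=
  `[0, 1]%classic `*` ([set x : 'cV[R]_n | forall i, -M <= x i 0 <= M] `*`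
                       [set u : 'cV[R]_m | forall i, -M <= u i 0 <= M]).

Lemma compact_box M : compact (box M).
Proof.
apply: compact_setX; first exact: segment_compact.
by apply: compact_setX; exact: compact_cV_box.
Qed.

Lemma box_dom01 M : box M `<=` (@dom01 R n m).
Proof. by move=> p [/=]; rewrite in_itv. Qed.

Lemma boxP M t x u : 0 <= t <= 1 -> `|x| <= M -> `|u| <= M -> box M (t, (x, u)).
Proof.
move=> tI xM uM; split; first by rewrite /= in_itv.
by split => i /=; rewrite -ler_norml (le_trans (mx_coord_le_norm _ _ _)).
Qed.

Lemma box_bounded (V : normedModType R) (k : R * ('cV[R]_n * 'cV[R]_m) -> V) M :
  {within (@dom01 R n m), continuous k} ->
  exists2 C : R, 0 <= C & forall p, box M p -> `|k p| <= C.
Proof.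
move=> ck.
have := continuous_compact (continuous_subspaceW (@box_dom01 M) ck) (@compact_box M).
move=> /compact_bounded [C0 [_ HC]]; exists (`|C0| + 1) => [|p pM].
  by rewrite addr_ge0.
apply: HC; last by exists p.
by rewrite (le_lt_trans (ler_norm _))// ltrDl.
Qed.

(** Only [p] is confined to the box; [p'] ranges over the strip [dom01], so that increments may
    leave the box. The box is covered by balls of half the radius of continuity, which leaves room
    for the second half between [p] and [p']. *)
Lemma box_uniform (V : normedModType R) (k : R * ('cV[R]_n * 'cV[R]_m) -> V) M e :
  {within (@dom01 R n m), continuous k} -> 0 < e ->
  exists2 d : R, 0 < d & forall p p', box M p -> (@dom01 R n m) p' ->
    ball p d p' -> `|k p - k p'| < e.
Proof.
move=> /subspace_continuousP ck e0.
pose Q (d : R) p := (@dom01 R n m) p -> forall p', (@dom01 R n m) p' ->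
  ball p d p' -> `|k p - k p'| < e.
have HQ : \forall d \near (0 : R)^'+, box M `<=` Q d.
  apply: (proj1 (compact_near_coveringP _) (@compact_box M)) => p0 p0M.
  have := ck _ (box_dom01 p0M) => /cvgrPdist_lt /(_ (e / 2)).
  rewrite divr_gt0// => /(_ isT); rewrite near_withinE => /nbhs_ballP[r /= r0 Hr].
  have hr : 0 < r / 2 by rewrite divr_gt0.
  exists (ball p0 (r / 2), [set d | d <= r / 2]).
    by split; [exact: nbhsx_ballx|exact: nbhs_right_le].
  move=> [p d] [/= bp dr] pd p' p'd bpp'.
  rewrite -(subrK (k p0) (k p)) -addrA (le_lt_trans (ler_normD _ _))//.
  rewrite [ltRHS]splitr ltrD//.
    rewrite distrC; apply: Hr => //; apply: le_ball bp.
    by rewrite ler_pdivrMr// ler_peMr ?ler1n// ltW.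
  apply: Hr => //; rewrite (splitr r).
  apply: (@ball_triangle _ _ p) => //; exact: le_ball bpp'.
near (0 : R)^'+ => d; exists d => // p p' pM.
by have /(_ p pM) : box M `<=` Q d; [near: d|apply; exact: box_dom01 pM].
Unshelve. all: by end_near. Qed.

(** The mean value theorem for s |-> h t (x + s xi) (u + s w) yields one [tau] for both variables.
    The work lies in identifying the joint differential at (y, 0) and (0, y) with the partial
    gradients, which are defined through directional derivatives. *)
Lemma C1_mvt h t x u xi w : C1_data h -> 0 <= t <= 1 ->
  exists2 tau : R, 0 <= tau <= 1 &
    h t (x + xi) (u + w) - h t x u =
    (grad_x h t (x + tau *: xi) (u + tau *: w) *m xi +
     grad_u h t (x + tau *: xi) (u + tau *: w) *m w) 0 0.
Proof.
move=> [_ dh _ _] tI.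
pose H (q : 'cV[R]_n * 'cV[R]_m) := h t q.1 q.2.
have dH q : differentiable H q by case: q => a b; exact: dh.
have gx a b y : 'd H (a, b) (y, 0) = (grad_x h t a b *m y) 0 0.
  rewrite [in LHS](matrix_sum_delta y) mxE.
  have -> : ((\sum_i \sum_j y i j *: delta_mx i j, 0) : 'cV[R]_n * 'cV[R]_m) =
      \sum_i y i 0 *: (delta_mx i 0, 0).
    under eq_bigr do rewrite big_ord1.
    rewrite [RHS](_ : _ = (\sum_i y i 0 *: delta_mx i 0, \sum_(i < n) 0)).
      by rewrite big1_eq.
    elim/big_rec3: _ => // i s1 s2 s3 _ ->.
    by congr (_, _); rewrite /= scaler0.
  rewrite linear_sum; apply: eq_bigr => i _; rewrite linearZ/= mulrC; congr (_ * _).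
  rewrite -deriveE// /grad_x /grad mxE /derive.
  have eqf : (fun r : R => r^-1 *: ((H \o shift (a, b)) (r *: (delta_mx i 0, 0)) - H (a, b))) =
    (fun r : R => r^-1 *: ((h t ^~ b \o shift a) (r *: delta_mx i 0) - h t a b)).
    by apply/funext => r; rewrite /H/= scaler0 add0r.
  by rewrite eqf.
have gu a b y : 'd H (a, b) (0, y) = (grad_u h t a b *m y) 0 0.
  rewrite [in LHS](matrix_sum_delta y) mxE.
  have -> : ((0, \sum_i \sum_j y i j *: delta_mx i j) : 'cV[R]_n * 'cV[R]_m) =
      \sum_i y i 0 *: (0, delta_mx i 0).
    under eq_bigr do rewrite big_ord1.
    rewrite [RHS](_ : _ = (\sum_(i < m) 0, \sum_i y i 0 *: delta_mx i 0)).
      by rewrite big1_eq.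
    elim/big_rec3: _ => // i s1 s2 s3 _ ->.
    by congr (_, _); rewrite /= scaler0.
  rewrite linear_sum; apply: eq_bigr => i _; rewrite linearZ/= mulrC; congr (_ * _).
  rewrite -deriveE// /grad_u /grad mxE /derive.
  have eqf : (fun r : R => r^-1 *: ((H \o shift (a, b)) (r *: (0, delta_mx i 0)) - H (a, b))) =
    (fun r : R => r^-1 *: ((h t a \o shift b) (r *: delta_mx i 0) - h t a b)).
    by apply/funext => r; rewrite /H/= scaler0 add0r.
  by rewrite eqf.
pose phi (s : R) := H (x + s *: xi, u + s *: w).
pose v : 'cV[R]_n * 'cV[R]_m := (xi, w).
have dphi (s : R) : is_derive s 1 phi ('d H (x + s *: xi, u + s *: w) v).
  have eqq : (fun r : R => r^-1 *: ((phi \o shift s) (r *: (1 : R)) - phi s)) =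
     (fun r : R => r^-1 *: ((H \o shift (x + s *: xi, u + s *: w)) (r *: v) - H (x + s *: xi, u + s *: w))).
    apply/funext => r; congr (_ *: (_ - _)); rewrite /phi/=; congr H.
    have -> : r%:A = r :> R by rewrite /GRing.scale/= mulr1.
    by congr (_, _); rewrite /= scalerDl addrCA.
  split; first by rewrite /derivable eqq; exact: diff_derivable.
  by rewrite -deriveE// /derive eqq.
have cphi : {within `[0, 1], continuous phi}.
  apply: continuous_subspaceT => s; apply: differentiable_continuous.
  by apply/derivable1_diffP; apply: ex_derive; exact: dphi.
have [tau] := MVT_segment ler01 (fun s _ => dphi s) cphi; rewrite in_itv/= => tau01.
rewrite /phi !scale1r !scale0r !addr0 subr0 mulr1 => ->.
exists tau => //; rewrite (_ : v = (xi, 0) + (0, w)); last by congr (_, _); rewrite ?addr0 ?add0r.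
by rewrite linearD gx gu [RHS]mxE.
Qed.

Lemma C1_bounded h M : C1_data h -> exists2 C : R, 0 <= C &
  forall t x u, 0 <= t <= 1 -> `|x| <= M -> `|u| <= M ->
  [/\ `|h t x u| <= C, `|grad_x h t x u| <= C & `|grad_u h t x u| <= C].
Proof.
move=> [ch _ cx cu].
have [C1 C10 H1] := box_bounded M ch.
have [C2 C20 H2] := box_bounded M cx.
have [C3 C30 H3] := box_bounded M cu.
exists (C1 + C2 + C3) => [|t x u tI xM uM]; first by rewrite !addr_ge0.
have bM := boxP tI xM uM.
split; [have := H1 _ bM|have := H2 _ bM|have := H3 _ bM] => /= ?; lra.
Qed.

Lemma mulmx_coord_le p (A : 'rV[R]_p) (v : 'cV[R]_p) (C c : R) :
  `|A| <= C -> `|v| <= c -> `|(A *m v) 0 0| <= p%:R * C * c.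
Proof.
move=> AC vc; rewrite (le_trans (mx_coord_le_norm _ _ _))//.
rewrite (le_trans (mulmx_norm_le _ _))// -!mulrA ler_wpM2l//.
exact: ler_pM.
Qed.

Lemma convex_norm_le p (x y : 'cV[R]_p) (tau M : R) : 0 <= tau <= 1 ->
  `|x| <= M -> `|x + y| <= M -> `|x + tau *: y| <= M.
Proof.
move=> /andP[t0 t1] xM xyM.
have -> : x + tau *: y = (1 - tau) *: x + tau *: (x + y).
  by rewrite scalerBl scale1r scalerDr addrA subrK.
rewrite (le_trans (ler_normD _ _))// !normrZ ger0_norm ?subr_ge0// [`|tau|]ger0_norm//.
have -> : M = (1 - tau) * M + tau * M by ring.
by rewrite lerD// ler_wpM2l// subr_ge0.
Qed.

Lemma C1_lipschitz h M : C1_data h -> exists2 C : R, 0 <= C &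
  forall t x x' u u', 0 <= t <= 1 -> `|x| <= M -> `|u| <= M -> `|x'| <= M -> `|u'| <= M ->
  `|h t x u - h t x' u'| <= C * (`|x - x'| + `|u - u'|).
Proof.
move=> hC; have [C C0 HC] := C1_bounded M hC.
exists (n%:R * C + m%:R * C) => [|t x x' u u' tI xM uM xM' uM'].
  by rewrite addr_ge0// mulr_ge0.
have [tau tau01] := C1_mvt x' u' (x - x') (u - u') hC tI.
rewrite ![_ + (_ - _)]addrC !subrK => ->.
have xt : `|x' + tau *: (x - x')| <= M by apply: convex_norm_le => //; rewrite addrC subrK.
have ut : `|u' + tau *: (u - u')| <= M by apply: convex_norm_le => //; rewrite addrC subrK.
have [_ gx gu] := HC _ _ _ tI xt ut.
rewrite mxE (le_trans (ler_normD _ _))//.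
have h1 := mulmx_coord_le gx (lexx `|x - x'|).
have h2 := mulmx_coord_le gu (lexx `|u - u'|).
apply: le_trans (lerD h1 h2) _.
rewrite mulrDl !mulrDr.
have := mulr_ge0 (mulr_ge0 (ler0n R n) C0) (normr_ge0 (u - u')).
have := mulr_ge0 (mulr_ge0 (ler0n R m) C0) (normr_ge0 (x - x')).
lra.
Qed.

(** By [C1_mvt] the remainder involves only the difference of the gradients between the mean value
    point and (x, u), which is small uniformly on the box. The choice of [e'] absorbs the dimensions
    brought in by [mulmx_coord_le]. *)
Lemma C1_taylor h M e : C1_data h -> 0 < e -> exists2 d : R, 0 < d &
  forall t x u xi w, 0 <= t <= 1 -> `|x| <= M -> `|u| <= M -> `|xi| < d -> `|w| < d ->
  `|h t (x + xi) (u + w) - h t x u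
    - (grad_x h t x u *m xi + grad_u h t x u *m w) 0 0| <= e * (`|xi| + `|w|).
Proof.
move=> hC e0; have [_ _ cx cu] := hC.
pose e' := e / (n + m).+1%:R.
have e'0 : 0 < e' by rewrite divr_gt0.
have [d1 d10 H1] := box_uniform M cx e'0.
have [d2 d20 H2] := box_uniform M cu e'0.
exists (Num.min d1 d2) => [|t x u xi w tI xM uM]; first by rewrite lt_min d10.
rewrite !lt_min => /andP[xi1 xi2] /andP[w1 w2].
have [tau /andP[tau0 tau1]] := C1_mvt x u xi w hC tI => ->.
have tau_le p (y : 'cV[R]_p) d : `|y| < d -> `|tau *: y| < d.
  by move=> yd; rewrite normrZ ger0_norm// (le_lt_trans _ yd)// ler_piMl.
have bM := boxP tI xM uM.
have bl (d : R) : 0 < d -> `|xi| < d -> `|w| < d ->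
    ball (t, (x, u)) d (t, (x + tau *: xi, u + tau *: w)).
  move=> d0 xid wd; split; [exact: ballxx|split; rewrite -ball_normE /ball_/=].
    by rewrite opprD addNKr normrN; exact: tau_le.
  by rewrite opprD addNKr normrN; exact: tau_le.
have dom : (@dom01 R n m) (t, (x + tau *: xi, u + tau *: w)) by [].
have := H1 _ _ bM dom (bl _ d10 xi1 w1); have := H2 _ _ bM dom (bl _ d20 xi2 w2).
rewrite /= => h2 h1.
set A1 := grad_x h t x u in h1 *; set A2 := grad_u h t x u in h2 *.
set B1 := grad_x h t _ _ in h1 *; set B2 := grad_u h t _ _ in h2 *.
have -> : (B1 *m xi + B2 *m w) 0 0 - (A1 *m xi + A2 *m w) 0 0 =
    ((B1 - A1) *m xi) 0 0 + ((B2 - A2) *m w) 0 0.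
  by rewrite !mulmxBl !mxE; ring.
rewrite (le_trans (ler_normD _ _))//.
have g1 : `|B1 - A1| <= e' by rewrite distrC ltW.
have g2 : `|B2 - A2| <= e' by rewrite distrC ltW.
have h3 := mulmx_coord_le g1 (lexx `|xi|).
have h4 := mulmx_coord_le g2 (lexx `|w|).
apply: le_trans (lerD h3 h4) _.
have ne : n%:R * e' <= e.
  rewrite /e' mulrCA ler_piMr//; first exact: ltW.
  rewrite ler_pdivrMr// mul1r ler_nat.
  by rewrite ltnW// ltnS leq_addr.
have me : m%:R * e' <= e.
  rewrite /e' mulrCA ler_piMr//; first exact: ltW.
  rewrite ler_pdivrMr// mul1r ler_nat.
  by rewrite ltnW// ltnS leq_addl.
by rewrite mulrDr lerD// ler_wpM2r.
Qed.

End UniformC1.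

(** * Measurability and almost everywhere statements *)

Section MeasurableMatrices.
Variable R : realType.
Implicit Types (s t : R).

Definition measM p q (A : R -> 'M[R]_(p, q)) :=
  forall i j, meas01 (fun t => A t i j).

Lemma measVM p (x : R -> 'cV[R]_p) : measV x <-> measM x.
Proof. by split=> mx i; [move=> j; rewrite ord1; exact: mx|exact: mx]. Qed.

Lemma meas01_sum p (h : 'I_p -> R -> R) : (forall i, meas01 (h i)) ->
  meas01 (fun t => \sum_i h i t).
Proof. by move=> mh; apply: measurable_sum. Qed.

Lemma measMD p q (A B : R -> 'M[R]_(p, q)) : measM A -> measM B ->
  measM (fun t => A t + B t).
Proof.
move=> mA mB i j; apply: (meas01_eq (h := fun t => A t i j + B t i j)).
  by move=> t _; rewrite mxE.
exact: (measurable_funD (mA i j) (mB i j)).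
Qed.

Lemma measMN p q (A : R -> 'M[R]_(p, q)) : measM A -> measM (fun t => - A t).
Proof.
move=> mA i j; apply: (meas01_eq (h := fun t => - 1 * A t i j)).
  by move=> t _; rewrite mxE mulN1r.
exact: (measurable_funM (measurable_cst _) (mA i j)).
Qed.

Lemma measMB p q (A B : R -> 'M[R]_(p, q)) : measM A -> measM B ->
  measM (fun t => A t - B t).
Proof. by move=> mA mB; apply: measMD => //; exact: measMN. Qed.

Lemma measMZ p q (h : R -> R) (A : R -> 'M[R]_(p, q)) : meas01 h -> measM A ->
  measM (fun t => h t *: A t).
Proof.
move=> mh mA i j; apply: (meas01_eq (h := fun t => h t * A t i j)).
  by move=> t _; rewrite mxE.
exact: (measurable_funM mh (mA i j)).
Qed.

Lemma measM_tr p q (A : R -> 'M[R]_(p, q)) : measM A -> measM (fun t => (A t)^T).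
Proof.
by move=> mA i j; apply: meas01_eq (mA j i) => t _; rewrite mxE.
Qed.

Lemma measM_mul p q r (A : R -> 'M[R]_(p, q)) (B : R -> 'M[R]_(q, r)) :
  measM A -> measM B -> measM (fun t => A t *m B t).
Proof.
move=> mA mB i j; apply: (meas01_eq (h := fun t => \sum_k A t i k * B t k j)).
  by move=> t _; rewrite mxE.
by apply: meas01_sum => k; apply: measurable_funM; [exact: mA|exact: mB].
Qed.

Lemma meas01V (h : R -> R) : meas01 h -> meas01 (fun t => (h t)^-1).
Proof.
move=> mh; apply: (measurableT_comp _ mh).
(* Inversion is continuous off 0; the singleton 0, where 0^-1 = 0, is treated apart. *)
rewrite -(setvU [set 0]); apply/measurable_funU => //.
  by apply: measurableC.
split; last exact: measurable_fun_set1.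
apply: open_continuous_measurable_fun.
  by rewrite openC; exact: closed_eq.
by move=> x; rewrite inE/= => /eqP x0; exact: inv_continuous.
Qed.

Lemma meas01_indic (A : set (lebT R)) : measurable A -> meas01 (\1_A).
Proof. by move=> mA; apply: measurable_funTS; exact: measurable_indic. Qed.

Lemma measurable_level (h : R -> R) (c : R) : meas01 h ->
  measurable ([set t | 0 <= t <= 1 /\ c <= h t] : set (lebT R)).
Proof.
move=> mh; rewrite (_ : mkset _ = `[0, 1]%classic `&` h @^-1` `[c, +oo[%classic).
  by apply: mh; [exact: lebT_itv|exact: measurable_itv].
by apply/seteqP; split=> t /=; rewrite !in_itv/= ?andbT.
Qed.

(** The index [None] stands for time and the others for the coordinates of [x] and [u]: the argument
    of [k] then consists of finitely many measurable real functions, as [meas01_continuous_in]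
    requires. *)
Lemma measM_comp n m p q (k : R * ('cV[R]_n * 'cV[R]_m) -> 'M[R]_(p, q)) x u :
  {within (@dom01 R n m), continuous k} -> measM x -> measM u ->
  measM (fun t => k (t, (x t, u t))).
Proof.
move=> /subspace_continuousP ck mx mu i j.
pose Q (o : option ('I_n + 'I_m)) (t : R) : R := match o with
  | None => t | Some (inl l) => x t l 0 | Some (inr l) => u t l 0 end.
apply: (@meas01_continuous_in _ _ Q).
  move=> [[l|l]|]; [exact: mx|exact: mu|].
  by apply: lebT_measurable_fun_borel; [exact: measurable_id|exact: measurable_itv].
move=> t e t01 e0.
have /cvgrPdist_lt/(_ _ e0) := ck (t, (x t, u t)) t01.
rewrite near_withinE => /nbhs_ballP[d /= d0 Hd]; exists (d / 2); first by rewrite divr_gt0.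
move=> s s01 Hs.
have dd : d / 2 < d by rewrite ltr_pdivrMr// ltr_pMr// ltr1n.
have := Hd (s, (x s, u s)); rewrite distrC => H.
have -> : k (s, (x s, u s)) i j - k (t, (x t, u t)) i j =
  - ((k (t, (x t, u t)) - k (s, (x s, u s))) i j) by rewrite !mxE opprB.
rewrite normrN (le_lt_trans (mx_coord_le_norm _ _ _))// distrC H//.
split; [|split]; rewrite -ball_normE /ball_/=.
- by rewrite distrC (lt_trans (Hs None)).
- rewrite (le_lt_trans _ dd)//; apply: cV_norm_le => [|l]; first by rewrite divr_ge0 ?ltW.
  by rewrite !mxE distrC ltW// (Hs (Some (inl l))).
- rewrite (le_lt_trans _ dd)//; apply: cV_norm_le => [|l]; first by rewrite divr_ge0 ?ltW.
  by rewrite !mxE distrC ltW// (Hs (Some (inr l))).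
Qed.

Lemma meas01_comp n m (k : R * ('cV[R]_n * 'cV[R]_m) -> R) x u :
  {within (@dom01 R n m), continuous k} -> measM x -> measM u ->
  meas01 (fun t => k (t, (x t, u t))).
Proof.
move=> ck mx mu.
have cK : {within (@dom01 R n m), continuous (fun p => (k p)%:M : 'M[R]_1)}.
  apply/subspace_continuousP => p pd.
  have /subspace_continuousP/(_ p pd) := ck.
  move=> /cvgrPdist_lt kp; apply/cvgrPdist_lt => e /kp.
  apply: filterS => p'; rewrite /from_subspace -raddfB/=; apply: le_lt_trans.
  by apply: mx_norm_le => // i j; rewrite !ord1 mxE eqxx mulr1n.
have := measM_comp cK mx mu 0 0; apply: meas01_eq => t _.
by rewrite mxE eqxx mulr1n.
Qed.

End MeasurableMatrices.

Section AlmostEverywhere.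
Variable R : realType.
Implicit Types (s t : R) (D : set (lebT R)).

Lemma Leb_aeS (P Q : R -> Prop) : (forall t, P t -> Q t) ->
  (\forall t \ae (@Leb R), P t) -> \forall t \ae (@Leb R), Q t.
Proof.
move=> PQ [N [mN N0 PN]]; exists N; split => // t nQ; apply: PN => Pt.
exact/nQ/PQ.
Qed.

Lemma Leb_aeI (P Q : R -> Prop) : (\forall t \ae (@Leb R), P t) ->
  (\forall t \ae (@Leb R), Q t) -> \forall t \ae (@Leb R), P t /\ Q t.
Proof.
move=> [N [mN N0 PN]] [N' [mN' N'0 PN']]; exists (N `|` N'); split.
- exact: measurableU.
- by rewrite measureU0.
- move=> t /= nPQ; apply: contrapT => /not_orP[nN nN']; apply: nPQ; split.
    by apply: contrapT => /PN.
  by apply: contrapT => /PN'.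
Qed.

Lemma ae01_and (P Q : R -> Prop) : ae01 P -> ae01 Q -> ae01 (fun t => P t /\ Q t).
Proof.
move=> HP HQ; apply: Leb_aeS (Leb_aeI HP HQ) => t [HPt HQt] tI.
by split; [exact: HPt|exact: HQt].
Qed.

Lemma ae01_imp (P Q : R -> Prop) : (forall t, 0 <= t <= 1 -> P t -> Q t) ->
  ae01 P -> ae01 Q.
Proof.
by move=> PQ; apply: Leb_aeS => t HP tI; exact: PQ (HP tI).
Qed.

(** Trades a property valid almost everywhere for a measurable set on which it holds everywhere;
    multiplied by the indicator of this set, estimates become valid at every point of [0, 1]. The
    point 0 is removed because [omega] is controlled only on ]0, 1]. *)
Lemma ae01_goodset (Q : R -> Prop) : ae01 Q -> exists Gd : set (lebT R),
  [/\ measurable Gd, forall t, Gd t -> 0 < t <= 1, forall t, Gd t -> Q t & ae01 Gd].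
Proof.
move=> [N [mN N0 QN]].
have m0 : measurable ([set 0 : R] : set (lebT R)).
  by rewrite -set_itv1; exact: lebT_itv.
exists (`]0, 1]%classic `\` N); split.
- by apply: measurableD => //; exact: lebT_itv.
- by move=> t [/=]; rewrite in_itv.
- move=> t [/= + Nt]; rewrite in_itv/= => /andP[t0 t1].
  by apply: contrapT => nQ; apply/Nt/QN => /(_ _); rewrite (ltW t0) t1 => /(_ isT).
exists (N `|` [set 0]); split.
- exact: measurableU.
- by rewrite measureU0//; exact: Leb_set1.
move=> t /= nG; apply: contrapT => /not_orP[nN n0].
apply: nG => /andP[t0 t1]; split => //=; rewrite in_itv/= t1 andbT lt_neqAle t0 andbT.
by apply/eqP => t00; apply: n0.
Qed.

Lemma ae01_foralln (Q : nat -> R -> Prop) : (forall k, ae01 (Q k)) ->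
  ae01 (fun t => forall k, Q k t).
Proof.
move=> H; have : (\forall t \ae (@Leb R), forall k, 0 <= t <= 1 -> Q k t).
  have := @negligible_bigcup _ _ _ (@Leb R) _ H; apply: negligibleS.
  by move=> t /= /existsNP[k kt]; exists k.
by apply: Leb_aeS => t + tI k; exact.
Qed.

Lemma Leb_integral_ae_eq D (h k : R -> R) :
  measurable D -> D `<=` `[0, 1]%classic -> meas01 h -> meas01 k -> ae01 (fun t => h t = k t) ->
  (\int[@Leb R]_(t in D) (h t)%:E = \int[@Leb R]_(t in D) (k t)%:E)%E.
Proof.
move=> mD DI mh mk hk; apply: (@ae_eq_integral _ (lebT R)) => //.
- by apply/measurable_EFinP; exact: (measurable_funS (lebT_itv _) DI mh).
- by apply/measurable_EFinP; exact: (measurable_funS (lebT_itv _) DI mk).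
- apply: Leb_aeS hk => t hk tD /=; congr EFin; apply: hk.
  by have := DI _ tD; rewrite /= in_itv.
Qed.

Lemma Rintegral_ae_eq D (h k : R -> R) : measurable D -> D `<=` `[0, 1]%classic ->
  meas01 h -> meas01 k -> ae01 (fun t => h t = k t) ->
  \int[@Leb R]_(t in D) h t = \int[@Leb R]_(t in D) k t.
Proof. by move=> *; apply: (congr1 fine); exact: Leb_integral_ae_eq. Qed.

Lemma Leb_setT_gt0 : (0 < @Leb R setT)%E.
Proof.
apply: (@lt_le_trans _ _ (@Leb R (`[0, 1]%classic : set (lebT R)))).
  by rewrite Leb_itvcc// subr0 lte01.
by apply: le_measure; rewrite ?inE//; exact: lebT_itv.
Qed.

(** The norm is an essential supremum over the whole line, which has positive measure, of the
    extension by 0; this is where 0 <= y enters. *)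
Lemma ess_normE (k : R -> R) (y : R) : 0 <= y ->
  (ess_norm k <= y%:E)%E <-> ae01 (fun t => `|k t| <= y).
Proof.
move=> y0; rewrite /ess_norm unlock /Lnorm.body Leb_setT_gt0.
split=> [/ess_supP|H].
  apply: Leb_aeS => t; rewrite /= patchE mem_setE/= in_itv/= => + tI.
  by rewrite tI lee_fin.
apply/ess_supP; apply: Leb_aeS H => t; rewrite /= patchE mem_setE/= in_itv/=.
by case: ifP => [_ /(_ isT)|_ _]; rewrite ?lee_fin// normr0.
Qed.

Lemma ess_norm_fin (k : R -> R) : (ess_norm k < +oo)%E ->
  exists2 M : R, 0 <= M & ae01 (fun t => `|k t| <= M).
Proof.
move=> kfin; exists (`|fine (ess_norm k)|) => //; apply/ess_normE => //.
by move: kfin; case: (ess_norm k) => [r _|//|_]; rewrite ?lee_fin ?ler_norm ?leNye.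
Qed.

Lemma eucl_ge0 p q (A : 'M[R]_(p, q)) : 0 <= eucl A.
Proof. exact: sqrtr_ge0. Qed.

Lemma mx_norm_le_eucl p q (A : 'M[R]_(p, q)) : `|A| <= eucl A.
Proof.
apply: mx_norm_le => [|i j]; first exact: eucl_ge0.
rewrite -sqrtr_sqr ler_wsqrtr// (bigD1 i)//= (bigD1 j)//= -addrA lerDl addr_ge0//.
  by apply: sumr_ge0 => k _; rewrite sqr_ge0.
by apply: sumr_ge0 => k _; apply: sumr_ge0 => l _; rewrite sqr_ge0.
Qed.

Lemma eucl_le_mx_norm p q (A : 'M[R]_(p, q)) : eucl A <= (p * q)%:R * `|A|.
Proof.
have S0 : 0 <= (p * q)%:R * `|A| by rewrite mulr_ge0.
rewrite -[leRHS]ger0_norm// -sqrtr_sqr ler_wsqrtr//.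
apply: (@le_trans _ _ (\sum_(i < p) \sum_(j < q) `|A| ^+ 2)).
  apply: ler_sum => i _; apply: ler_sum => j _.
  by rewrite -[_ ^+ 2]real_normK ?num_real// lerXn2r ?nnegrE// mx_coord_le_norm.
rewrite sumr_const card_ord sumr_const card_ord -mulrnA exprMn -[leLHS]mulr_natl mulnC.
rewrite ler_wpM2r ?sqr_ge0// -natrX ler_nat.
by case: (p * q)%N => // k; rewrite leq_pmulr.
Qed.

Lemma Linf_norm_le p (u : R -> 'cV[R]_p) (y : R) : 0 <= y ->
  ae01 (fun t => `|u t| <= y) -> (Linf_norm u <= (p%:R * y)%:E)%E.
Proof.
move=> y0 uy; apply/ess_normE; first by rewrite mulr_ge0.
apply: ae01_imp uy => t _ uy; rewrite ger0_norm ?eucl_ge0//.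
by rewrite (le_trans (eucl_le_mx_norm _))// muln1 ler_wpM2l.
Qed.

Lemma Linf_norm_fin p (u : R -> 'cV[R]_p) : (Linf_norm u < +oo)%E ->
  exists2 M : R, 0 <= M & ae01 (fun t => `|u t| <= M).
Proof.
move=> /ess_norm_fin[M M0 uM]; exists M => //; apply: ae01_imp uM => t _.
by rewrite ger0_norm ?eucl_ge0//; apply: le_trans; exact: mx_norm_le_eucl.
Qed.

Lemma C_norm_le p (x : R -> 'cV[R]_p) (y : R) :
  (forall t, 0 <= t <= 1 -> `|x t| <= y) -> (C_norm x <= (p%:R * y)%:E)%E.
Proof.
move=> xy; apply: ge_ereal_sup => _ [t /= tI <-]; rewrite lee_fin.
rewrite (le_trans (eucl_le_mx_norm _))// muln1 ler_wpM2l//.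
by apply: xy; move: tI; rewrite in_itv.
Qed.

End AlmostEverywhere.

(** * Estimates for the vector field f *)

Section VectorField.
Variables (R : realType) (n m : nat) (P : problem R n m).
Implicit Types (t s d M e : R) (x xi : 'cV[R]_n) (u w : 'cV[R]_m).
Hypothesis Preg : regular P.

Lemma f_lipschitz M : exists2 C : R, 0 <= C &
  forall t x x' u u', 0 <= t <= 1 -> `|x| <= M -> `|u| <= M -> `|x'| <= M -> `|u'| <= M ->
  `|P_f P t x u - P_f P t x' u'| <= C * (`|x - x'| + `|u - u'|).
Proof.
have [_ f1 _] := Preg.
have /choice[Cf Hf] : forall i, exists C : R, 0 <= C /\
    forall t x x' u u', 0 <= t <= 1 -> `|x| <= M -> `|u| <= M -> `|x'| <= M -> `|u'| <= M ->
    `|P_f P t x u i 0 - P_f P t x' u' i 0| <= C * (`|x - x'| + `|u - u'|).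
  by move=> i; have [C C0 H] := C1_lipschitz M (f1 i); exists C.
have S0 : 0 <= \sum_i Cf i by apply: sumr_ge0 => i _; have [] := Hf i.
exists (\sum_i Cf i) => // t x x' u u' tI xM uM xM' uM'.
apply: cV_norm_le => [|i]; first by rewrite mulr_ge0// addr_ge0.
rewrite !mxE; have [_ /(_ t x x' u u' tI xM uM xM' uM')] := Hf i; move/le_trans; apply.
rewrite ler_wpM2r ?addr_ge0// (bigD1 i)//= lerDl.
by apply: sumr_ge0 => k _; have [] := Hf k.
Qed.

Lemma f_taylor M e : 0 < e -> exists2 d : R, 0 < d &
  forall t x u xi w, 0 <= t <= 1 -> `|x| <= M -> `|u| <= M -> `|xi| < d -> `|w| < d ->
  `|P_f P t (x + xi) (u + w) - P_f P t x u
    - (jac_x (P_f P) t x u *m xi + jac_u (P_f P) t x u *m w)| <= e * (`|xi| + `|w|).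
Proof.
move=> e0; have [_ f1 _] := Preg.
have /choice[df Hf] : forall i, exists d : R, 0 < d /\
  forall t x u xi w, 0 <= t <= 1 -> `|x| <= M -> `|u| <= M -> `|xi| < d -> `|w| < d ->
  `|P_f P t (x + xi) (u + w) i 0 - P_f P t x u i 0
    - (grad_x (fun s y v => P_f P s y v i 0) t x u *m xi +
       grad_u (fun s y v => P_f P s y v i 0) t x u *m w) 0 0| <= e * (`|xi| + `|w|).
  by move=> i; have [d d0 H] := C1_taylor M (f1 i) e0; exists d.
have : \forall d \near (0 : R)^'+, forall i, d <= df i.
  by apply: filter_forall => i; apply: nbhs_right_le; have [] := Hf i.
move=> dle; near (0 : R)^'+ => d; exists d => // t x u xi w tI xM uM xid wd.
apply: cV_norm_le => [|i]; first by rewrite mulr_ge0 ?addr_ge0// ltW.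
have ddf : d <= df i by move: i; near: d.
have [_ /(_ t x u xi w tI xM uM (lt_le_trans xid ddf) (lt_le_trans wd ddf))] := Hf i.
apply: le_trans; rewrite le_eqVlt; apply/orP; left; apply/eqP; congr (`| _ |).
rewrite !mxE; congr (_ - (_ + _)); apply: eq_bigr => k _; congr (_ * _).
  by rewrite /jac_x !mxE.
by rewrite /jac_u !mxE.
Unshelve. all: by end_near. Qed.

Lemma measM_f : forall (x : R -> 'cV[R]_n) (u : R -> 'cV[R]_m),
  measM x -> measM u -> measM (fun t => P_f P t (x t) (u t)).
Proof.
move=> x u mx mu i j; have [_ /(_ i)[c _ _ _] _] := Preg.
by rewrite ord1; exact: (meas01_comp c mx mu).
Qed.

End VectorField.

(** * Truncation to the unit ball of the maximum norm *)

Section Clip.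
Variable R : realType.

(** [forward_volterra] asks for a global Lipschitz bound, whereas f has Lipschitz bounds on bounded
    sets only. Clipping the increment of the state provides one and is invisible on solutions of
    norm at most 1. *)
Definition clip1 (a : R) : R := Num.max (- 1) (Num.min 1 a).
Definition clip p (x : 'cV[R]_p) : 'cV[R]_p := \col_i clip1 (x i 0).

Lemma clip1_le a : `|clip1 a| <= 1.
Proof.
by rewrite /clip1 ler_norml le_max lexx/= ge_max ge_min lexx/= andbT; lra.
Qed.

Lemma clip1_id a : `|a| <= 1 -> clip1 a = a.
Proof.
rewrite /clip1 ler_norml => /andP[h1 h2].
by rewrite (min_idPr _)// (max_idPr _).
Qed.

Lemma clip1_dist a b : `|clip1 a - clip1 b| <= `|a - b|.
Proof.
wlog ab : a b / b <= a.
  by move=> H; case: (leP b a) => [|/ltW] /H //; rewrite distrC [leRHS]distrC.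
rewrite [leRHS]ger0_norm ?subr_ge0// /clip1 ler_norml /Num.max /Num.min.
have e1 : (-1 < 1 :> R) by lra.
case: (ltP 1 a) => h1; case: (ltP 1 b) => h2; rewrite ?e1;
  case: (ltP (-1) a) => h3; case: (ltP (-1) b) => h4; lra.
Qed.

Lemma clip_le p (x : 'cV[R]_p) : `|clip x| <= 1.
Proof. by apply: cV_norm_le => // i; rewrite mxE clip1_le. Qed.

Lemma clip_id p (x : 'cV[R]_p) : `|x| <= 1 -> clip x = x.
Proof.
move=> x1; apply/colP => i; rewrite mxE clip1_id//.
exact: le_trans (mx_coord_le_norm x i 0) x1.
Qed.

Lemma clip_dist p (x y : 'cV[R]_p) : `|clip x - clip y| <= `|x - y|.
Proof.
apply: cV_norm_le => // i; rewrite !mxE (le_trans (clip1_dist _ _))//.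
by have := mx_coord_le_norm (x - y) i 0; rewrite !mxE.
Qed.

Lemma measM_clip p (x : R -> 'cV[R]_p) : measM x -> measM (fun t => clip (x t)).
Proof.
move=> mx; apply/measVM; apply: measV_col => i.
apply: (@meas01_continuous_in _ 'I_1 (fun _ t => x t i 0)); first by move=> _; exact: mx.
move=> t e _ e0; exists e => // s _ /(_ 0); apply: le_lt_trans; exact: clip1_dist.
Qed.

End Clip.

Lemma mem_itvcc (R : realType) (a b r : R) : r \in `[a, b]%classic -> a <= r <= b.
Proof. by rewrite inE/= in_itv. Qed.

(** * Stieltjes charges and charge integrals *)

Section BackwardPrimitive.
Variable R : realType.
Implicit Types (h p : R -> R) (s t : R).

(** Jordan decomposition: with N t = int_t^1 |p|, both N and N + h are nonincreasing, and h is their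
    difference. *)
Lemma bounded_variation_cumul1 h p : inL1 p ->
  (forall t, 0 <= t <= 1 -> h t = \int[@Leb R]_(r in `[t, 1]) p r) -> bounded_variation 0 1 h.
Proof.
move=> pL hE; pose N t := \int[@Leb R]_(r in `[t, 1]) `|p r|.
have nL := inL1_norm pL.
have mono q k : inL1 q -> (forall t, 0 <= q t) ->
    (forall t, 0 <= t <= 1 -> k t = \int[@Leb R]_(r in `[t, 1]) q r) ->
    bounded_variation 0 1 (\- k).
  move=> qL q0 kE; apply: nondecreasing_bounded_variation => s t.
  rewrite !in_itv/= => sI tI st; rewrite lerN2 !kE//.
  move: sI tI => /andP[s0 s1] /andP[t0 t1].
  by rewrite -subr_ge0 cumul1B//; exact: Rintegral_ge0.
have bN := mono _ _ nL (fun t => normr_ge0 _) (fun t _ => erefl (N t)).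
have bD : bounded_variation 0 1 (\- (N \+ h)).
  apply: (mono (fun t => `|p t| + p t)); first exact: inL1D.
    by move=> t; rewrite -lerBlDr sub0r ler_normr lexx orbT.
  move=> t tI /=; rewrite hE// /N; have /andP[t0 t1] := tI.
  rewrite Rintegral_on_D//; [exact: lebT_itv|exact: subIt1].
have := bounded_variationD ltr01 bN (bounded_variationN bD).
rewrite (_ : _ \+ _ = h)//; apply/funext => t /=; by rewrite opprK addKr.
Qed.

Lemma right_continuous_cumul1 p t : inL1 p -> 0 < t < 1 ->
  \int[@Leb R]_(r in `[s, 1]) p r @[s --> t^'+] --> \int[@Leb R]_(r in `[t, 1]) p r.
Proof.
move=> pL /andP[t0 t1]; apply/cvgrPdist_lt => e e0.
have [d d0 H] := cumul1_dist pL e0; near=> s.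
have st : t < s by near: s; exact: nbhs_right_gt.
have s1 : s < 1 by near: s; exact: nbhs_right_lt.
have sd : s < t + d by near: s; apply: nbhs_right_lt; rewrite ltrDl.
by rewrite distrC; apply: H; rewrite ?(ltW t0) ?(ltW st) ?(ltW s1)// ltrBlDl.
Unshelve. all: by end_near. Qed.

Lemma inBV_cumul1 n (p lam : R -> 'cV[R]_n) : (forall i, inL1 (fun t => p t i 0)) ->
  (forall t, 0 <= t <= 1 -> forall i, lam t i 0 = \int[@Leb R]_(r in `[t, 1]) p r i 0) ->
  inBV lam.
Proof.
move=> pL lamE i; split.
  by apply: bounded_variation_cumul1 (pL i) _ => t tI; rewrite lamE.
move=> t /andP[t0 t1]; rewrite lamE ?ltW//.
have := right_continuous_cumul1 (pL i) (introT andP (conj t0 t1)).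
apply: cvg_trans; apply: near_eq_cvg; near=> s.
rewrite lamE//; apply/andP; split; last by near: s; apply: nbhs_right_le.
by apply/ltW/(lt_trans t0); near: s; exact: nbhs_right_gt.
Unshelve. all: by end_near. Qed.

(** The charge with density [p] lives on the Lebesgue sets; pushing it forward by the identity
    restricts it to the Borel sets, where Stieltjes charges are defined. *)
Lemma borel_density_charge p : inL1 p ->
  exists nu : {charge set (measurableTypeR R) -> \bar R},
    forall B : set (measurableTypeR R), measurable B -> B `<=` `[0, 1] ->
      nu B = (\int[@Leb R]_(t in (B : set (lebT R))) (p t)%:E)%E.
Proof.
move=> pL.
have pR : (@Leb R).-integrable setT (((EFin \o p) \_ `[0, 1]) : lebT R -> \bar R).
  by apply/(integrable_mkcond _ (lebT_itv `[0, 1])).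
have mid : measurable_fun setT (id : lebT R -> measurableTypeR R).
  by move=> _ Y mY; rewrite setTI; exact: lebT_measurable_borel.
exists (pushforward (induced_charge pR) (id : lebT R -> measurableTypeR R)) => B mB BI.
transitivity (\int[@Leb R]_(t in (B : set (lebT R)))
  (((EFin \o p) \_ `[0%R, 1%R]%classic) : lebT R -> \bar R) t)%E => //.
have mB' : measurable (B : set (lebT R)) by exact: lebT_measurable_borel.
by apply: eq_integral => t /set_mem/BI tI; rewrite patchE mem_set.
Unshelve. exact: mid. Qed.

End BackwardPrimitive.

Section ZeroCharge.
Variable R : realType.

Lemma sintegral_czero (f : lebT R -> R) : sintegral (@czero _ (lebT R) R) f = 0%E.
Proof. by rewrite /sintegral fsbig1// => x _; rewrite /czero mule0. Qed.

(* Rounds [x] down to a multiple of [1 / j.+1], counted from [- C]; the cap [N]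
   keeps the range finite. *)
Definition quantize (C : R) (N j : nat) (x : R) : R :=
  (minn (Num.truncn ((x + C) * j.+1%:R)) N)%:R / j.+1%:R - C.

(** For |x| <= C the cap cuts nothing off, as x + C <= 2 C. *)
Lemma quantize_dist (C : R) j x : `|x| <= C ->
  `|quantize C (Num.truncn (2 * C * j.+1%:R)) j x - x| <= j.+1%:R^-1.
Proof.
move=> /ler_normlP[x1 x2]; have j0 : (0 : R) < j.+1%:R by rewrite ltr0n.
have y0 : 0 <= (x + C) * j.+1%:R by rewrite mulr_ge0//; lra.
have yle : (x + C) * j.+1%:R <= 2 * C * j.+1%:R by rewrite ler_wpM2r//; lra.
rewrite /quantize (minn_idPl _); last exact: le_truncn.
have /andP[l1 l2] := truncn_itv y0.
have -> : (Num.truncn ((x + C) * j.+1%:R))%:R / j.+1%:R - C - x =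
  - (((x + C) * j.+1%:R - (Num.truncn ((x + C) * j.+1%:R))%:R) / j.+1%:R).
  by rewrite mulrBl mulfK ?gt_eqF//; ring.
rewrite normrN ger0_norm ?divr_ge0 ?subr_ge0// -[leRHS]mul1r ler_wpM2r ?invr_ge0//.
by rewrite lerBlDl -natr1 -natr1 in l2 *; rewrite ltW// natr1.
Qed.

Lemma quantize_measurable (C : R) N j : measurable_fun [set: R] (quantize C N j).
Proof.
apply: nondecreasing_measurable => // x y xy; rewrite lerD2r ler_wpM2r ?invr_ge0//.
rewrite ler_nat leq_min geq_minr andbT (leq_trans (geq_minl _ _))//.
by apply: le_truncn; rewrite ler_wpM2r// lerD2r.
Qed.

Lemma quantize_finite (C : R) N j : finite_set (range (quantize C N j)).
Proof.
apply: (@sub_finite_set _ _ ((fun i : nat => i%:R / j.+1%:R - C) @` `I_N.+1)).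
  move=> _ [x _ <-]; exists (minn (Num.truncn ((x + C) * j.+1%:R)) N) => //=.
  by rewrite ltnS geq_minr.
exact/finite_image/finite_II.
Qed.

(** Every simple function has integral 0 against the zero charge, but the definition still asks for
    simple functions converging to [k] on [E] uniformly almost everywhere; rounding to multiples of
    1 / (j + 1) supplies them for essentially bounded [k]. *)
Lemma is_charge_int_czero (E : set (lebT R)) (k : R -> R) (C : R) : measurable E ->
  meas01 k -> ae01 (fun t => `|k t| <= C) ->
  is_charge_int (@czero _ (lebT R) R) E k 0.
Proof.
(* Simple functions are measurable on the whole line, [k] only on [0, 1]; hence the extension by
   0. *)
move=> mE mk kC; pose k0 : lebT R -> R := (k \_ `[0, 1]) \* \1_E.
have mk0 : measurable_fun setT k0.
  apply: measurable_funM; last exact: measurable_indic.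
  by apply/(measurable_restrictT _ (lebT_itv `[0, 1])).
pose s j := quantize C (Num.truncn (2 * C * j.+1%:R)) j \o k0.
have ms j : measurable_fun setT (s j) by apply: measurableT_comp mk0; exact: quantize_measurable.
have fs j : finite_set (range (s j)).
  apply: sub_finite_set (quantize_finite C (Num.truncn (2 * C * j.+1%:R)) j).
  by move=> _ [t _ <-]; exists (k0 t).
have sP j : s j \in (@sfun _ (lebT R) R) by apply/andP; split; apply/mem_set; [exact: ms|exact: fs].
pose sf j : {sfun (lebT R) >-> R} := sfun_Sub (sP j); exists sf; split; last first.
  under eq_fun do rewrite sintegral_czero.
  exact: cvg_cst.
apply: (@squeeze_cvge _ _ _ _ (cst 0%E) _ (fun j => (j.+1%:R^-1 : R)%:E)).
- apply: nearW => j; apply/andP; split; first exact: Lnorm_ge0.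
  apply/ess_normE => //; apply: ae01_imp kC => t tI kt.
  have -> : k t * \1_E t = k0 t by rewrite /k0 /= patchE mem_set//= in_itv.
  rewrite /sf sfun_valP; apply: quantize_dist.
  rewrite /k0 /= patchE mem_set/= ?in_itv// normrM (le_trans _ kt)// ler_piMr//.
  by rewrite indicE; case: (_ \in _); rewrite normr_nat ?lexx.
- exact: cvg_cst.
- apply/cvg_EFin; first exact: nearW.
  exact: cvg_harmonic.
Qed.

End ZeroCharge.

Lemma Leb_Rintegral_eq0 (R : realType) (D : set (lebT R)) (h : R -> R) :
  (forall r, D r -> h r = 0) -> \int[@Leb R]_(r in D) h r = 0.
Proof. by move=> h0; apply: (congr1 fine (y := 0%E)); apply: integral0_eq => r /h0 ->. Qed.

Lemma Rintegral01_sum (R : realType) p (h : 'I_p -> R -> R) : (forall i, inL1 (h i)) ->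
  \int[@Leb R]_(t in `[0, 1]) (\sum_i h i t) = \sum_i \int[@Leb R]_(t in `[0, 1]) h i t.
Proof.
elim: p h => [|p IH] h hL.
  by rewrite big_ord0; apply: Leb_Rintegral_eq0 => r _; rewrite big_ord0.
rewrite big_ord_recl -IH// -Rintegral_on_D//.
- by apply: eq_Rintegral => r _; rewrite big_ord_recl.
- exact: lebT_itv.
- exact: inL1_sum.
Qed.

(** With [a] and [b] the dimensions of state and control, one smallness condition on s implies all
    four that the perturbation has to meet. *)
Lemma weighted_sum_bounds (R : realFieldType) (a b A B : R) :
  0 <= a -> 0 <= b -> 0 <= A -> 0 <= B ->
  [/\ a * A <= (a + b) * (A + B) + A + B + 1, b * B <= (a + b) * (A + B) + A + B + 1,
      A <= (a + b) * (A + B) + A + B + 1 & B <= (a + b) * (A + B) + A + B + 1].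
Proof.
move=> a0 b0 A0 B0; have := mulr_ge0 a0 A0; have := mulr_ge0 a0 B0.
have := mulr_ge0 b0 A0; have := mulr_ge0 b0 B0.
by split; lra.
Qed.

(** * The squared Euclidean norm *)

Section SquareNorm.
Variables (R : realType) (p : nat).
Implicit Types (x y : 'cV[R]_p).

Definition sqn x : R := (x^T *m x) 0 0.

Lemma sqnE x : sqn x = \sum_i x i 0 ^+ 2.
Proof. by rewrite /sqn mxE; apply: eq_bigr => i _; rewrite mxE expr2. Qed.

Lemma sqn_ge0 x : 0 <= sqn x.
Proof. by rewrite sqnE; apply: sumr_ge0 => i _; exact: sqr_ge0. Qed.

Lemma sqn_eq0 x : sqn x = 0 -> x = 0.
Proof.
rewrite sqnE => x0; apply/colP => i; rewrite mxE; apply/eqP.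
have /(_ _ i isT)/eqP := psumr_eq0P _ x0; rewrite sqrf_eq0; apply => j _.
exact: sqr_ge0.
Qed.

Lemma sqn_addZ x y (c : R) :
  sqn (x + c *: y) = sqn x + 2 * c * (y^T *m x) 0 0 + c ^+ 2 * sqn y.
Proof.
rewrite !sqnE mxE !mulr_sumr -!big_split; apply: eq_bigr => i _.
by rewrite !mxE/=; ring.
Qed.

End SquareNorm.

(** * The adjoint equation and the variation of the control *)

Section Hamiltonian.
Variables (R : realType) (n m : nat).

Lemma tr_mul_mx (A : 'M[R]_n) (x y : 'cV[R]_n) :
  ((A *m x)^T *m y) 0 0 = ((A^T *m y)^T *m x) 0 0.
Proof.
have -> : (A^T *m y)^T *m x = ((A *m x)^T *m y)^T.
  by rewrite !trmx_mul !trmxK mulmxA.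
by rewrite [RHS]mxE.
Qed.

Lemma tr_sub_mul (a c : R) (x y z : 'cV[R]_m) :
  ((a *: x - c *: y)^T *m z) 0 0 = a * (x^T *m z) 0 0 - c * (y^T *m z) 0 0.
Proof.
rewrite !mxE !mulr_sumr -sumrB; apply: eq_bigr => k _; rewrite !mxE; ring.
Qed.

Lemma tr_add_mul (x y z : 'cV[R]_n) :
  ((x + y)^T *m z) 0 0 = (x^T *m z) 0 0 + (y^T *m z) 0 0.
Proof.
by rewrite !mxE -big_split; apply: eq_bigr => k _; rewrite !mxE/=; ring.
Qed.

Lemma tr_comb_mul (y z : 'cV[R]_n) (a b : 'rV[R]_n) (c : R) :
  ((y + a^T + c *: b^T)^T *m z) 0 0 =
  (y^T *m z) 0 0 + (a *m z) 0 0 + c * (b *m z) 0 0.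
Proof.
rewrite !mxE mulr_sumr -!big_split; apply: eq_bigr => k _; rewrite !mxE/=; ring.
Qed.

(** The terms in F and [lx] cancel between the linearized dynamics and the adjoint equation. What
    remains is w . h - z gx xi with h = G^T lam + lu^T and z = - q . h; the feedback part of [w]
    contributes - (gx xi) (q . h), which the term in z compensates. *)
Lemma hamiltonian_identity (F : 'M[R]_n) (G : 'M[R]_(n, m)) (lx gx : 'rV[R]_n)
    (lu : 'rV[R]_m) (q v w : 'cV[R]_m) (xi lam : 'cV[R]_n) (s : R) :
  w = s *: v - (gx *m xi) 0 0 *: q ->
  (lx *m xi + lu *m w) 0 0 + ((F *m xi + G *m w)^T *m lam) 0 0 -
  ((F^T *m lam + lx^T + (- (q^T *m (G^T *m lam + lu^T)) 0 0) *: gx^T)^T *m xi) 0 0 =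
  s * (v^T *m (G^T *m lam + lu^T)) 0 0.
Proof.
move=> wE; have hE : (w^T *m (G^T *m lam + lu^T)) 0 0 = (lu *m w) 0 0 + ((G *m w)^T *m lam) 0 0.
  rewrite mulmxDr trmx_mul mulmxA addrC.
  have -> : lu *m w = (w^T *m lu^T)^T by rewrite trmx_mul !trmxK.
  by rewrite mxE [X in _ = X + _]mxE addrC.
have wE' : (w^T *m (G^T *m lam + lu^T)) 0 0 = s * (v^T *m (G^T *m lam + lu^T)) 0 0 -
    (gx *m xi) 0 0 * (q^T *m (G^T *m lam + lu^T)) 0 0 by rewrite wE tr_sub_mul.
have f1 := tr_mul_mx F xi lam.
move: wE' hE f1; move: (G^T *m lam + lu^T) => h {wE}.
rewrite tr_add_mul tr_comb_mul; move: (F^T *m lam) => y.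
move: (w^T *m h) (v^T *m h) (q^T *m h) => c1 c2 c3.
move: (lu *m w) ((G *m w)^T *m lam) ((F *m xi)^T *m lam) => c4 c5 c6.
move: (y^T *m xi) (lx *m xi) (gx *m xi) => c7 c8 c9 E1 E2 E3.
by rewrite [X in X + _ - _]mxE; lra.
Qed.

End Hamiltonian.

(** * The integrable weight 1 / omega *)

Section GrowthWeight.
Variables (R : realType) (omega : R -> R).
Hypothesis omega_gt0 : forall t, 0 < t <= 1 -> 0 < omega t.
Hypothesis omega_nd : forall s t, 0 < s -> s <= t -> t <= 1 -> omega s <= omega t.
Hypothesis omega_int : (\int[@Leb R]_(t in `]0%R, 1%R]) ((omega t)^-1)%:E < +oo)%E.

(* Extends [1 / omega] to the whole line, by 0 for [t <= 0]. *)
Definition weight (t : R) : R := if t <= 0 then 0 else (omega (Num.min t 1))^-1.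

Lemma weightE t : 0 < t <= 1 -> weight t = (omega t)^-1.
Proof. by move=> /andP[t0 t1]; rewrite /weight leNgt t0/= (min_idPl t1). Qed.

Lemma weight_ge0 t : 0 <= weight t.
Proof.
rewrite /weight; have [//|t0] := leP t 0; rewrite invr_ge0 ltW// omega_gt0//.
by rewrite lt_min t0 ltr01 ge_min lexx orbT.
Qed.

Lemma weight_le d t : 0 < d -> d <= t <= 1 -> weight t <= (omega d)^-1.
Proof.
move=> d0 /andP[dt t1]; have t0 := lt_le_trans d0 dt.
have d1 := le_trans dt t1.
by rewrite weightE ?t0// lef_pV2 ?posrE ?omega_gt0 ?t0 ?d0// omega_nd.
Qed.

(** Measurability comes from monotonicity: [omega], extended by 0 to the left and by its value at 1
    to the right, is nondecreasing on the line, and [weight] is its inverse with 0^-1 = 0. *)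
Lemma meas01_weight : meas01 weight.
Proof.
pose W t : R := if t <= 0 then 0 else omega (Num.min t 1).
have W0 t : 0 < t -> 0 < W t.
  move=> t0; rewrite /W leNgt t0/= omega_gt0// lt_min t0 ltr01.
  by rewrite ge_min lexx orbT.
have mW : meas01 W.
  apply: lebT_measurable_fun_borel; last exact: measurable_itv.
  apply: nondecreasing_measurable; first exact: measurable_itv.
  move=> s t st; have [s0|s0] := leP s 0.
    rewrite {1}/W s0; have [t0|/W0/ltW//] := leP t 0; by rewrite /W t0.
  have t0 := lt_le_trans s0 st; rewrite /W [s <= 0]leNgt s0 [t <= 0]leNgt t0/=.
  apply: omega_nd; first by rewrite lt_min s0 ltr01.
    by rewrite le_min ge_min st/= ge_min lexx orbT.
  by rewrite ge_min lexx orbT.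
apply: meas01_eq (meas01V mW) => t _; rewrite /W /weight.
by case: ifP => // _; rewrite invr0.
Qed.

Lemma inL1_weight : inL1 weight.
Proof.
apply/integrableP; split; first by apply/measurable_EFinP; exact: meas01_weight.
apply: le_lt_trans omega_int.
have -> : (`]0%R, 1%R]%classic : set (lebT R)) = `[0%R, 1%R]%classic `&` `]0%R, 1%R]%classic.
  by rewrite setIidr//; apply: subset_itvr; rewrite bnd_simp.
rewrite integral_mkcondr le_eqVlt; apply/orP; left; apply/eqP.
apply: eq_integral => t; rewrite inE/= in_itv/= => /andP[t0 t1].
rewrite patchE; case: ifPn => [|tN].
  by rewrite inE/= in_itv/= => tI; rewrite weightE// ger0_norm// invr_ge0 ltW// omega_gt0.
have -> : t = 0.
  apply/eqP; rewrite eq_le t0 andbT leNgt; apply/negP => tp.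
  by move/negP: tN; apply; rewrite inE/= in_itv/= tp.
by rewrite /weight lexx normr0.
Qed.

End GrowthWeight.

(** * The adjoint equation with z eliminated *)

Section Multiplier.
Variables (R : realType) (n m : nat) (P : problem R n m).
Variables (xb dxb : R -> 'cV[R]_n) (ub : R -> 'cV[R]_m).
Variables (M eps : R) (om : R -> R) (Gd : set (lebT R)).
Implicit Types (t s d : R).

Hypothesis Preg : regular P.
Hypothesis mxb : measM xb.
Hypothesis mub : measM ub.
Hypothesis xb_le : forall t, 0 <= t <= 1 -> `|xb t| <= M.
Hypothesis mGd : measurable Gd.
Hypothesis Gd01 : forall t, Gd t -> 0 < t <= 1.
Hypothesis aeGd : ae01 Gd.
Hypothesis ub_le : forall t, Gd t -> `|ub t| <= M.
Hypothesis omL1 : inL1 om.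
Hypothesis om_ge0 : forall t, 0 <= t <= 1 -> 0 <= om t.
Hypothesis om_bnd : forall d, 0 < d -> exists C, forall t, d <= t <= 1 -> om t <= C.

Local Notation fx := (bar (jac_x (P_f P)) xb ub).
Local Notation fu := (bar (jac_u (P_f P)) xb ub).
Local Notation Lx := (bar (grad_x (P_L P)) xb ub).
Local Notation Lu := (bar (grad_u (P_L P)) xb ub).
Local Notation gx := (bar (grad_x (P_g P)) xb ub).
Local Notation gu := (bar (grad_u (P_g P)) xb ub).
Local Notation gb := (bar (P_g P) xb ub).

Hypothesis gb_le0 : forall t, Gd t -> gb t <= 0.
Hypothesis gu_om : forall t, Gd t -> - eps <= gb t -> 1 <= om t * eucl (gu t).

Lemma Gd_I t : Gd t -> 0 <= t <= 1.
Proof. by move=> /Gd01/andP[t0 ->]; rewrite ltW. Qed.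

Lemma measM_Lx : measM Lx.
Proof. by have [[_ _ + _] _ _] := Preg => c; exact: measM_comp c mxb mub. Qed.

Lemma measM_Lu : measM Lu.
Proof. by have [[_ _ _ +] _ _] := Preg => c; exact: measM_comp c mxb mub. Qed.

Lemma measM_gx : measM gx.
Proof. by have [_ _ [_ _ + _]] := Preg => c; exact: measM_comp c mxb mub. Qed.

Lemma measM_gu : measM gu.
Proof. by have [_ _ [_ _ _ +]] := Preg => c; exact: measM_comp c mxb mub. Qed.

Lemma measM_fx : measM fx.
Proof.
move=> i j; have [_ + _] := Preg => /(_ i)[_ _ c _].
apply: meas01_eq (measM_comp c mxb mub 0 j) => t _.
by rewrite /bar /jac_x !mxE.
Qed.

Lemma measM_fu : measM fu.
Proof.
move=> i j; have [_ + _] := Preg => /(_ i)[_ _ _ c].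
apply: meas01_eq (measM_comp c mxb mub 0 j) => t _.
by rewrite /bar /jac_u !mxE.
Qed.

Lemma meas01_gb : meas01 gb.
Proof. by have [_ _ [c _ _ _]] := Preg; exact: meas01_comp c mxb mub. Qed.

Lemma bar_bounds : exists2 C, 0 <= C & forall t, Gd t ->
  [/\ `|fx t| <= C, `|fu t| <= C, `|Lx t| <= C & `|Lu t| <= C] /\
  `|gx t| <= C.
Proof.
have [L1 f1 g1] := Preg.
have [CL CL0 HL] := C1_bounded M L1; have [Cg Cg0 Hg] := C1_bounded M g1.
have /choice[Cf Hf] : forall i, exists C : R, 0 <= C /\ forall t x u, 0 <= t <= 1 ->
    `|x| <= M -> `|u| <= M -> `|grad_x (fun s y v => P_f P s y v i 0) t x u| <= C /\
                             `|grad_u (fun s y v => P_f P s y v i 0) t x u| <= C.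
  move=> i; have [C C0 H] := C1_bounded M (f1 i); exists C; split => // t x u tI xM uM.
  by have [] := H t x u tI xM uM.
have Sf0 : 0 <= \sum_i Cf i by apply: sumr_ge0 => i _; have [] := Hf i.
have Cfi i : Cf i <= CL + Cg + \sum_i Cf i.
  rewrite (bigD1 i)//= addrCA lerDl addr_ge0 ?addr_ge0//.
  by apply: sumr_ge0 => k _; have [] := Hf k.
exists (CL + Cg + \sum_i Cf i) => [|t tG]; first by rewrite !addr_ge0.
have tI := Gd_I tG; have xM := xb_le tI; have uM := ub_le tG.
have [_ l1 l2] := HL _ _ _ tI xM uM; have [_ h1 h2] := Hg _ _ _ tI xM uM.
have S0 : 0 <= CL + Cg + \sum_i Cf i by rewrite !addr_ge0.
split; last by apply: (le_trans h1); lra.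
split.
- apply: mx_norm_le => // i j; apply: le_trans (Cfi i).
  have [_ /(_ _ _ _ tI xM uM)[+ _]] := Hf i; apply: le_trans.
  by rewrite /bar /jac_x mxE mx_coord_le_norm.
- apply: mx_norm_le => // i j; apply: le_trans (Cfi i).
  have [_ /(_ _ _ _ tI xM uM)[_ +]] := Hf i; apply: le_trans.
  by rewrite /bar /jac_u mxE mx_coord_le_norm.
- by apply: (le_trans l1); lra.
- by apply: (le_trans l2); lra.
Qed.

Lemma gu_bounded : exists2 C : R, 0 <= C & forall t, Gd t -> `|gu t| <= C.
Proof.
have [_ _ g1] := Preg; have [C C0 HC] := C1_bounded M g1; exists C => // t tG.
by have [] := HC _ _ _ (Gd_I tG) (xb_le (Gd_I tG)) (ub_le tG).
Qed.

Definition act : set (lebT R) := Gd `&` [set t | 0 <= t <= 1 /\ - eps <= gb t].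

Lemma measurable_act : measurable act.
Proof. by apply: measurableI => //; exact: measurable_level meas01_gb. Qed.

Definition nrm2 t : R := (gu t *m (gu t)^T) 0 0.

Lemma nrm2E t : nrm2 t = eucl (gu t) ^+ 2.
Proof.
rewrite /nrm2 /eucl; move: (gu t) => A; rewrite sqr_sqrtr; last first.
  by apply: sumr_ge0 => i _; apply: sumr_ge0 => j _; exact: sqr_ge0.
by rewrite big_ord1 mxE; apply: eq_bigr => j _; rewrite mxE expr2.
Qed.

Lemma act_eucl_gt0 t : act t -> 0 < eucl (gu t).
Proof.
move=> [tG [tI ge]]; have := gu_om tG ge; rewrite lt_neqAle eucl_ge0 andbT => H.
by apply/eqP => e0; move: H; rewrite -e0 mulr0 ler10.
Qed.

(* Right inverse of [gu t], extended by 0 off the active set. *)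
Definition gu_inv t : 'cV[R]_m := (\1_act t * (nrm2 t)^-1) *: (gu t)^T.

Lemma measM_gu_inv : measM gu_inv.
Proof.
apply: measMZ; last exact: measM_tr measM_gu.
apply: measurable_funM; first exact: meas01_indic measurable_act.
apply: meas01V; exact: (measM_mul measM_gu (measM_tr measM_gu)).
Qed.

Lemma gu_inv_act t : act t -> (gu t *m gu_inv t) 0 0 = 1.
Proof.
move=> at_; rewrite /gu_inv -scalemxAr mxE indicE mem_set// mul1r mulVf//.
by rewrite nrm2E gt_eqF// exprn_gt0// act_eucl_gt0.
Qed.

Lemma gu_inv_nact t : ~ act t -> gu_inv t = 0.
Proof. by move=> nat_; rewrite /gu_inv indicE memNset// mul0r scale0r. Qed.

Lemma gu_inv_le t : 0 <= t <= 1 -> `|gu_inv t| <= om t.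
Proof.
move=> tI; have [at_|/gu_inv_nact ->] := pselect (act t); last by rewrite normr0 om_ge0.
have e0 := act_eucl_gt0 at_; have [tG [_ ge]] := at_.
rewrite /gu_inv normrZ indicE mem_set// mul1r nrm2E trmx_norm normfV normrX ger0_norm ?eucl_ge0//.
rewrite mulrC ler_pdivrMr ?exprn_gt0// (le_trans (mx_norm_le_eucl _))//.
by rewrite expr2 mulrA ler_peMl ?eucl_ge0// gu_om.
Qed.

(** Gradient in u, as a column, of the Hamiltonian l . f + L along the reference process. *)
Definition hamu t (l : 'cV[R]_n) : 'cV[R]_m := (fu t)^T *m l + (Lu t)^T.
Definition mulz t (l : 'cV[R]_n) : R := - ((gu_inv t)^T *m hamu t l) 0 0.
(** Minus the derivative of the adjoint arc, once z is replaced by [mulz]. The indicator makes the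
    bounds hold at every t of [0, 1], as [backward_volterra] demands. *)
Definition adjp t (l : 'cV[R]_n) : 'cV[R]_n :=
  (\1_Gd t : R) *: ((fx t)^T *m l + (Lx t)^T + mulz t l *: (gx t)^T).

Lemma measM_hamu (l : R -> 'cV[R]_n) : measM l -> measM (fun t => hamu t (l t)).
Proof.
move=> ml; apply: measMD; last exact: measM_tr measM_Lu.
exact: measM_mul (measM_tr measM_fu) ml.
Qed.

Lemma meas01_mulz (l : R -> 'cV[R]_n) : measM l -> meas01 (fun t => mulz t (l t)).
Proof.
move=> ml; have := measMN (measM_mul (measM_tr measM_gu_inv) (measM_hamu ml)).
by move=> /(_ 0 0); apply: meas01_eq => t _; rewrite mxE.
Qed.

Lemma measM_adjp (l : R -> 'cV[R]_n) : measM l -> measM (fun t => adjp t (l t)).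
Proof.
move=> ml; apply: measMZ; first exact: meas01_indic.
apply: measMD; last exact: measMZ (meas01_mulz ml) (measM_tr measM_gx).
apply: measMD; last exact: measM_tr measM_Lx.
exact: measM_mul (measM_tr measM_fx) ml.
Qed.

Lemma adjoint_exists : exists (lam : R -> 'cV[R]_n) (C : R),
  [/\ measM lam,
      forall t, 0 <= t <= 1 -> `|lam t| <= C,
      forall i, inL1 (fun t => adjp t (lam t) i 0) &
      forall t, 0 <= t <= 1 -> forall i,
        lam t i 0 = \int[@Leb R]_(r in `[t, 1]) adjp r (lam r) i 0].
Proof.
have [C C0 HC] := bar_bounds.
(* One summand for each contribution: [fx], [Lx], and the parts of [mulz] coming from [fu] and from
   [Lu]. The last two carry a factor [om t], whence the coefficient K (1 + om). *)
pose K : R := n%:R * C + C + m%:R * (n%:R * C) * C + m%:R * C * C.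
have K0 : 0 <= K by rewrite !addr_ge0 ?mulr_ge0.
pose a t := K * (1 + om t).
have aL : inL1 a by apply: inL1Z; apply: inL1D => //; exact: inL1_cst.
have a0 t : 0 <= t <= 1 -> 0 <= a t by move=> tI; rewrite mulr_ge0// addr_ge0// om_ge0.
have ab d : 0 < d -> exists M0, forall t, d <= t <= 1 -> a t <= M0.
  move=> /om_bnd[M0 HM0]; exists (K * (1 + M0)) => t tI.
  by rewrite ler_wpM2l// lerD2l HM0.
have mulN t : ~ Gd t -> (\1_Gd t : R) = 0 by move=> ?; rewrite indicE memNset.
have mulY t : Gd t -> (\1_Gd t : R) = 1 by move=> ?; rewrite indicE mem_set.
have qq t (v : 'cV[R]_m) (c : R) : Gd t -> `|v| <= c ->
    `|((gu_inv t)^T *m v) 0 0| <= m%:R * om t * c.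
  move=> tG vc; apply: mulmx_coord_le => //; rewrite trmx_norm; exact: gu_inv_le (Gd_I tG).
have tr_mul p q (A : 'M[R]_(p, q)) (v : 'cV[R]_p) : `|A| <= C ->
    `|A^T *m v| <= p%:R * C * `|v|.
  move=> AC; rewrite (le_trans (mulmx_norm_le _ _))// trmx_norm ler_wpM2r//.
  by rewrite ler_wpM2l.
have [|||lam [C' [ml bl Il El]]] := @backward_volterra R n adjp a aL a0 ab.
- by move=> xi mxi; apply/measVM; apply: measM_adjp; apply/measVM.
- move=> t tI xi xi'; rewrite /adjp -scalerBr.
  have [tG|nG] := pselect (Gd t); last by rewrite mulN// scale0r normr0 mulr_ge0// a0.
  have [[bfx bfu _ _] bgx] := HC t tG; have o0 := om_ge0 tI.
  rewrite mulY// scale1r.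
  have -> : (fx t)^T *m xi + (Lx t)^T + mulz t xi *: (gx t)^T -
     ((fx t)^T *m xi' + (Lx t)^T + mulz t xi' *: (gx t)^T) =
     (fx t)^T *m (xi - xi') - ((gu_inv t)^T *m ((fu t)^T *m (xi - xi'))) 0 0 *: (gx t)^T.
    have -> : ((gu_inv t)^T *m ((fu t)^T *m (xi - xi'))) 0 0 = - (mulz t xi - mulz t xi').
      rewrite /mulz /hamu !mulmxDr !mulmxN.
      move: (_ *m (_ *m xi)) (_ *m (_ *m xi')) (_ *m (Lu t)^T) => c1 c2 c3.
      by rewrite !mxE; ring.
    rewrite mulmxBr.
    move: (_ *m xi) (_ *m xi') (mulz t xi) (mulz t xi') ((gx t)^T) ((Lx t)^T).
    move=> c1 c2 c3 c4 c5 c6.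
    by apply/matrixP => i j; rewrite !mxE; ring.
  rewrite (le_trans (ler_normB _ _))// normrZ trmx_norm.
  have h1 := tr_mul _ _ _ (xi - xi') bfx.
  have h2 := qq t _ _ tG (tr_mul _ _ _ (xi - xi') bfu).
  have h3 := ler_pM (normr_ge0 _) (normr_ge0 _) h2 bgx.
  apply: le_trans (lerD h1 h3) _.
  have -> : n%:R * C * `|xi - xi'| + m%:R * om t * (n%:R * C * `|xi - xi'|) * C =
    (n%:R * C + m%:R * (n%:R * C) * C * om t) * `|xi - xi'| by ring.
  rewrite ler_wpM2r// /a /K.
  have x1 : 0 <= m%:R * (n%:R * C) * C by rewrite !mulr_ge0.
  have x2 : 0 <= (n%:R * C + C + m%:R * C * C) * om t by rewrite mulr_ge0 ?addr_ge0 ?mulr_ge0.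
  have x3 : 0 <= m%:R * C * C by rewrite !mulr_ge0.
  lra.
- move=> t tI; rewrite /adjp.
  have [tG|nG] := pselect (Gd t); last by rewrite mulN// scale0r normr0 a0.
  have [[_ _ bLx bLu] bgx] := HC t tG; have o0 := om_ge0 tI.
  rewrite mulY// scale1r mulmx0 add0r (le_trans (ler_normD _ _))// normrZ !trmx_norm.
  rewrite /mulz /hamu mulmx0 add0r normrN.
  have bLu' : `|(Lu t)^T| <= C by rewrite trmx_norm.
  have h3 := ler_pM (normr_ge0 _) (normr_ge0 _) (qq t _ _ tG bLu') bgx.
  apply: le_trans (lerD bLx h3) _; rewrite /a /K.
  have x1 : 0 <= m%:R * (n%:R * C) * C by rewrite !mulr_ge0.
  have x2 : 0 <= (n%:R * C + C + m%:R * (n%:R * C) * C) * om t.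
    by rewrite mulr_ge0 ?addr_ge0 ?mulr_ge0.
  have x3 : 0 <= m%:R * C * C by rewrite !mulr_ge0.
  have x4 : 0 <= n%:R * C by rewrite !mulr_ge0.
  lra.
by exists lam, C'; split => //; apply/measVM.
Qed.

(** * Controls perturbed away from 0 *)

Section Variation.
Variables (dl eta kappa V : R) (v : R -> 'cV[R]_m).
Hypothesis dl_gt0 : 0 < dl.
Hypothesis mv : measM v.
Hypothesis v_le : forall t, 0 <= t <= 1 -> `|v t| <= V.

(** On [dl, 1] the weight [om] is bounded, hence so is [gu_inv], and the feedback control stays
    essentially bounded. *)
Definition Gdl : set (lebT R) := Gd `&` `[dl, 1]%classic.

Lemma Gdl_Gd t : Gdl t -> Gd t. Proof. by case. Qed.

(* The term in [gu_inv] cancels the first order effect of [xi] on [g]. *)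
Definition feedback s t (xi : 'cV[R]_n) : 'cV[R]_m :=
  (\1_Gdl t : R) *: (s *: v t - (gx t *m xi) 0 0 *: gu_inv t).

(** Right-hand side of the equation for the increment xi = x - xb; the indicator keeps xi at 0 up to
    time [dl]. *)
Definition perturbed_rhs s t (xi : 'cV[R]_n) : 'cV[R]_n :=
  (\1_Gdl t : R) *:
    (P_f P t (xb t + xi) (ub t + feedback s t xi) - P_f P t (xb t) (ub t)).

Lemma measurable_Gdl : measurable Gdl.
Proof. by apply: measurableI => //; exact: lebT_itv. Qed.

Lemma measM_feedback s (xi : R -> 'cV[R]_n) : measM xi ->
  measM (fun t => feedback s t (xi t)).
Proof.
move=> mxi; apply: measMZ; first exact: meas01_indic measurable_Gdl.
apply: measMB; first by apply: measMZ => //; exact: measurable_cst.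
by apply: measMZ; [exact: (measM_mul measM_gx mxi)|exact: measM_gu_inv].
Qed.

Lemma measM_perturbed_rhs s (xi : R -> 'cV[R]_n) : measM xi ->
  measM (fun t => perturbed_rhs s t (xi t)).
Proof.
move=> mxi; apply: measMZ; first exact: meas01_indic measurable_Gdl.
apply: measMB; last exact: measM_f.
by apply: measM_f => //; apply: measMD => //; exact: measM_feedback.
Qed.

Lemma indGdlN t : ~ Gdl t -> (\1_Gdl t : R) = 0.
Proof. by move=> ?; rewrite indicE memNset. Qed.

Lemma indGdlY t : Gdl t -> (\1_Gdl t : R) = 1.
Proof. by move=> ?; rewrite indicE mem_set. Qed.

(** [A] and [B] do not depend on [s], so state and control vary by O(s). The closed loop is
    Lipschitz in xi because [gu_inv] is bounded on [Gdl]; it is solved with the increment clipped,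
    and clipping turns out to be inactive. *)
Lemma perturbation_exists : exists A B s0 : R, [/\ 0 <= A, 0 <= B, 0 < s0 &
  forall s, 0 < s <= s0 -> exists xi : R -> 'cV[R]_n,
    [/\ measM xi,
        forall t, 0 <= t <= 1 -> `|xi t| <= s * A /\ `|feedback s t (xi t)| <= s * B,
        forall t, 0 <= t <= 1 -> t < dl -> xi t = 0,
        forall i, inL1 (fun t => perturbed_rhs s t (xi t) i 0) &
        forall t, 0 <= t <= 1 -> forall i,
          xi t i 0 = \int[@Leb R]_(r in `[0, t]) perturbed_rhs s r (xi r) i 0]].
Proof.
have [C C0 HC] := bar_bounds.
have [Q0 HQ] := om_bnd dl_gt0.
pose Q : R := `|Q0|.
have Q_ge0 : 0 <= Q by exact: normr_ge0.
have V0 : 0 <= V by apply: le_trans (v_le (_ : 0 <= 0 <= 1)); rewrite ?lexx ?ler01.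
have qQ t : Gdl t -> `|gu_inv t| <= Q.
  move=> [tG tdl]; rewrite (le_trans (gu_inv_le (Gd_I tG)))//.
  by rewrite (le_trans (HQ t _)) ?ler_norm//; move: tdl; rewrite /= in_itv.
have dfb s t (xi xi' : 'cV[R]_n) : Gdl t ->
    `|feedback s t xi - feedback s t xi'| <= n%:R * C * Q * `|xi - xi'|.
  move=> tG; have [_ bgx] := HC t (Gdl_Gd tG).
  rewrite /feedback -scalerBr indGdlY// scale1r.
  have -> : s *: v t - (gx t *m xi) 0 0 *: gu_inv t -
      (s *: v t - (gx t *m xi') 0 0 *: gu_inv t) =
      - ((gx t *m (xi - xi')) 0 0 *: gu_inv t).
    rewrite mulmxBr; move: (gx t *m xi) (gx t *m xi') (gu_inv t) (v t) => c1 c2 c3 c4.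
    by apply/matrixP => i j; rewrite !mxE; ring.
  rewrite normrN normrZ.
  have h1 := mulmx_coord_le bgx (lexx `|xi - xi'|).
  apply: le_trans (ler_pM (normr_ge0 _) (normr_ge0 _) h1 (qQ _ tG)) _.
  by rewrite mulrAC.
have fb0 s t : 0 <= s -> 0 <= t <= 1 -> `|feedback s t 0| <= s * V.
  move=> s0 tI; have [tG|tG] := pselect (Gdl t); last first.
    by rewrite /feedback indGdlN// scale0r normr0 mulr_ge0.
  rewrite /feedback indGdlY// scale1r mulmx0 (_ : (0 : 'M[R]_1) 0 0 = 0) ?mxE//.
  rewrite scale0r subr0 normrZ ger0_norm//.
  by rewrite ler_wpM2l// v_le.
(* A radius containing xb + y and ub + feedback for all |y| <= 1 and s <= 1; the Lipschitz constant
   of f is taken there. *)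
pose M' : R := `|M| + 1 + V + n%:R * C * Q.
have MM' : M <= M'.
  by rewrite /M' (le_trans (ler_norm M))// -!addrA lerDl !addr_ge0// !mulr_ge0.
have [Cf Cf0 Hf] := f_lipschitz Preg M'.
(* Lipschitz constant of the closed loop; 1 is added for strict positivity. *)
pose l : R := Cf * (1 + n%:R * C * Q) + 1.
have l0 : 0 < l by rewrite ltr_wpDl// mulr_ge0// addr_ge0// !mulr_ge0.
pose A : R := 2 * expR (2 * l) * (Cf * V).
have A0 : 0 <= A by rewrite /A !mulr_ge0// expR_ge0.
pose B : R := V + n%:R * C * Q * A.
have B0 : 0 <= B by rewrite addr_ge0// !mulr_ge0.
(* For s <= 1 / (1 + A) both s <= 1 and s A <= 1 hold, so that the solution stays in the ball where
   [clip] is the identity. *)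
exists A, B, (1 + A)^-1; split => //; first by rewrite invr_gt0 ltr_pwDl.
move=> s /andP[s_gt0 ss0].
have s0 := ltW s_gt0.
have s1 : s <= 1 by rewrite (le_trans ss0)// invf_le1 ?lerDl// ltr_pwDl.
have sA1 : s * A <= 1.
  rewrite (le_trans (ler_wpM2r A0 ss0))// mulrC ler_pdivrMr ?ltr_pwDl// mul1r lerDr.
  exact: ler01.
have bx t (y : 'cV[R]_n) : Gdl t -> `|y| <= 1 -> `|xb t + y| <= M'.
  move=> tG y1; rewrite (le_trans (ler_normD _ _))//.
  have x1 := xb_le (Gd_I (Gdl_Gd tG)); have x2 := ler_norm M.
  have x3 : 0 <= n%:R * C * Q by rewrite !mulr_ge0.
  rewrite /M'; lra.
have bu t (y : 'cV[R]_n) : Gdl t -> `|y| <= 1 -> `|ub t + feedback s t y| <= M'.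
  move=> tG y1; rewrite (le_trans (ler_normD _ _))//.
  have x1 := ub_le (Gdl_Gd tG); have x2 := ler_norm M.
  have x4 : `|feedback s t y| <= V + n%:R * C * Q.
    rewrite -[feedback s t y](subrK (feedback s t 0)) (le_trans (ler_normD _ _))//.
    rewrite addrC lerD//.
      by rewrite (le_trans (fb0 _ _ s0 (Gd_I (Gdl_Gd tG))))// ler_piMl.
    by rewrite (le_trans (dfb _ _ _ _ tG))// subr0 ler_piMr// !mulr_ge0.
  rewrite /M'; lra.
have [||||xi [mxi bxi Ixi Exi]] := @forward_volterra R n
    (fun t xi => perturbed_rhs s t (clip xi)) l (Cf * V * s) l0.
- by rewrite !mulr_ge0.
- move=> xi /measVM mxi; apply/measVM; apply: measM_perturbed_rhs; exact: measM_clip.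
- move=> t tI xi xi'; rewrite /perturbed_rhs -scalerBr.
  have [tG|tG] := pselect (Gdl t); last first.
    by rewrite indGdlN// scale0r normr0 mulr_ge0// ltW.
  rewrite indGdlY// scale1r opprB addrA subrK.
  have c1 := clip_le xi; have c2 := clip_le xi'.
  rewrite (le_trans (Hf _ _ _ _ _ tI (bx _ _ tG c1) (bu _ _ tG c1) (bx _ _ tG c2) (bu _ _ tG c2)))//.
  rewrite !opprD !(addrACA _ _ (- _)) !subrr !add0r.
  have h1 := dfb s t (clip xi) (clip xi') tG.
  have h2 := clip_dist xi xi'.
  have nCQ : 0 <= n%:R * C * Q by rewrite !mulr_ge0.
  have h3 := le_trans h1 (ler_wpM2l nCQ h2).
  apply: le_trans (ler_wpM2l Cf0 (lerD h2 h3)) _.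
  rewrite /l; have := normr_ge0 (xi - xi'); lra.
- move=> t tI; rewrite /perturbed_rhs clip_id ?normr0//.
  have [tG|tG] := pselect (Gdl t); last first.
    by rewrite indGdlN// scale0r normr0 !mulr_ge0.
  have z1 : `|0 : 'cV[R]_n| <= 1 by rewrite normr0.
  have xM := le_trans (xb_le tI) MM'; have uM := le_trans (ub_le (Gdl_Gd tG)) MM'.
  rewrite indGdlY// scale1r (le_trans (Hf _ _ _ _ _ tI (bx _ _ tG z1) (bu _ _ tG z1) xM uM))//.
  rewrite addr0 subrr normr0 add0r addrAC subrr add0r -mulrA ler_wpM2l// mulrC.
  exact: fb0.
have bxi' t : 0 <= t <= 1 -> `|xi t| <= s * A.
  by move=> tI; rewrite (le_trans (bxi _ tI))// /A; lra.
have cxi t : 0 <= t <= 1 -> clip (xi t) = xi t.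
  by move=> tI; rewrite clip_id// (le_trans (bxi' _ tI)).
have Exi' t : 0 <= t <= 1 -> forall i,
    xi t i 0 = \int[@Leb R]_(r in `[0, t]) perturbed_rhs s r (xi r) i 0.
  move=> tI i; rewrite (Exi t tI i); apply: eq_Rintegral => r /mem_itvcc/andP[r0 rt].
  by have /cxi -> : 0 <= r <= 1 by rewrite r0 (le_trans rt)//; case/andP: tI.
exists xi; split.
- exact/measVM.
- move=> t tI; split; first exact: bxi'.
  have [tG|tG] := pselect (Gdl t); last first.
    by rewrite /feedback indGdlN// scale0r normr0 mulr_ge0.
  rewrite -[feedback s t (xi t)](subrK (feedback s t 0)) (le_trans (ler_normD _ _))//.
  rewrite addrC /B mulrDr lerD ?fb0// (le_trans (dfb _ _ _ _ tG))// subr0.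
  have nCQ : 0 <= n%:R * C * Q by rewrite !mulr_ge0.
  by rewrite mulrCA ler_wpM2l// bxi'.
- move=> t tI tdl; apply/colP => i; rewrite mxE Exi'//.
  apply: Leb_Rintegral_eq0 => r /=; rewrite in_itv/= => /andP[r0 rt]; rewrite /perturbed_rhs indGdlN.
    by rewrite scale0r mxE.
  move=> [_ /=]; rewrite in_itv/= => /andP[dr _].
  by have := le_lt_trans rt tdl; rewrite ltNge dr.
- by move=> i; apply: inL1_eq (Ixi i) => t tI; rewrite cxi.
- exact: Exi'.
Qed.

Hypothesis eta_gt0 : 0 < eta.
Hypothesis eta_eps : eta <= eps.
Hypothesis kappa_gt0 : 0 < kappa.
Hypothesis v_neg : forall t, Gdl t -> - eta <= gb t -> (gu t *m v t) 0 0 <= - kappa.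

Lemma Gd_lt_dl t : Gd t -> ~ Gdl t -> t < dl.
Proof.
move=> tG nG; rewrite ltNge; apply/negP => dt; apply: nG; split => //=.
by rewrite in_itv/= dt; have /andP[] := Gd_I tG.
Qed.

(** Where g >= - eta the first order change is s gu v <= - s kappa, and the Taylor remainder, taken
    with slope kappa / (A + B + 1), is at most s kappa. Where g < - eta a Lipschitz bound shows that
    g moves by at most eta. Before [dl] nothing moves. *)
Lemma perturbed_g (A B : R) : 0 <= A -> 0 <= B -> exists2 s1 : R, 0 < s1 &
  forall s t (xi : 'cV[R]_n), 0 < s <= s1 -> Gd t -> `|xi| <= s * A ->
    `|feedback s t xi| <= s * B -> (t < dl -> xi = 0) ->
    P_g P t (xb t + xi) (ub t + feedback s t xi) <= 0.
Proof.
move=> A0 B0; have [_ _ g1] := Preg.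
have S0 : 0 < A + B + 1 by rewrite ltr_wpDl// addr_ge0.
have [d d0 Hd] := C1_taylor M g1 (divr_gt0 kappa_gt0 S0).
have [Cg Cg0 Hg] := C1_lipschitz (M + 1) g1.
have Cg1 : 0 < Cg + 1 by rewrite ltr_wpDl.
(* The three bounds on the size of the increments serve the ball of radius M + 1, the Taylor
   estimate and the slack eta. *)
pose r : R := Num.min 1 (Num.min (d / 2) (eta / (Cg + 1))).
have r0 : 0 < r by rewrite /r !lt_min ltr01 !divr_gt0.
have r1 : r <= 1 by rewrite /r !ge_min lexx.
have rd : r < d.
  by rewrite /r !gt_min; apply/orP; right; rewrite ltr_pdivrMr// ltr_pMr// ltr1n.
have re : r * (Cg + 1) <= eta by rewrite -ler_pdivlMr// /r !ge_min lexx !orbT.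
exists (r / (A + B + 1)); first by rewrite divr_gt0.
move=> s t xi /andP[s0 ss] tG xiA fB xi0.
have [tGl|tGl] := pselect (Gdl t); last first.
  rewrite (xi0 (Gd_lt_dl tG tGl)) /feedback indGdlN// scale0r !addr0.
  exact: gb_le0.
have sS : s * (A + B + 1) <= r by rewrite -ler_pdivlMr.
have sAB : s * A + s * B <= r by rewrite (le_trans _ sS)// !mulrDr mulr1 lerDl ltW.
have sA0 : 0 <= s * A by rewrite mulr_ge0// ltW.
have sB0 : 0 <= s * B by rewrite mulr_ge0// ltW.
have xM := xb_le (Gd_I tG); have uM := ub_le tG.
have [ge|gl] := leP (- eta) (gb t).
  have at_ : act t.
    by split => //=; split; [exact: Gd_I|apply: le_trans ge; rewrite lerN2].
  have := Hd t _ _ xi (feedback s t xi) (Gd_I tG) xM uM.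
  have xid : `|xi| < d by lra.
  have fd : `|feedback s t xi| < d by lra.
  move=> /(_ xid fd); rewrite -/(gb t) -/(gx t) -/(gu t).
  have -> : (gx t *m xi + gu t *m feedback s t xi) 0 0 = s * (gu t *m v t) 0 0.
    rewrite /feedback indGdlY// scale1r; have := gu_inv_act at_.
    move: (gu_inv t) => q; rewrite mulmxBr -!scalemxAr.
    move: (gx t *m xi) (gu t *m v t) (gu t *m q) => c1 c2 c3 c31.
    by rewrite !mxE c31; ring.
  rewrite ler_norml => /andP[_ H].
  have h1 := v_neg tGl ge; have h2 := gb_le0 tG.
  have h3 : s * (gu t *m v t) 0 0 <= - (s * kappa).
    by rewrite -mulrN ler_wpM2l// ltW.
  have h4 : kappa / (A + B + 1) * (`|xi| + `|feedback s t xi|) <= s * kappa.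
    apply: (@le_trans _ _ (kappa / (A + B + 1) * (s * (A + B + 1)))).
      rewrite ler_wpM2l ?divr_ge0 ?(ltW kappa_gt0) ?(ltW S0)//.
      rewrite !mulrDr mulr1; lra.
    by rewrite mulrCA divfK ?gt_eqF.
  lra.
have := Hg t (xb t + xi) (xb t) (ub t + feedback s t xi) (ub t) (Gd_I tG).
have n1 : `|xb t + xi| <= M + 1 by rewrite (le_trans (ler_normD _ _))//; lra.
have n2 : `|ub t + feedback s t xi| <= M + 1 by rewrite (le_trans (ler_normD _ _))//; lra.
move=> /(_ n1 n2); have n3 : `|xb t| <= M + 1 by lra.
have n4 : `|ub t| <= M + 1 by lra.
move=> /(_ n3 n4); rewrite !(addrAC _ _ (- _)) !subrr !add0r -/(gb t) ler_norml => /andP[_ H].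
have h5 : Cg * (`|xi| + `|feedback s t xi|) <= (Cg + 1) * r.
  apply: (@le_trans _ _ (Cg * r)); first by rewrite ler_wpM2l//; lra.
  by rewrite mulrDl lerDl mul1r ltW.
lra.
Qed.

(** Pointwise expansion of the Lagrangian: by [hamiltonian_identity] its first order part is s v .
    h. Two remainders are left, that of L and that of f paired with [lam]; the choice of [e'] makes
    their sum at most e s. *)
Lemma perturbed_cost (A B Cl e : R) : 0 <= A -> 0 <= B -> 0 <= Cl -> 0 < e ->
  exists2 s2 : R, 0 < s2 &
  forall s t (xi lam : 'cV[R]_n), 0 < s <= s2 -> Gd t -> `|xi| <= s * A ->
    `|feedback s t xi| <= s * B -> (t < dl -> xi = 0) -> `|lam| <= Cl ->
    P_L P t (xb t + xi) (ub t + feedback s t xi) - P_L P t (xb t) (ub t)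
    + ((perturbed_rhs s t xi)^T *m lam) 0 0 - ((adjp t lam)^T *m xi) 0 0
    <= s * ((\1_Gdl t : R) * ((v t)^T *m hamu t lam) 0 0) + e * s.
Proof.
move=> A0 B0 Cl0 e0; have [L1 _ _] := Preg.
have S0 : 0 < A + B + 1 by rewrite ltr_wpDl// addr_ge0.
have N0 : 0 < 1 + n%:R * Cl by rewrite ltr_pwDl// mulr_ge0.
pose e' : R := e / ((A + B + 1) * (1 + n%:R * Cl)).
have e'0 : 0 < e' by rewrite divr_gt0// mulr_gt0.
have [d1 d10 HL] := C1_taylor M L1 e'0.
have [d2 d20 Hf] := f_taylor Preg M e'0.
pose d : R := Num.min d1 d2.
have d0 : 0 < d by rewrite lt_min d10.
exists (d / 2 / (A + B + 1)); first by rewrite !divr_gt0.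
move=> s t xi lam /andP[s0 ss] tG xiA fB xi0 lamC.
have [tGl|tGl] := pselect (Gdl t); last first.
  rewrite (xi0 (Gd_lt_dl tG tGl)) /perturbed_rhs /feedback indGdlN// !scale0r !addr0.
  rewrite subrr trmx0 mul0mx mulmx0 mul0r mulr0 add0r subrr add0r.
  by rewrite mulr_ge0// ltW.
have sS : s * (A + B + 1) <= d / 2 by rewrite -ler_pdivlMr.
have dd : d / 2 < d by rewrite ltr_pdivrMr// ltr_pMr// ltr1n.
have sA0 : 0 <= s * A by rewrite mulr_ge0// ltW.
have sB0 : 0 <= s * B by rewrite mulr_ge0// ltW.
have sAB : s * A + s * B + s <= d / 2 by move: sS; rewrite !mulrDr mulr1.
have dd1 : d <= d1 by rewrite /d ge_min lexx.
have dd2 : d <= d2 by rewrite /d ge_min lexx orbT.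
have xM := xb_le (Gd_I tG); have uM := ub_le tG.
have fbE : feedback s t xi = s *: v t - (gx t *m xi) 0 0 *: gu_inv t.
  by rewrite /feedback indGdlY// scale1r.
set w := feedback s t xi in fB fbE *.
have := HL t _ _ xi w (Gd_I tG) xM uM; have := Hf t _ _ xi w (Gd_I tG) xM uM.
have xid1 : `|xi| < d1 by lra.
have xid2 : `|xi| < d2 by lra.
have wd1 : `|w| < d1 by lra.
have wd2 : `|w| < d2 by lra.
move=> /(_ xid2 wd2); rewrite -/(fx t) -/(fu t) => H2.
move=> /(_ xid1 wd1); rewrite -/(Lx t) -/(Lu t) => H1.
rewrite /perturbed_rhs -/w !indGdlY// scale1r mul1r.
set df := _ - P_f P t _ _ in H2 *.
set dL := _ - P_L P t _ _ in H1 *.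
have -> : ((df)^T *m lam) 0 0 = ((df - (fx t *m xi + fu t *m w))^T *m lam) 0 0 +
    ((fx t *m xi + fu t *m w)^T *m lam) 0 0.
  have dfE : df = (df - (fx t *m xi + fu t *m w)) + (fx t *m xi + fu t *m w).
    by rewrite subrK.
  by rewrite [in LHS]dfE [in LHS]linearD/= [in LHS]mulmxDl [LHS]mxE.
have alg : (Lx t *m xi + Lu t *m w) 0 0 + ((fx t *m xi + fu t *m w)^T *m lam) 0 0 -
    ((adjp t lam)^T *m xi) 0 0 = s * ((v t)^T *m hamu t lam) 0 0.
  have -> : adjp t lam = (fx t)^T *m lam + (Lx t)^T + mulz t lam *: (gx t)^T.
    by rewrite /adjp indicE mem_set// scale1r.
  exact: (@hamiltonian_identity R n m (fx t) (fu t) (Lx t) (gx t) (Lu t)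
    (gu_inv t) (v t) w xi lam s fbE).
have rL := ler_norm (dL - (Lx t *m xi + Lu t *m w) 0 0).
have rf := ler_norm (((df - (fx t *m xi + fu t *m w))^T *m lam) 0 0).
have rf2 : `|((df - (fx t *m xi + fu t *m w))^T *m lam) 0 0| <=
    n%:R * (e' * (`|xi| + `|w|)) * Cl.
  by apply: mulmx_coord_le => //; rewrite trmx_norm.
have ee : e' * (`|xi| + `|w|) * (1 + n%:R * Cl) <= e * s.
  apply: (@le_trans _ _ (e' * (s * (A + B + 1)) * (1 + n%:R * Cl))).
    rewrite ler_wpM2r ?(ltW N0)// ler_wpM2l ?(ltW e'0)//.
    rewrite !mulrDr mulr1; lra.
  rewrite /e' le_eqVlt; apply/orP; left; apply/eqP; field.
  by rewrite !gt_eqF.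
have := le_trans rL H1; have := le_trans rf rf2.
move: alg; move: (_ 0 0) (_ 0 0) (_ 0 0) (_ 0 0) (_ 0 0) => k1 k2 k3 k4 k5.
lra.
Qed.

Hypothesis dxb_W11 : W11_deriv xb dxb.
Hypothesis dxb_f : forall t, Gd t -> dxb t = P_f P t (xb t) (ub t).
Hypothesis min_xub : weak_local_minimizer P xb ub.

Lemma perturbed_admissible s (xi : R -> 'cV[R]_n) (K : R) : measM xi ->
  (forall t, 0 <= t <= 1 -> `|feedback s t (xi t)| <= K) ->
  (forall t, 0 <= t <= 1 -> t < dl -> xi t = 0) ->
  (forall i, inL1 (fun t => perturbed_rhs s t (xi t) i 0)) ->
  (forall t, 0 <= t <= 1 -> forall i,
     xi t i 0 = \int[@Leb R]_(r in `[0, t]) perturbed_rhs s r (xi r) i 0) ->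
  (forall t, Gd t -> P_g P t (xb t + xi t) (ub t + feedback s t (xi t)) <= 0) ->
  admissible P (fun t => xb t + xi t) (fun t => ub t + feedback s t (xi t)).
Proof.
move=> mxi fK xi0 Ixi Exi gle.
have [[_ [_ ubL] _ x0] _] := min_xub.
have [dxbL dxbE] := dxb_W11.
have xi00 : xi 0 = 0 by apply: xi0 => //; rewrite lexx ler01.
split.
- exists (fun t => dxb t + perturbed_rhs s t (xi t)).
    have rL i : inL1 (fun t => (dxb t + perturbed_rhs s t (xi t)) i 0).
      apply: inL1_eq (inL1D (dxbL i) (Ixi i)) => t _; by rewrite [RHS]mxE.
    split; first exact: rL.
    move=> t tI i; have /andP[t0 t1] := tI.
    have xsE r : (xb r + xi r) i 0 = xb r i 0 + xi r i 0 by rewrite mxE.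
    rewrite !xsE xi00 [X in _ + X + _]mxE addr0 (dxbE t tI) (Exi t tI) -addrA.
    congr (_ + _).
    rewrite -Rintegral_on_D//; [|exact: lebT_itv|exact: subI0t].
    by apply: eq_Rintegral => r _; rewrite [RHS]mxE.
  apply: ae01_imp aeGd => t tI tG; rewrite dxb_f//.
  have [tGl|tGl] := pselect (Gdl t).
    by rewrite /perturbed_rhs indGdlY// scale1r addrC subrK.
  rewrite /perturbed_rhs /feedback indGdlN// !scale0r !addr0.
  by rewrite (xi0 _ tI (Gd_lt_dl tG tGl)) addr0.
- split; first by apply/measVM; apply: measMD => //; exact: measM_feedback.
  have K0 : 0 <= K by apply: le_trans (fK 0 _); rewrite ?lexx ?ler01.
  have M0 : 0 <= M by apply: le_trans (xb_le (_ : 0 <= 0 <= 1)); rewrite ?lexx ?ler01.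
  apply: (@le_lt_trans _ _ (m%:R * (M + K))%:E); last exact: ltry.
  apply: Linf_norm_le; first exact: addr_ge0.
  apply: ae01_imp aeGd => t tI tG; rewrite (le_trans (ler_normD _ _))// lerD//.
    exact: ub_le.
  exact: fK.
- by apply: ae01_imp aeGd => t _; exact: gle.
- by rewrite xi00 addr0.
Qed.

(** Integrating [perturbed_cost], the terms in [lam] and in [adjp] cancel by integration by parts,
    which leaves the difference of the costs; it is nonnegative by optimality. Division by s, with e
    arbitrary, gives the claim. *)
Lemma variation_ge0 (lam : R -> 'cV[R]_n) (Cl : R) : measM lam ->
  (forall t, 0 <= t <= 1 -> `|lam t| <= Cl) ->
  (forall i, inL1 (fun t => adjp t (lam t) i 0)) ->
  (forall t, 0 <= t <= 1 -> forall i,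
     lam t i 0 = \int[@Leb R]_(r in `[t, 1]) adjp r (lam r) i 0) ->
  0 <= \int[@Leb R]_(t in `[0, 1]) ((\1_Gdl t : R) * ((v t)^T *m hamu t (lam t)) 0 0).
Proof.
move=> mlam lamC pL lamE.
have I01 : 0 <= (0 : R) <= 1 by rewrite lexx ler01.
have Cl0 : 0 <= Cl by apply: le_trans (lamC _ I01).
have V0 : 0 <= V by apply: le_trans (v_le I01).
have [C C0 HC] := bar_bounds.
have [A [B [s0 [A0 B0 s0_gt0 Hpert]]]] := perturbation_exists.
have [s1 s1_gt0 Hg] := perturbed_g A0 B0.
have [L1 _ _] := Preg; have [CL CL0 HL] := C1_bounded (M + 1) L1.
have [adm [em em0 Hmin]] := min_xub.
have mind : meas01 (\1_Gd : R -> R) by exact: meas01_indic.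
pose J t := (\1_Gdl t : R) * ((v t)^T *m hamu t (lam t)) 0 0.
have JL : inL1 J.
  apply: (@inL1_bounded _ _ (m%:R * V * (n%:R * C * Cl + C))).
    apply: measurable_funM; first exact: meas01_indic measurable_Gdl.
    exact: (measM_mul (measM_tr mv) (measM_hamu mlam)).
  move=> t tI; rewrite /J; have [tG|tG] := pselect (Gdl t); last first.
    by rewrite indGdlN// mul0r normr0 !(mulr_ge0, addr_ge0).
  rewrite indGdlY// mul1r; have [[_ bfu _ bLu] _] := HC t (Gdl_Gd tG).
  apply: mulmx_coord_le; first by rewrite trmx_norm v_le.
  rewrite /hamu (le_trans (ler_normD _ _))// trmx_norm lerD//.
  rewrite (le_trans (mulmx_norm_le _ _))// trmx_norm -!mulrA ler_wpM2l//.
  by apply: ler_pM => //; exact: lamC.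
apply/ler_addgt0Pr => e e0.
have [s2 s2_gt0 Hc] := perturbed_cost A0 B0 Cl0 e0.
have S0 : 0 < (n%:R + m%:R) * (A + B) + A + B + 1.
  by rewrite ltr_wpDl// !addr_ge0// mulr_ge0// addr_ge0.
(* Keeps both increments at most 1 and, the dimensions accounting for the passage to Euclidean
   norms, closer than [em] to the minimizer. *)
pose s3 : R := Num.min 1 (em / 2) / ((n%:R + m%:R) * (A + B) + A + B + 1).
have s3_gt0 : 0 < s3 by rewrite divr_gt0// lt_min ltr01 divr_gt0.
pose s := Num.min (Num.min s0 s1) (Num.min s2 s3).
have s_gt0 : 0 < s by rewrite /s !lt_min s0_gt0 s1_gt0 s2_gt0 s3_gt0.
have ss0 : s <= s0 by rewrite /s !ge_min lexx.
have ss1 : s <= s1 by rewrite /s !ge_min lexx !orbT.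
have ss2 : s <= s2 by rewrite /s !ge_min lexx !orbT.
have ss3 : s <= s3 by rewrite /s !ge_min lexx !orbT.
have sS : s * ((n%:R + m%:R) * (A + B) + A + B + 1) <= Num.min 1 (em / 2).
  by rewrite -ler_pdivlMr.
have [sS1 sSe] : s * ((n%:R + m%:R) * (A + B) + A + B + 1) <= 1 /\
    s * ((n%:R + m%:R) * (A + B) + A + B + 1) <= em / 2.
  by move: sS; rewrite le_min => /andP[].
have [xi [mxi bxi xi0 Ixi Exi]] : exists xi : R -> 'cV[R]_n,
    [/\ measM xi,
        forall t, 0 <= t <= 1 -> `|xi t| <= s * A /\ `|feedback s t (xi t)| <= s * B,
        forall t, 0 <= t <= 1 -> t < dl -> xi t = 0,
        forall i, inL1 (fun t => perturbed_rhs s t (xi t) i 0) &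
        forall t, 0 <= t <= 1 -> forall i,
          xi t i 0 = \int[@Leb R]_(r in `[0, t]) perturbed_rhs s r (xi r) i 0].
  by apply: Hpert; rewrite s_gt0.
pose xs t := xb t + xi t; pose us t := ub t + feedback s t (xi t).
have adms : admissible P xs us.
  apply: (@perturbed_admissible s xi (s * B)) => //; first by move=> t /bxi[].
  move=> t tG; have [b1 b2] := bxi t (Gd_I tG).
  by apply: Hg => //; [rewrite s_gt0|exact: (xi0 _ (Gd_I tG))].
have [hnA hmB hA hB] := weighted_sum_bounds (ler0n R n) (ler0n R m) A0 B0.
have s_ge0 := ltW s_gt0.
have em2 : em / 2 < em by rewrite ltr_pdivrMr// ltr_pMr// ltr1n.
have nsA : n%:R * (s * A) < em.
  by rewrite mulrCA (le_lt_trans (ler_wpM2l s_ge0 hnA))// (le_lt_trans sSe).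
have msB : m%:R * (s * B) < em.
  by rewrite mulrCA (le_lt_trans (ler_wpM2l s_ge0 hmB))// (le_lt_trans sSe).
have sA1 : s * A <= 1 := le_trans (ler_wpM2l s_ge0 hA) sS1.
have sB1 : s * B <= 1 := le_trans (ler_wpM2l s_ge0 hB) sS1.
have costle : cost P xb ub <= cost P xs us.
  apply: Hmin => //.
    apply: (@le_lt_trans _ _ (n%:R * (s * A))%:E); last by rewrite lte_fin.
    by apply: C_norm_le => t tI; rewrite /xs addrAC subrr add0r; have [] := bxi t tI.
  apply: (@le_lt_trans _ _ (m%:R * (s * B))%:E); last by rewrite lte_fin.
  apply: Linf_norm_le; first exact: mulr_ge0.
  apply: ae01_imp aeGd => t tI _; rewrite /us addrAC subrr add0r.
  by have [] := bxi t tI.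
have mxs : measM xs by exact: measMD.
have mus : measM us by apply: measMD => //; exact: measM_feedback.
have [cL _ _ _] := L1.
have mLs : meas01 (fun t => P_L P t (xs t) (us t)) := meas01_comp cL mxs mus.
have mLb : meas01 (fun t => P_L P t (xb t) (ub t)) := meas01_comp cL mxb mub.
(* Multiplication by the indicator of [Gd] does not change the costs but makes the integrands
   bounded at every point. *)
have ind1 (h : R -> R) : meas01 h ->
    \int[@Leb R]_(t in `[0, 1]) h t = \int[@Leb R]_(t in `[0, 1]) ((\1_Gd t : R) * h t).
  move=> mh; apply: Rintegral_ae_eq => //; first exact: lebT_itv.
    exact: (measurable_funM mind mh).
  by apply: ae01_imp aeGd => t _ tG; rewrite indicE mem_set// mul1r.
have indL (x : R -> 'cV[R]_n) (u : R -> 'cV[R]_m) : meas01 (fun t => P_L P t (x t) (u t)) ->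
    (forall t, Gd t -> `|x t| <= M + 1 /\ `|u t| <= M + 1) ->
    inL1 (fun t => (\1_Gd t : R) * P_L P t (x t) (u t)).
  move=> mL xuM; apply: (@inL1_bounded _ _ CL); first exact: (measurable_funM mind mL).
  move=> t tI; rewrite indicE; have [tG|tG] := pselect (Gd t); last first.
    by rewrite memNset// mul0r normr0.
  by rewrite mem_set// mul1r; have [h1 h2] := xuM _ tG; have [] := HL t _ _ tI h1 h2.
have Ls : inL1 (fun t => (\1_Gd t : R) * P_L P t (xs t) (us t)).
  apply: indL => // t tG; have [b1 b2] := bxi t (Gd_I tG).
  split; apply: (le_trans (ler_normD _ _)); apply: lerD.
  - exact: xb_le (Gd_I tG).
  - exact: le_trans b1 sA1.
  - exact: ub_le.
  - exact: le_trans b2 sB1.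
have Lb : inL1 (fun t => (\1_Gd t : R) * P_L P t (xb t) (ub t)).
  apply: indL => // t tG; have h1 := xb_le (Gd_I tG); have h2 := ub_le tG.
  by split; [apply: (le_trans h1)|apply: (le_trans h2)]; rewrite lerDl.
have rl i : inL1 (fun t => perturbed_rhs s t (xi t) i 0 * lam t i 0).
  apply: (inL1M (M := Cl) (Ixi i) (mlam i 0)) => t tI.
  by rewrite (le_trans (mx_coord_le_norm _ _ _))// lamC.
have px i : inL1 (fun t => adjp t (lam t) i 0 * xi t i 0).
  apply: (inL1M (M := s * A) (pL i) (mxi i 0)) => t tI.
  by rewrite (le_trans (mx_coord_le_norm _ _ _))//; have [] := bxi t tI.
(* Integration by parts for xi and lam, which vanish at 0 and at 1 respectively. *)
have fub i : \int[@Leb R]_(t in `[0, 1]) (perturbed_rhs s t (xi t) i 0 * lam t i 0) =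
    \int[@Leb R]_(t in `[0, 1]) (adjp t (lam t) i 0 * xi t i 0).
  have := Leb_Fubini_triangle (pL i) (Ixi i) => E.
  transitivity (\int[@Leb R]_(t in `[0, 1]) (perturbed_rhs s t (xi t) i 0 *
      \int[@Leb R]_(r in `[t, 1]) adjp r (lam r) i 0)).
    by apply: eq_Rintegral => t /mem_itvcc tI; rewrite (lamE t tI i).
  by rewrite E; apply: eq_Rintegral => t /mem_itvcc tI; rewrite (Exi t tI i).
pose D1 t := (\1_Gd t : R) * P_L P t (xs t) (us t) - (\1_Gd t : R) * P_L P t (xb t) (ub t).
pose D2 t := \sum_i perturbed_rhs s t (xi t) i 0 * lam t i 0.
pose D3 t := \sum_i adjp t (lam t) i 0 * xi t i 0.
have D1L : inL1 D1 by exact: inL1B.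
have D2L : inL1 D2 by exact: inL1_sum.
have D3L : inL1 D3 by exact: inL1_sum.
have mI := @lebT_itv R `[0, 1].
have E123 : 0 <= \int[@Leb R]_(t in `[0, 1]) (D1 t + D2 t - D3 t).
  rewrite Rintegral_on_B//; last exact: inL1D.
  rewrite Rintegral_on_D// [X in _ + X - _]Rintegral01_sum// [X in _ - X]Rintegral01_sum//.
  under eq_bigr do rewrite fub.
  rewrite addrK Rintegral_on_B// -!ind1// subr_ge0.
  exact: costle.
have eL : inL1 (fun t => s * J t + e * s) by apply: inL1D; [exact: inL1Z|exact: inL1_cst].
have : \int[@Leb R]_(t in `[0, 1]) (D1 t + D2 t - D3 t) <=
       \int[@Leb R]_(t in `[0, 1]) (s * J t + e * s).
  apply: Rintegral_le_on => //; first by apply: inL1B => //; exact: inL1D.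
  move=> t tI; have [b1 b2] := bxi t tI; rewrite /D1 /D2 /D3.
  have -> : \sum_i perturbed_rhs s t (xi t) i 0 * lam t i 0 =
     ((perturbed_rhs s t (xi t))^T *m lam t) 0 0.
    by rewrite mxE; apply: eq_bigr => i _; rewrite [in RHS]mxE.
  have -> : \sum_i adjp t (lam t) i 0 * xi t i 0 = ((adjp t (lam t))^T *m xi t) 0 0.
    by rewrite mxE; apply: eq_bigr => i _; rewrite [in RHS]mxE.
  have [tG|tG] := pselect (Gd t); last first.
    have tGl : ~ Gdl t by move=> /Gdl_Gd.
    rewrite /J /perturbed_rhs /adjp indGdlN// indicE memNset// !mul0r !scale0r.
    rewrite trmx0 !mul0mx !mxE !subrr add0r mulr0 add0r oppr0 add0r.
    by rewrite mulr_ge0// ltW.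
  rewrite [\1_Gd t]indicE mem_set// !mul1r /J.
  apply: Hc => //; [by rewrite s_gt0|exact: xi0|exact: lamC].
move=> /(le_trans E123).
rewrite Rintegral_on_D//; [|exact: inL1Z|exact: inL1_cst].
rewrite Rintegral_on_Z// (@Rintegral_cst _ (lebT R))//.
rewrite -[X in fine X]/(Leb _) Leb_itvcc//= subr0 mulr1 [e * s]mulrC -mulrDr.
by rewrite pmulr_rge0.
Qed.

End Variation.

(** * Sign, complementarity and stationarity of the multiplier *)

Section Stationarity.
Hypothesis eps_gt0 : 0 < eps.
Hypothesis dxb_W11 : W11_deriv xb dxb.
Hypothesis dxb_f : forall t, Gd t -> dxb t = P_f P t (xb t) (ub t).
Hypothesis min_xub : weak_local_minimizer P xb ub.
Variables (lam : R -> 'cV[R]_n) (Cl : R).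
Hypothesis mlam : measM lam.
Hypothesis lam_le : forall t, 0 <= t <= 1 -> `|lam t| <= Cl.
Hypothesis adjL1 : forall i, inL1 (fun t => adjp t (lam t) i 0).
Hypothesis lamE : forall t, 0 <= t <= 1 -> forall i,
  lam t i 0 = \int[@Leb R]_(r in `[t, 1]) adjp r (lam r) i 0.

Local Notation ham t := (hamu t (lam t)).
Local Notation zz t := (mulz t (lam t)).

(** Equivalently, - zz gu^T is the orthogonal projection of [ham] onto the line spanned by gu^T. *)
Lemma mulz_act t : act t -> (gu t *m ham t) 0 0 = - (zz t * nrm2 t).
Proof.
move=> at_; have n0 : nrm2 t != 0.
  by rewrite nrm2E gt_eqF// exprn_gt0// act_eucl_gt0.
rewrite /mulz /gu_inv indicE mem_set// mul1r; move: n0 (ham t) => n0 y.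
have -> : ((nrm2 t)^-1 *: (gu t)^T)^T *m y = (nrm2 t)^-1 *: (gu t *m y).
  by rewrite linearZ/= trmxK scalemxAl.
by move: (gu t *m y) => c; rewrite mxE mulNr opprK mulrAC mulVf// mul1r.
Qed.

Lemma mulz_nact t : ~ act t -> zz t = 0.
Proof. by move=> /gu_inv_nact q0; rewrite /mulz q0 trmx0 mul0mx mxE oppr0. Qed.

(** Cauchy-Schwarz, read off 0 <= |ham + zz gu^T|^2. *)
Lemma mulz_sq_le t : act t -> zz t ^+ 2 * nrm2 t <= sqn (ham t).
Proof.
move=> at_; have := sqn_ge0 (ham t + zz t *: (gu t)^T).
rewrite sqn_addZ trmxK mulz_act//.
have -> : sqn (gu t)^T = nrm2 t by rewrite /sqn trmxK.
by move: (zz t) (nrm2 t) (sqn _) => a b c; lra.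
Qed.

(** The difference [phi] of the two sides is nonnegative: it is the squared length of the projection
    of - ham onto the half-space gu w <= 0 where g >= - eta, and |ham|^2 elsewhere. Testing
    optimality with this projection bounds int phi by kappa int psi for every kappa > 0, so phi
    vanishes almost everywhere. *)
Lemma stationarity_on (dl eta : R) : 0 < dl -> 0 < eta -> eta <= eps ->
  ae01 (fun t => Gdl dl t ->
    sqn (ham t) = if - eta <= gb t then Num.max 0 (zz t) ^+ 2 * nrm2 t else 0).
Proof.
move=> dl0 eta0 etae.
have [C C0 HC] := bar_bounds.
have [Cu Cu0 HCu] := gu_bounded.
have [Q0 HQ] := om_bnd dl0.
pose Q : R := `|Q0|.
have Q_ge0 : 0 <= Q by exact: normr_ge0.
have I01 : 0 <= (0 : R) <= 1 by rewrite lexx ler01.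
have Cl0 : 0 <= Cl by apply: le_trans (lam_le I01).
have omQ t : Gdl dl t -> om t <= Q.
  by move=> [tG tdl]; rewrite (le_trans (HQ t _)) ?ler_norm.
have qQ t : Gdl dl t -> `|gu_inv t| <= Q.
  by move=> tG; rewrite (le_trans (gu_inv_le (Gd_I (Gdl_Gd tG))))// omQ.
pose K : R := n%:R * C * Cl + C.
have K0 : 0 <= K by rewrite addr_ge0// !mulr_ge0.
have hamK t : Gdl dl t -> `|ham t| <= K.
  move=> tG; have [[_ bfu _ bLu] _] := HC t (Gdl_Gd tG).
  rewrite /hamu (le_trans (ler_normD _ _))// trmx_norm lerD//.
  rewrite (le_trans (mulmx_norm_le _ _))// trmx_norm -!mulrA ler_wpM2l//.
  by apply: ler_pM => //; exact: lam_le (Gd_I (Gdl_Gd tG)).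
have zK t : Gdl dl t -> `|zz t| <= m%:R * Q * K.
  move=> tG; rewrite /mulz normrN; apply: mulmx_coord_le; last exact: hamK.
  by rewrite trmx_norm qQ.
pose S1 : set (lebT R) := Gdl dl `&` [set t | 0 <= t <= 1 /\ - eta <= gb t].
have mS1 : measurable S1.
  by apply: measurableI; [exact: measurable_Gdl|exact: measurable_level meas01_gb].
have S1act t : S1 t -> act t.
  move=> [[tG _] [tI ge]]; split => //=; split => //.
  by apply: le_trans ge; rewrite lerN2.
pose zp t := Num.max 0 (zz t).
have mz : meas01 (fun t => zz t) := meas01_mulz mlam.
have mzp : meas01 zp by exact: (measurable_maxr (measurable_cst _) mz).
have mham : measM (fun t => ham t) := measM_hamu mlam.
have m1 : meas01 (\1_(Gdl dl) : R -> R) := meas01_indic (measurable_Gdl dl).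
have mi1 : meas01 (\1_S1 : R -> R) := meas01_indic mS1.
have zp_abs t : 0 <= zp t <= `|zz t|.
  by rewrite /zp le_max lexx ge_max normr_ge0 ler_norm.
have zpz t : zp t * zz t = zp t ^+ 2.
  by rewrite /zp; case: leP => h; rewrite ?mul0r ?expr0n// expr2.
have mnrm : meas01 nrm2 := measM_mul measM_gu (measM_tr measM_gu) 0 0.
pose phi t := (\1_(Gdl dl) t : R) * (sqn (ham t) - \1_S1 t * (zp t ^+ 2 * nrm2 t)).
pose psi t := (\1_S1 t : R) * zz t.
have mphi : meas01 phi.
  apply: (measurable_funM m1); apply: measurable_funB.
    exact: (measM_mul (measM_tr mham) mham).
  apply: (measurable_funM mi1); apply: (measurable_funM _ mnrm).
  by apply: (meas01_eq (h := fun t => zp t * zp t)) (measurable_funM mzp mzp) => t _; rewrite expr2.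
have phi0 t : 0 <= phi t.
  rewrite /phi; have [tG|tG] := pselect (Gdl dl t); last by rewrite indGdlN// mul0r.
  rewrite indGdlY// mul1r indicE; have [tS|tS] := pselect (S1 t); last first.
    by rewrite memNset// mul0r subr0 sqn_ge0.
  rewrite mem_set// mul1r subr_ge0; apply: le_trans (mulz_sq_le (S1act _ tS)).
  rewrite ler_wpM2r//; first by rewrite nrm2E sqr_ge0.
  have /andP[h1 h2] := zp_abs t.
  by rewrite -[leRHS]real_normK ?num_real// lerXn2r ?nnegrE.
have psiL : inL1 psi.
  apply: (@inL1_bounded _ _ (m%:R * Q * K)); first exact: (measurable_funM mi1 mz).
  move=> t tI; rewrite /psi indicE; have [tS|tS] := pselect (S1 t); last first.
    by rewrite memNset// mul0r normr0 !mulr_ge0.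
  by rewrite mem_set// mul1r; apply: zK; case: tS.
have phiL : inL1 phi.
  apply: (@inL1_bounded _ _ (m%:R * K * K)) => // t tI.
  rewrite ger0_norm// /phi; have [tG|tG] := pselect (Gdl dl t); last first.
    by rewrite indGdlN// mul0r !mulr_ge0.
  rewrite indGdlY// mul1r; apply: (@le_trans _ _ (sqn (ham t))).
    by rewrite gerBl// mulr_ge0// mulr_ge0 ?sqr_ge0// nrm2E sqr_ge0.
  apply: (le_trans (ler_norm _)); apply: mulmx_coord_le; last exact: hamK.
  by rewrite trmx_norm hamK.
have key kappa : 0 < kappa -> \int[@Leb R]_(t in `[0, 1]) phi t <=
    kappa * \int[@Leb R]_(t in `[0, 1]) psi t.
  move=> kappa0.
  (* Off [S1] the constraint has slack eta and the direction of steepest descent - ham is allowed.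
     On [S1] its outward part is removed, [zp] being the positive part of zz, and the last term
     makes gu v <= - kappa. *)
  pose v t := - ((\1_(Gdl dl) t : R) *: ham t) - (\1_S1 t * zp t) *: (gu t)^T
              - (kappa * \1_S1 t) *: gu_inv t.
  have mv : measM v.
    apply: measMB; last first.
      apply: measMZ measM_gu_inv; exact: (measurable_funM (measurable_cst _) mi1).
    apply: measMB; first exact: measMN (measMZ m1 mham).
    by apply: measMZ (measM_tr measM_gu); exact: (measurable_funM mi1 mzp).
  pose V : R := K + m%:R * Q * K * Cu + kappa * Q.
  have x1 : 0 <= m%:R * Q * K by rewrite !mulr_ge0.
  have V0 : 0 <= V by rewrite !(addr_ge0, mulr_ge0)// ltW.
  have v_le t : 0 <= t <= 1 -> `|v t| <= V.
    move=> tI; rewrite /v; have [tG|tG] := pselect (Gdl dl t); last first.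
      have tS : ~ S1 t by case.
      by rewrite indGdlN// indicE memNset// !(mulr0, mul0r) !scale0r !subr0 oppr0 normr0.
    have /andP[s10 s11] : 0 <= (\1_S1 t : R) <= 1.
      by rewrite indicE; case: (_ \in _); rewrite ?lexx ler01.
    have /andP[z0 z1] := zp_abs t.
    rewrite indGdlY// scale1r (le_trans (ler_normB _ _))// lerD//; last first.
      have k1 : 0 <= kappa * \1_S1 t by apply: mulr_ge0 => //; exact: ltW.
      rewrite normrZ ger0_norm//; apply: ler_pM => //; last exact: qQ.
      by rewrite ler_piMr// ltW.
    rewrite (le_trans (ler_normB _ _))// normrN lerD//; first exact: hamK.
    have [tS|tS] := pselect (S1 t); last first.
      by rewrite indicE memNset// mul0r scale0r normr0 mulr_ge0.
    rewrite normrZ trmx_norm; apply: ler_pM => //; last exact: HCu (Gdl_Gd tG).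
    rewrite ger0_norm ?mulr_ge0//; apply: le_trans (zK t tG); apply: le_trans z1.
    by rewrite ler_piMl.
  have v_neg t : Gdl dl t -> - eta <= gb t -> (gu t *m v t) 0 0 <= - kappa.
    move=> tG ge; have tS : S1 t by split => //=; split => //; exact: Gd_I (Gdl_Gd tG).
    rewrite /v indGdlY// scale1r [\1_S1 t]indicE mem_set// mul1r mulr1.
    have := gu_inv_act (S1act _ tS); have := mulz_act (S1act _ tS).
    have : (gu t *m (gu t)^T) 0 0 = nrm2 t by [].
    have -> : forall (y q : 'cV[R]_m) (r : 'cV[R]_m) (a : R),
        (gu t *m (- y - a *: r - kappa *: q)) 0 0 =
        - (gu t *m y) 0 0 - a * (gu t *m r) 0 0 - kappa * (gu t *m q) 0 0.
      move=> y q r a; move: (gu t) => c.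
      rewrite mulmxBr mulmxBr mulmxN -!scalemxAr.
      by move: (c *m y) (c *m r) (c *m q) => c1 c2 c3; rewrite !mxE.
    have n0 : 0 <= nrm2 t by rewrite nrm2E sqr_ge0.
    have zn : zz t * nrm2 t <= zp t * nrm2 t.
      by rewrite ler_wpM2r// /zp le_max lexx orbT.
    move=> -> -> ->; move: (zz t) (zp t) (nrm2 t) zn => a b c; lra.
  have := @variation_ge0 dl eta kappa V v dl0 mv v_le eta0 etae kappa0 v_neg
     dxb_W11 dxb_f min_xub lam Cl mlam lam_le adjL1 lamE.
  have -> : \int[@Leb R]_(t in `[0, 1]) ((\1_(Gdl dl) t : R) * ((v t)^T *m ham t) 0 0) =
     \int[@Leb R]_(t in `[0, 1]) (kappa * psi t - phi t).
    apply: eq_Rintegral => t _; rewrite /phi /psi.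
    have [tG|tG] := pselect (Gdl dl t); last first.
      have tS : ~ S1 t by case.
      by rewrite indGdlN// [\1_S1 t]indicE memNset// !(mulr0, mul0r) subr0.
    rewrite /v indGdlY// scale1r !mul1r.
    have -> : ((- ham t - (\1_S1 t * zp t) *: (gu t)^T
                - (kappa * \1_S1 t) *: gu_inv t)^T *m ham t) 0 0
      = - sqn (ham t) - \1_S1 t * zp t * (gu t *m ham t) 0 0
        - kappa * \1_S1 t * ((gu_inv t)^T *m ham t) 0 0.
      rewrite /sqn; move: (ham t) (gu_inv t) (gu t) (\1_S1 t * zp t) (kappa * \1_S1 t) => y q g a b.
      rewrite !mxE !mulr_sumr -!sumrN -!big_split/=; apply: eq_bigr => k _.
      by rewrite !mxE; ring.
    have [tS|tS] := pselect (S1 t); last first.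
      by rewrite [\1_S1 t]indicE memNset// !(mulr0, mul0r, subr0) sub0r.
    rewrite [\1_S1 t]indicE mem_set// !(mulr1, mul1r) mulz_act; last exact: S1act.
    (* Since zp zz = zp^2, the cross term merges into [phi]; the pairing of [gu_inv] with [ham] is -
       zz and produces [psi]. *)
    have -> : zz t = - ((gu_inv t)^T *m ham t) 0 0 by [].
    have := zpz t; rewrite -/(zz t) /mulz; move: (((gu_inv t)^T *m ham t) 0 0) => c.
    by move: (zp t) (nrm2 t) (sqn _) => a b d E; rewrite -E; ring.
  rewrite Rintegral_on_B//; [|exact: lebT_itv|exact: inL1Z].
  by rewrite Rintegral_on_Z ?subr_ge0//; exact: lebT_itv.
have phi_int : \int[@Leb R]_(t in `[0, 1]) phi t = 0.
  apply/eqP; rewrite eq_le; apply/andP; split; last by apply: Rintegral_ge0.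
  apply/ler_addgt0Pr => e e0; rewrite add0r.
  set I1 := \int[@Leb R]_(t in `[0, 1]) psi t in key.
  have N0 : 0 < `|I1| + 1 by rewrite ltr_wpDl.
  apply: le_trans (key (e / (`|I1| + 1)) _) _; first by rewrite divr_gt0.
  apply: (@le_trans _ _ (e / (`|I1| + 1) * (`|I1| + 1))); last by rewrite divfK// gt_eqF.
  by rewrite ler_wpM2l ?divr_ge0 ?(ltW e0) ?(ltW N0)// (le_trans (ler_norm _))// lerDl.
have : (\int[@Leb R]_(t in (`[0%R, 1%R]%classic : set (lebT R))) `|(phi t)%:E|)%E = 0%E.
  under eq_integral do rewrite gee0_abs ?lee_fin//.
  rewrite -(fineK (integrable_fin_num (lebT_itv `[0, 1]) phiL)).
  by rewrite -[fine _]/(\int[@Leb R]_(t in `[0, 1]) phi t) phi_int.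
move=> /(ae_eq_integral_abs _ (lebT_itv `[0, 1]) (measurable_int _ phiL)).
apply: Leb_aeS => t H tI tG; have := H; rewrite /= in_itv/= tI => /(_ isT) [].
rewrite /phi indGdlY// mul1r => /eqP; rewrite subr_eq0 => /eqP ->.
rewrite indicE; case: ifPn => ge.
  by rewrite mem_set ?mul1r//; split => //=; split.
by rewrite memNset ?mul0r// => -[_ [_]]; exact/negP.
Qed.

(** [stationarity_on] holds for countably many pairs of parameters off a single null set; at a given
    t the pair is chosen according to whether g vanishes there or is negative. *)
Lemma stationarity : ae01 (fun t =>
  [/\ 0 <= zz t, zz t * gb t = 0 & ham t + zz t *: (gu t)^T = 0]).
Proof.
pose dk k : R := k.+1%:R^-1.
have dk_gt0 k : 0 < dk k by rewrite invr_gt0.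
have small (a : R) : 0 < a -> exists k, dk k < a.
  by move=> /ltr_add_invr[k]; rewrite add0r; exists k.
pose et k := Num.min eps (dk k).
have et_gt0 k : 0 < et k by rewrite lt_min eps_gt0 dk_gt0.
have et_le k : et k <= eps by rewrite ge_min lexx.
have H := ae01_foralln (fun k => stationarity_on (dk_gt0 k) (et_gt0 k) (et_le k)).
apply: ae01_imp (ae01_and aeGd H) => t tI [tG {}H].
have /andP[t0 t1] := Gd01 tG.
have Gdk k : dk k < t -> Gdl (dk k) t.
  by move=> kt; split => //=; rewrite in_itv/= ltW.
have := gb_le0 tG; rewrite le_eqVlt => /orP[/eqP g0|gneg].
  have [k kt] := small _ t0; have := H k (Gdk k kt).
  rewrite g0 oppr_le0 ltW// => sqE.
  have at_ : act t by split => //; split => //; rewrite g0 oppr_le0 ltW.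
  (* By [mulz_act] this square equals |ham|^2 minus the square of the positive part times |gu|^2,
     hence 0. Pairing with gu then shows that zz equals its positive part. *)
  have : sqn (ham t + Num.max 0 (zz t) *: (gu t)^T) = 0.
    rewrite sqn_addZ trmxK mulz_act// sqE.
    have -> : sqn (gu t)^T = nrm2 t by rewrite /sqn trmxK.
    have : Num.max 0 (zz t) * zz t = Num.max 0 (zz t) ^+ 2.
      by case: leP => h; rewrite ?mul0r ?expr0n// expr2.
    by move: (Num.max 0 (zz t)) (zz t) (nrm2 t) => a b c E; ring: E.
  move=> /sqn_eq0 hE.
  have : (gu t *m (ham t + Num.max 0 (zz t) *: (gu t)^T)) 0 0 = 0.
    by rewrite hE mulmx0 mxE.
  rewrite mulmxDr -scalemxAr.
  have := mulz_act at_; have : (gu t *m (gu t)^T) 0 0 = nrm2 t by [].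
  move: hE; move: (gu t *m ham t) (gu t *m (gu t)^T) => c1 c2 hE E1 E2.
  rewrite mxE [X in _ + X]mxE E1 E2 => E3.
  have n0 : nrm2 t != 0 by rewrite nrm2E gt_eqF// exprn_gt0// act_eucl_gt0.
  have zE : Num.max 0 (zz t) = zz t.
    apply: (mulIf n0); move: E3; move: (Num.max 0 (zz t)) (zz t) (nrm2 t) => a b c; lra.
  by split; [rewrite -zE le_max lexx|rewrite mulr0|rewrite -zE].
(* For this k both t > dk and g < - et, so [ham] vanishes, and [zz] with it. *)
have [|k] := small (Num.min t (- gb t)); first by rewrite lt_min t0 oppr_gt0.
rewrite lt_min => /andP[kt kg]; have := H k (Gdk k kt).
rewrite leNgt; have -> : gb t < - et k.
  by rewrite ltrNr; apply: le_lt_trans kg; rewrite ge_min lexx orbT.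
move=> /sqn_eq0 h0; have z0 : zz t = 0 by rewrite /mulz h0 mulmx0 mxE oppr0.
by rewrite z0 lexx mul0r scale0r addr0 h0.
Qed.

(** [ham] is bounded on [Gd], so zz is at most a multiple of [om]. *)
Lemma inL1_mulz : inL1 (fun t => zz t).
Proof.
have [C C0 HC] := bar_bounds.
pose K : R := n%:R * C * `|Cl| + C.
apply: (@inL1_le _ (fun t => m%:R * K * om t)); [exact: meas01_mulz|exact: inL1Z|].
move=> t tI; have [tG|tG] := pselect (Gd t); last first.
  rewrite mulz_nact; last by case.
  by rewrite normr0 !mulr_ge0 ?addr_ge0 ?mulr_ge0 ?om_ge0.
have [[_ bfu _ bLu] _] := HC t tG.
have hK : `|ham t| <= K.
  rewrite /hamu (le_trans (ler_normD _ _))// trmx_norm lerD//.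
  rewrite (le_trans (mulmx_norm_le _ _))// trmx_norm -!mulrA ler_wpM2l//.
  by apply: ler_pM => //; rewrite (le_trans (lam_le tI))// ler_norm.
have := mulmx_coord_le (A := (gu_inv t)^T) (C := om t) _ hK.
rewrite trmx_norm => /(_ (gu_inv_le tI)).
by rewrite /mulz normrN -!mulrA [K * _]mulrC.
Qed.

(** The charge and beta are zero, which turns the adjoint equation into the statement that d(lam)
    has density - adjp. As [lam] is absolutely continuous, its Stieltjes measure has no mass at the
    end points. *)
Lemma normal_multiplier :
  multiplier P xb ub lam (fun=> 0) 1 (fun t => zz t) (@czero _ (lebT R) R).
Proof.
have [C C0 HC] := bar_bounds.
have [Cg Cg0 HCg] := gu_bounded.
have I11 : 0 <= (1 : R) <= 1 by rewrite ler01 lexx.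
have I01 : 0 <= (0 : R) <= 1 by rewrite ler01 lexx.
have gx_int (E : set (lebT R)) i : measurable E ->
    is_charge_int (@czero _ (lebT R) R) E (fun t => gx t 0 i) 0.
  move=> mE; apply: (is_charge_int_czero (C := C)) => //; first exact: measM_gx.
  apply: ae01_imp aeGd => t _ tG; have [_ bgx] := HC t tG.
  exact: le_trans (mx_coord_le_norm _ _ _) bgx.
constructor.
- exact: ler01.
- exact: inL1_mulz.
- by apply: ae01_imp stationarity => t _ [].
- by split=> [//|]; exists 0 => A mA; rewrite /czero abse0.
- by [].
- move=> mu mu0 A mA; apply/eqP; rewrite eq_le measure_ge0 andbT; exact: mu0.
- exact: inBV_cumul1 adjL1 lamE.
- move=> i; split; last by move=> t _; exact: cvg_cst.
  apply: (@bounded_variation_cumul1 _ _ (fun=> 0)); first exact: inL1_cst.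
  by move=> t tI; rewrite mxE Leb_Rintegral_eq0.
- rewrite /czero/= addr0 ltr_pwDl// Rintegral_ge0//.
- by apply: ae01_imp stationarity => t _ [].
- by [].
- split=> //; apply/colP => i; rewrite lamE// mxE set_itv1; exact: Leb_Rintegral_set1.
- move=> i; have pL := adjL1 i; have [nu nuE] := borel_density_charge (inL1N pL).
  have nuN B : measurable (B : set (measurableTypeR R)) -> B `<=` `[0, 1]%classic ->
      nu B = (- \int[@Leb R]_(t in B) adjp t (lam t) i 0)%:E.
    move=> mB BI; have mB' := lebT_measurable_borel mB.
    rewrite nuE// -(fineK (integrable_fin_num mB' (inL1S (inL1N pL) mB' BI))); congr EFin.
    rewrite -[LHS]/(\int[@Leb R]_(t in B) - adjp t (lam t) i 0).
    under eq_Rintegral do rewrite -mulN1r.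
    by rewrite Rintegral_on_Z// mulN1r.
  have nu0 t : 0 <= t <= 1 -> nu `[0, t]%classic = (lam t i 0 - lam 0 i 0)%:E.
    move=> /[dup] tI /andP[t0 t1].
    rewrite nuN; [|exact: measurable_itv|exact: subI0t].
    rewrite !lamE// -[X in _ = X%:E]opprB cumul1B// -cumul0B//.
    by rewrite set_itv1 Leb_Rintegral_set1 subr0.
  exists nu, (@czero _ (measurableTypeR R) R); split.
  + by split=> [t /andP[t0 t1]|]; apply: nu0; rewrite ?I11// !ltW.
  + by split=> [t _|]; rewrite !mxE subr0.
  + move=> B mB BI; have mB' := lebT_measurable_borel mB.
    rewrite nuN// /czero adde0 -EFinN opprK.
    apply: etrans (fineK (integrable_fin_num mB' (inL1S pL mB' BI))) _.
    apply: Leb_integral_ae_eq => //; first exact: inL1_meas.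
      apply: (measMD _ (measMZ (meas01_mulz mlam) (measM_tr measM_gx)) i 0).
      apply: measMD; last exact: measMZ (measurable_cst _) (measM_tr measM_Lx).
      exact: measM_mul (measM_tr measM_fx) mlam.
    (* Because of its indicator, [adjp] agrees with the right-hand side of the adjoint equation on
       [Gd], hence almost everywhere. *)
    apply: ae01_imp aeGd => t _ tG.
    by rewrite /adjp indicE mem_set// !scale1r.
- by move=> i; rewrite mxE oppr0; apply: gx_int; exact: lebT_itv.
- move=> t _ i; exists (fun=> 0) => [k|]; first by apply: gx_int; exact: lebT_itv.
  by rewrite mxE oppr0; exact: cvg_cst.
- apply: ae01_imp stationarity => t _ [_ _ /esym].
  by rewrite /hamu scale1r.
- move=> E j mE; apply: (is_charge_int_czero (C := Cg)) => //; first exact: measM_gu.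
  apply: ae01_imp aeGd => t _ tG.
  exact: le_trans (mx_coord_le_norm _ _ _) (HCg t tG).
Qed.

End Stationarity.

End Multiplier.

(** * From the minimizer to the standing hypotheses of the construction *)

Lemma W11_measM (R : realType) n (x dx : R -> 'cV[R]_n) : W11_deriv x dx -> measM x.
Proof.
move=> [dL dE] i j; rewrite (ord1 j).
apply: meas01_eq (measurable_funD (measurable_cst (x 0 i 0)) (meas01_cumul0 (dL i))) => t tI /=.
by rewrite [RHS]dE.
Qed.

Lemma W11_bounded (R : realType) n (x dx : R -> 'cV[R]_n) : W11_deriv x dx ->
  exists2 M : R, 0 <= M & forall t, 0 <= t <= 1 -> `|x t| <= M.
Proof.
move=> [dL dE]; pose c i := `|x 0 i 0| + \int[@Leb R]_(s in `[0, 1]) `|dx s i 0|.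
have c0 i : 0 <= c i by rewrite addr_ge0// Rintegral_ge0.
exists (\sum_i c i) => [|t /[dup] tI /andP[t0 t1]]; first exact: sumr_ge0.
apply: cV_norm_le => [|i]; first exact: sumr_ge0.
apply: (@le_trans _ _ (c i)); last by rewrite (bigD1 i)//= lerDl sumr_ge0.
rewrite dE// (le_trans (ler_normD _ _))// lerD2l.
have nL := inL1_norm (dL i).
apply: le_trans (normr_Rintegral_le (lebT_itv `[0, t]) (subI0t t1) (dL i) nL _) _ => //.
rewrite -subr_ge0 cumul0B//; exact: Rintegral_ge0.
Qed.

Theorem theorem4p7 (R : realType) (n m : nat) (P : problem R n m)
    (xb : R -> 'cV[R]_n) (ub : R -> 'cV[R]_m)
    (P_regular : regular P)
    (min_xb_ub : weak_local_minimizer P xb ub)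
    (g_at_0 : ess_lim (bar (P_g P) xb ub) 0 0)
    (gu_at_0 : forall j, ess_lim (fun t => bar (grad_u (P_g P)) xb ub t 0 j) 0 0)
    (eps : R) (eps_gt0 : 0 < eps)
    (omega : R -> R)
    (omega_gt0 : forall t, 0 < t <= 1 -> 0 < omega t)
    (omega_nd : forall s t, 0 < s -> s <= t -> t <= 1 -> omega s <= omega t)
    (omega_int : (\int[@Leb R]_(t in `]0%R, 1%R]) ((omega t)^-1)%:E < +oo)%E)
    (gu_ge_omega : ae01 (fun t => - eps <= bar (P_g P) xb ub t ->
       omega t <= eucl (bar (grad_u (P_g P)) xb ub t)))
    (slater : exists (y : R -> 'cV[R]_n) (v : R -> 'cV[R]_m),
       linear_system P xb ub y v /\
       ae01 (fun t => bar (P_g P) xb ub t = 0 ->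
         (bar (grad_x (P_g P)) xb ub t *m y t
          + bar (grad_u (P_g P)) xb ub t *m v t) 0 0 < 0)) :
  (exists (lam bet : R -> 'cV[R]_n) (lam0 : R) (z : R -> R)
          (zeta : {additive_charge set (lebT R) -> \bar R}),
     [/\ multiplier P xb ub lam bet lam0 z zeta,
         forall A : set (lebT R), measurable A -> zeta A = 0%E,
         forall t, 0 <= t <= 1 -> bet t = 0 &
         0 < lam0]) /\
  (exists (lam bet : R -> 'cV[R]_n) (z : R -> R)
          (zeta : {additive_charge set (lebT R) -> \bar R}),
     [/\ multiplier P xb ub lam bet 1 z zeta,
         forall A : set (lebT R), measurable A -> zeta A = 0%E &
         forall t, 0 <= t <= 1 -> bet t = 0]).

Proof.
suff [lam [z H]] : exists (lam : R -> 'cV[R]_n) (z : R -> R),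
    multiplier P xb ub lam (fun=> 0) 1 z (@czero _ (lebT R) R).
  split; last by exists lam, (fun=> 0), z, (@czero _ (lebT R) R).
  by exists lam, (fun=> 0), 1, z, (@czero _ (lebT R) R); split.
have [[[dxb dxbW dxbf] [mub ubfin] gle _] _] := min_xb_ub.
have mxb := W11_measM dxbW.
have {}mub : measM ub by move=> i j; rewrite (ord1 j); exact: mub.
have [Mx Mx0 HMx] := W11_bounded dxbW.
have [Mu Mu0 HMu] := Linf_norm_fin ubfin.
pose M := Mx + Mu.
(* A single set of full measure carries the dynamics, the bound on [ub], the constraint and the
   growth of gu. *)
have [Gd [mGd Gd01 GdQ aeGd]] :=
  ae01_goodset (ae01_and (ae01_and dxbf HMu) (ae01_and gle gu_ge_omega)).
pose om := weight omega.
have xb_le t : 0 <= t <= 1 -> `|xb t| <= M by move=> /HMx h; rewrite (le_trans h)// lerDl.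
have ub_le t : Gd t -> `|ub t| <= M.
  by move=> /GdQ[[_ h] _]; rewrite (le_trans h)// lerDr.
have omL1 : inL1 om := inL1_weight omega_gt0 omega_nd omega_int.
have om_ge0 t : 0 <= t <= 1 -> 0 <= om t by move=> _; exact: weight_ge0.
have om_bnd d : 0 < d -> exists C, forall t, d <= t <= 1 -> om t <= C.
  by move=> d0; exists (omega d)^-1 => t; exact: weight_le.
have gb_le0 t : Gd t -> bar (P_g P) xb ub t <= 0 by move=> /GdQ[_ []].
have dxb_f t : Gd t -> dxb t = P_f P t (xb t) (ub t) by move=> /GdQ[[]].
have gu_om t : Gd t -> - eps <= bar (P_g P) xb ub t ->
    1 <= om t * eucl (bar (grad_u (P_g P)) xb ub t).
  move=> tG ge; have tI := Gd01 _ tG; have [_ [_ /(_ ge) h]] := GdQ _ tG.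
  by rewrite /om weightE// mulrC ler_pdivlMr ?omega_gt0// mul1r.
have [lam [C [mlam lam_le adjL1 lamE]]] :=
  adjoint_exists P_regular mxb mub xb_le mGd Gd01 ub_le omL1 om_ge0 om_bnd gu_om.
exists lam, (fun t => mulz P xb ub eps Gd t (lam t)).
exact: (normal_multiplier P_regular mxb mub xb_le mGd Gd01 aeGd ub_le omL1 om_ge0 om_bnd
  gb_le0 gu_om eps_gt0 dxbW dxb_f min_xb_ub mlam lam_le adjL1 lamE).
Qed.
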